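(* Let $p\ge3$, $n\ge1$, $N=p+n$, and let $X\in\mathbb{R}^p$, $Z\in\mathbb{R}^n$ have joint density $\eta^{N/2}f(\eta\{\|x-\theta\|^2+\|z\|^2\})$ with $\eta=1/\sigma^2$, where $\theta\in\mathbb{R}^p$, $\sigma>0$ are unknown and $f\ge0$ on $[0,\infty)$ with $\int_0^\infty t^{N/2-1}f(t)\,dt<\infty$; let $S=Z'Z$. For real $a,e$ let $\delta$ be the generalized Bayes estimator of $\theta$ with respect to the prior density $\pi(\theta,\eta)=\|\theta\|^{-2(p/2+a+1)}\eta^{-a-1+e}$ under the loss $\eta\|d-\theta\|^2$, i.e. $\delta=E(\eta\theta\mid X,S)/E(\eta\mid X,S)$, which (when finite) equals $$\delta=\frac{\int_{\mathbb{R}^p}\theta\,(\|X-\theta\|^2+S)^{-(n+p)/2+a-e-1}\|\theta\|^{-2(p/2+a+1)}\,d\theta}{\int_{\mathbb{R}^p}(\|X-\theta\|^2+S)^{-(n+p)/2+a-e-1}\|\theta\|^{-2(p/2+a+1)}\,d\theta}.$$ Assume the moment condition $\int_0^\infty\eta^{(n+p)/2-a+e}f(\eta)\,d\eta<\infty$. Let $c(p,n)=2(p-2)/(n+2)$. (i) If $-p/2-n/2-1<e\le-n/4-3/2$ and $-p/2-1<a\le\frac{c(p,n)(n/2+e)-p/2-1}{1+c(p,n)}$, then $\delta$ is minimax. (ii) If $e>-n/4-3/2$, $n\ge2$, and $-p/2-1<a\le a_*$, where $a_*$ is the larger solution of $g(a)=0$ with $$g(a)=(2p+2n+4e+4)a^2+a\{2p^2+2pn+12p+7n+4(p+3)e+10\}+4p^2+\tfrac{7}{2}pn+6(p+2)e+7n+13p+10,$$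 then $\delta$ is minimax.
   Context: Minimaxity is for estimating $\theta$ under the loss $(\delta-\theta)'(\delta-\theta)/\sigma^2$, with risk $E[(\delta-\theta)'(\delta-\theta)/\sigma^2]$; $X$ is minimax with constant risk, so $\delta$ is minimax iff its risk is at most that of $X$ for all $\theta,\sigma^2$. *)

(* Defs.v *)
From HB Require Import structures.
From mathcomp Require Import all_boot all_order all_algebra.
From mathcomp Require Import all_classical all_reals all_analysis.
Set Implicit Arguments. Unset Strict Implicit. Unset Printing Implicit Defensive.
Import Order.TTheory GRing.Theory Num.Theory.
Local Open Scope classical_set_scope.
Local Open Scope ring_scope.

Section Defs.
Variable R : realType.

(* Lebesgue integral over R^k (vectors 'rV[R]_k) of a nonnegative extended-real
   function, as the iterated one-dimensional Lebesgue integral (equal to the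
   integral w.r.t. k-dimensional Lebesgue measure by Tonelli). *)
Fixpoint intRn (k : nat) : ('rV[R]_k -> \bar R) -> \bar R :=
  match k return ('rV[R]_k -> \bar R) -> \bar R with
  | 0 => fun F => F 0
  | k'.+1 => fun F =>
      (\int[@lebesgue_measure R]_x intRn (fun v : 'rV[R]_k' =>
            F (row_mx (const_mx x : 'rV[R]_1) v)))%E
  end.

Definition RintRn (k : nat) (F : 'rV[R]_k -> R) : R :=
  fine (intRn (fun v => (Num.max (F v) 0)%:E) - intRn (fun v => (Num.max (- F v) 0)%:E))%E.

Definition sqnorm (k : nat) (v : 'rV[R]_k) : R := \sum_(i < k) v ord0 i ^+ 2.

Definition dens (p n : nat) (f : R -> R) (theta : 'rV[R]_p) (eta : R)
  (x : 'rV[R]_p) (z : 'rV[R]_n) : R :=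
  powR eta ((p + n)%:R / 2) * f (eta * (sqnorm (x - theta) + sqnorm z)).

Definition risk (p n : nat) (f : R -> R) (d : 'rV[R]_p -> R -> 'rV[R]_p)
  (theta : 'rV[R]_p) (eta : R) : \bar R :=
  intRn (fun x : 'rV[R]_p => intRn (fun z : 'rV[R]_n =>
    (eta * sqnorm (d x (sqnorm z) - theta) * dens f theta eta x z)%:E)).

Definition minimax (p n : nat) (f : R -> R) (d : 'rV[R]_p -> R -> 'rV[R]_p) : Prop :=
  forall (theta : 'rV[R]_p) (eta : R), 0 < eta ->
    (risk n f d theta eta <= risk n f (fun x _ => x) theta eta)%E.

Definition gbw (p n : nat) (a e : R) (x : 'rV[R]_p) (s : R) (t : 'rV[R]_p) : R :=
  powR (sqnorm (x - t) + s) (- ((n + p)%:R / 2) + a - e - 1) *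
  powR (sqnorm t) (- (p%:R / 2 + a + 1)).

Definition gbayes (p n : nat) (a e : R) (x : 'rV[R]_p) (s : R) : 'rV[R]_p :=
  \row_(i < p) (RintRn (fun t => t ord0 i * gbw n a e x s t) /
                RintRn (gbw n a e x s)).

Definition cpn (p n : nat) : R := 2 * (p%:R - 2) / (n%:R + 2).

Definition gpoly (p n : nat) (e a : R) : R :=
  let P := p%:R in let Nn := n%:R in
  (2 * P + 2 * Nn + 4 * e + 4) * a ^+ 2
  + a * (2 * P ^+ 2 + 2 * P * Nn + 12 * P + 7 * Nn + 4 * (P + 3) * e + 10)
  + 4 * P ^+ 2 + 7 / 2 * P * Nn + 6 * (P + 2) * e + 7 * Nn + 13 * P + 10.

End Defs.

(* Main.v *)
Require Import Defs.
From HB Require Import structures.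
From mathcomp Require Import all_boot all_order all_algebra.
From mathcomp Require Import all_classical all_reals all_analysis measurable_realfun.
From mathcomp Require Import ring lra.
Set Implicit Arguments. Unset Strict Implicit. Unset Printing Implicit Defensive.
Import Order.TTheory GRing.Theory Num.Theory.
Import numFieldNormedType.Exports.
Local Open Scope classical_set_scope.
Local Open Scope ring_scope.

(** With [W = |X|^2 / S], [A = p/2 + a + 1], [b = a + 2], [D = n/2 + e - a], the
    representation [B(A, m) X^-m Y^-A = \int_0^oo v^(A-1) (X + v Y)^-(m+A) dv] and
    completing the square turn the estimator into [(1 - psi W) X], where [psi] is the
    mean of [v / (1 + v)] under an explicit density on the half line.  Integration by
    parts gives, for [phi w = w psi w], the Riccati equation
    [w (1 + w) phi' = (w - phi) (A - D phi) + b phi (1 + phi)].  A barrier argument bounds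
    [phi] from above and [w phi' / phi] from below, and the parameter conditions then
    say exactly that the unbiased risk difference [Delta] is nonpositive.

    The density [f] is only measurable, so Stein's identity cannot be applied to it.
    It is applied to the weight [(T - rho)^+], [rho = |X - theta|^2 + S], instead: if [V]
    and [U] denote the losses of [X] and of the estimator, then
    [\int_(rho < T) V = \int_(rho < T) U + \int (T - rho)^+ (- Delta / 2)] for all [T].
    Hence the image under [rho] of the measure [V] dominates that of [U], and
    [\int U h(rho) <= \int V h(rho)] for every measurable [h >= 0]. *)

(** * Improper integrals over the positive half line *)

(** The sign of [b] separates two regimes. For [b < 0] Jensen's inequality keeps [phi <= A / D] and
    [phi' >= 0], and [Delta <= 0] reduces to [(n/2 + 1) A <= (p - 2) D], that is [A <= c(p,n) D].
    For [0 <= b] the term [b phi (1 + phi)] can push [phi] above [A / D], where it may start to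
    decrease. The bounds are then [phi <= A / (D - b (A + D))] and, above [A / D],
    [w phi' / phi >= - b (A + 1) / (1 - b)]. Inserting both into [Delta <= 0] and clearing
    denominators gives [(n/2 + 1) A + 2 b (2 A + 1 - b) (A + D) <= 2 (A - b) D], which is
    [g(a) <= 0] up to a factor 2. The threshold [e = - n/4 - 3/2] is the value at which the bound on
    [a] in (i) equals [-2], that is [b = 0].

    Two kinds of singularity have to be controlled. At [S = 0] the ratio [W] blows up, so Stein's
    identity in [Z] needs decay of [psi] and [psi'] at infinity. The prior is unbounded near the
    origin when [A > 0], and the first moment of the posterior weight is a signed integral; both are
    handled with integrals of nonnegative functions only. *)

Section FTCpos.
Variable R : realType.
Notation mu := (@lebesgue_measure R).
Variables f F : R -> R.
Hypothesis dF : forall x, 0 < x -> is_derive (x : R) 1 F (f x).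
Hypothesis cf : forall x, 0 < x -> {for (x : R), continuous f}.

Lemma FTC_segment_gt0 a b : 0 < a -> a < b ->
  (\int[mu]_(x in `[a, b]) (f x)%:E = (F b)%:E - (F a)%:E)%E.
Proof.
move=> a0 ab; apply: continuous_FTC2 => //.
- apply/continuous_in_subspaceT => x /[!inE]/= /[!in_itv]/= /andP[ax _].
  exact/cf/(lt_le_trans a0 ax).
- have dC x : 0 < x -> {for x, continuous F}.
    move=> x0; apply: differentiable_continuous.
    by have [] := dF x0; rewrite derivable1_diffP.
  split.
  + move=> x; rewrite in_itv/= => /andP[ax _].
    by have [] := dF (lt_trans a0 ax).
  + exact/cvg_at_right_filter/dC.
  + exact/cvg_at_left_filter/dC/(lt_trans a0 ab).
- move=> x; rewrite in_itv/= => /andP[ax _].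
  by rewrite derive1E; exact: (@derive_val _ _ _ _ _ _ _ (dF (lt_trans a0 ax))).
Qed.
End FTCpos.

Section FTCy.
Variable R : realType.
Notation mu := (@lebesgue_measure R).

(** The shift is by 2 because with [n.+1] the interval for [n = 0] would be the single point 1,
    while the fundamental theorem on a segment asks for distinct endpoints. *)
Let I (n : nat) : set R := `[n.+2%:R^-1, n.+2%:R].

Let bigcupI : \bigcup_n I n = `]0, +oo[%classic.
Proof.
apply/seteqP; split => [x [n _]|x]; rewrite /I/= !in_itv/= ?andbT.
  by move=> /andP[+ _]; apply: lt_le_trans; rewrite invr_gt0.
move=> x0; exists (Num.truncn (x + x^-1)) => //=; rewrite in_itv/=.
have xx0 : 0 <= x + x^-1 by rewrite addr_ge0// ?invr_ge0 ltW.
have /andP[_ h] := truncn_itv xx0.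
set m := Num.truncn _ in h *.
have h2 : x + x^-1 <= m.+2%:R by rewrite (le_trans (ltW h))// ler_nat.
apply/andP; split; last by rewrite (le_trans _ h2)// lerDl invr_ge0 ltW.
rewrite invf_ple ?posrE// (le_trans _ h2)// lerDr ltW//.
Qed.

Let ndI : nondecreasing_seq I.
Proof.
move=> m n mn; rewrite subsetEset => x; rewrite /I/= !in_itv/= => /andP[h1 h2].
apply/andP; split; last by rewrite (le_trans h2)// ler_nat.
by rewrite (le_trans _ h1)// lef_pV2 ?posrE// ler_nat.
Qed.

Let cvgI (f : R -> \bar R) : measurable_fun (`]0%R, +oo[%classic : set R) f ->
  (forall x, 0 < x -> (0 <= f x)%E) ->
  (\int[mu]_(x in I n) f x)%E @[n --> \oo] --> (\int[mu]_(x in `]0%R, +oo[) f x)%E.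
Proof.
move=> mf f0; rewrite -bigcupI; apply: ge0_nondecreasing_set_cvg_integral => //.
- by move=> i; exact: measurable_itv.
- move=> i; apply: measurable_funS mf => //.
  by rewrite -bigcupI; exact: bigcup_sup.
- by move=> i x Iix; apply: f0; have : (\bigcup_n I n) x by [exists i]; rewrite bigcupI/= in_itv/= andbT.
Qed.

Variables f F : R -> R.
Hypothesis dF : forall x : R, 0 < x -> is_derive x 1 F (f x).
Hypothesis cf : forall x : R, 0 < x -> {for x, continuous f}.
Variables l0 l1 : R.
Hypothesis Fl0 : F x @[x --> 0^'+] --> l0.
Hypothesis Fl1 : F x @[x --> +oo%R] --> l1.

Lemma measurable_continuous_gt0 : measurable_fun (`]0%R, +oo[%classic : set R) f.
Proof.
apply: open_continuous_measurable_fun; first exact: interval_open.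
by move=> x /[!inE]/=; rewrite in_itv/= andbT => /cf.
Qed.

Let cvgF : F n.+2%:R - F n.+2%:R^-1 @[n --> \oo] --> l1 - l0.
Proof.
have hy : n.+2%:R @[n --> \oo] --> (+oo%R : set_system R).
  have := @cvgr_idn R; rewrite -(cvg_shiftn 2) /=.
  by under eq_fun do rewrite addn2.
apply: cvgB; first exact: (cvg_pinftyP _ _).1 Fl1 _ hy.
apply: (cvg_at_rightP _ _ _).1 Fl0 (fun n => n.+2%:R^-1) _; split => [n|]; first by rewrite invr_gt0.
have := @cvgrVy R _ \oo _ (fun n => n.+2%:R^-1 : R).
case; first by apply: nearW => n; rewrite invr_gt0.
move=> h _; apply: h; rewrite [X in X @ _ --> _](_ : _ = fun n => n.+2%:R)//.
by apply/funext => n /=; rewrite invrK.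
Qed.

Lemma integral_FTC_ge0 : (forall x, 0 < x -> 0 <= f x) ->
  (\int[mu]_(x in `]0%R, +oo[) (f x)%:E = (l1 - l0)%:E)%E.
Proof.
move=> f0.
have mf : measurable_fun (`]0%R, +oo[%classic : set R) (EFin \o f).
  apply/measurable_EFinP; exact: measurable_continuous_gt0.
have h := cvgI mf f0.
have E : (fun n => \int[mu]_(x in I n) (EFin \o f) x)%E = fun n => (F n.+2%:R - F n.+2%:R^-1)%:E.
  apply/funext => n; rewrite /= FTC_segment_gt0// ?invr_gt0// invf_plt ?posrE// ?ltr1n//.
  by rewrite (@lt_trans _ _ 1) ?ltr1n// invf_lt1 ?ltr1n.
rewrite E in h; rewrite -(cvg_lim _ h)//.
by apply: cvg_lim => //; apply: cvg_EFin cvgF; exact: nearW.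
Qed.

(** For a sign-changing [f] the positive and negative parts converge separately along [I n];
    integrability makes both limits finite, so that they can be subtracted. *)
Lemma Rintegral_FTC_gt0 :
  mu.-integrable `]0%R, +oo[ (EFin \o f) ->
  (\int[mu]_(x in `]0%R, +oo[) f x)%R = l1 - l0.
Proof.
move=> intf.
have mf : measurable_fun (`]0%R, +oo[%classic : set R) (EFin \o f).
  apply/measurable_EFinP; exact: measurable_continuous_gt0.
have hp := cvgI (measurable_funepos mf) (fun x _ => funepos_ge0 _ x).
have hn := cvgI (measurable_funeneg mf) (fun x _ => funeneg_ge0 _ x).
have fp := integrable_pos_fin_num _ intf.
have fn := integrable_neg_fin_num _ intf.
have h : (\int[mu]_(x in I n) (EFin \o f) x)%E @[n --> \oo] --> (\int[mu]_(x in `]0%R, +oo[) (EFin \o f) x)%E.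
  rewrite [in X in _ --> X]integralE; under eq_fun do rewrite integralE.
  apply: cvgeB => //.
  by apply: fin_num_adde_defr; rewrite fp.
have E : (fun n => \int[mu]_(x in I n) (EFin \o f) x)%E = fun n => (F n.+2%:R - F n.+2%:R^-1)%:E.
  apply/funext => n; rewrite /= FTC_segment_gt0// ?invr_gt0// invf_plt ?posrE// ?ltr1n//.
  by rewrite (@lt_trans _ _ 1) ?ltr1n// invf_lt1 ?ltr1n.
have h2 : (\int[mu]_(x in `]0%R, +oo[) (f x)%:E = (l1 - l0)%:E)%E.
  rewrite E in h; rewrite -(cvg_lim _ h)//.
  by apply: cvg_lim => //; apply: cvg_EFin cvgF; exact: nearW.
by rewrite /Rintegral h2.
Qed.
End FTCy.

(** * The integral family behind the shrinkage function *)

Section DeriveHelpers.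
Variable R : realType.
Implicit Types (f g : R -> R) (x df dg : R).

Lemma isd_eq f x df dg : is_derive x 1 f df -> df = dg -> is_derive x 1 f dg.
Proof. by move=> h <-. Qed.

Lemma isd_add f g x df dg : is_derive x 1 f df -> is_derive x 1 g dg ->
  is_derive x 1 (fun y => f y + g y) (df + dg).
Proof. exact: is_deriveD. Qed.

Lemma isd_opp f x df : is_derive x 1 f df -> is_derive x 1 (fun y => - f y) (- df).
Proof. exact: is_deriveN. Qed.

Lemma isd_mul f g x df dg : is_derive x 1 f df -> is_derive x 1 g dg ->
  is_derive x 1 (fun y => f y * g y) (df * g x + f x * dg).
Proof.
move=> hf hg; apply: isd_eq (is_deriveM hf hg) _.
by rewrite /GRing.scale/= addrC; congr (_ + _); exact: mulrC.
Qed.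

Lemma isd_inv f x df : f x != 0 -> is_derive x 1 f df ->
  is_derive x 1 (fun y => (f y)^-1) (- df / f x ^+ 2).
Proof.
by move=> f0 hf; apply: isd_eq (is_deriveV f0 hf) _; rewrite /GRing.scale/= mulNr mulrC mulNr.
Qed.

Lemma isd_comp f g x df dg : is_derive (g x) 1 f df -> is_derive x 1 g dg ->
  is_derive x 1 (fun y => f (g y)) (df * dg).
Proof. exact: is_derive1_comp. Qed.

Lemma isd_powR f a x df : 0 < f x -> is_derive x 1 f df ->
  is_derive x 1 (fun y => f y `^ a) (a * f x `^ (a - 1) * df).
Proof.
move=> f0 hf; apply: (@isd_comp (fun z => z `^ a) f x _ _ _ hf).
exact: is_derive1_powR.
Qed.

Lemma isd_cst (c : R) x : is_derive x 1 (fun=> c) 0.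
Proof. exact: is_derive_cst. Qed.

Lemma isd_id x : is_derive x 1 (fun y : R => y) 1.
Proof. exact: is_derive_id. Qed.

Lemma isd_continuous f x df : is_derive x 1 f df -> {for x, continuous f}.
Proof.
move=> h; apply: differentiable_continuous.
by have [] := h; rewrite derivable1_diffP.
Qed.

Lemma powRS x (a : R) : 0 < x -> x `^ (a + 1) = x * x `^ a.
Proof.
move=> x0; rewrite powRD; last by rewrite (gt_eqF x0) implybT.
by rewrite powRr1 1?mulrC// ltW.
Qed.

End DeriveHelpers.

Section JFamily.
Variable R : realType.
Notation mu := (@lebesgue_measure R).
Implicit Types (A b k w v : R).

(* [jf A b k w] is the unnormalized mixing density of the estimator at [w = |X|^2 / S],
   and [1 - lam v] is the factor by which the mixture component [v] shrinks [X]. *)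
Definition lam v : R := v / (1 + v).
Definition jw A b v : R := v `^ (A - 1) * (1 + v) `^ (b - A - 1).
Definition jf A b k w v : R := jw A b v * (1 + w * lam v) `^ (- k).

Lemma lam_gt0 v : 0 < v -> 0 < lam v.
Proof. by move=> v0; rewrite divr_gt0// addr_gt0. Qed.

Lemma lam_lt1 v : 0 < v -> lam v < 1.
Proof. by move=> v0; rewrite ltr_pdivrMr ?addr_gt0// mul1r ltrDr. Qed.

Lemma jw_gt0 A b v : 0 < v -> 0 < jw A b v.
Proof. by move=> v0; rewrite mulr_gt0 ?powR_gt0 ?addr_gt0. Qed.

Lemma jwS A b v : 0 < v -> jw (A + 1) b v = jw A b v * lam v.
Proof.
move=> v0; have v1 : 0 < 1 + v by rewrite addr_gt0.
rewrite /jw /lam (_ : A + 1 - 1 = (A - 1) + 1); last by ring.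
rewrite (_ : b - A - 1 = (b - (A + 1) - 1) + 1); last by ring.
rewrite !powRS//.
by field; rewrite gt_eqF.
Qed.

Lemma base_gt0 w v : -1 < w -> 0 < v -> 0 < 1 + w * lam v.
Proof.
move=> w1 v0; have := lam_gt0 v0; have := lam_lt1 v0; nra.
Qed.

Lemma jf_gt0 A b k w v : -1 < w -> 0 < v -> 0 < jf A b k w v.
Proof. by move=> w1 v0; rewrite mulr_gt0 ?jw_gt0 ?powR_gt0 ?base_gt0. Qed.

Lemma jfS A b k w v : 0 < v -> jf (A + 1) b k w v = jf A b k w v * lam v.
Proof. by move=> v0; rewrite /jf jwS//; ring. Qed.

Lemma jfk A b k w v : -1 < w -> 0 < v ->
  jf A b k w v = jf A b (k + 1) w v * (1 + w * lam v).
Proof.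
move=> w1 v0; rewrite /jf (_ : - k = - (k + 1) + 1); last by ring.
by rewrite powRS ?base_gt0//; ring.
Qed.

Lemma isd_lam v : 0 < v -> is_derive v 1 lam ((1 + v)^-1 ^+ 2).
Proof.
move=> v0; have v1 : 1 + v != 0 by rewrite gt_eqF// addr_gt0.
apply: isd_eq (isd_mul (isd_id _) (isd_inv _ (isd_add (isd_cst 1 _) (isd_id _)))) _ => //.
by field.
Qed.

(** In the variable [l = lam v] this is [l^A (1 - l)^(1 - b) (1 + w l)^(-k)], the boundary term of
    the integration by parts. It vanishes at both ends when [0 < A] and [b < 1]. *)
Definition jG A b k w v : R :=
  v `^ A * (1 + v) `^ (b - 1 - A) * (1 + w * lam v) `^ (- k).

Definition jg A b k w v : R := A * jf A b k w v - (A + 1 - b) * jf (A + 1) b k w v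
  - k * w * (jf (A + 1) b (k + 1) w v - jf (A + 2) b (k + 1) w v).

Lemma isd_jG A b k w v : -1 < w -> 0 < v -> is_derive v 1 (jG A b k w) (jg A b k w v).
Proof.
move=> w1 v0; have v1 : 0 < 1 + v by rewrite addr_gt0.
have dv : is_derive v 1 (fun y : R => 1 + y) 1.
  by apply: isd_eq (isd_add (isd_cst _ _) (isd_id _)) _; rewrite add0r.
have dw : is_derive v 1 (fun y : R => 1 + w * lam y) (w * (1 + v)^-1 ^+ 2).
  apply: isd_eq (isd_add (isd_cst _ _) (isd_mul (isd_cst w _) (isd_lam v0))) _; ring.
have bg := base_gt0 w1 v0.
apply: isd_eq (isd_mul (isd_mul (@isd_powR _ id A _ _ v0 (isd_id v)) (@isd_powR _ (fun y => 1 + y) (b - 1 - A) _ _ v1 dv)) (@isd_powR _ (fun y => 1 + w * lam y) (- k) _ _ bg dw)) _.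
rewrite /jg (_ : A + 2 = A + 1 + 1); last by ring.
rewrite (jfS A b k w v0) !(jfS _ b (k + 1) w v0) (jfk A b k w1 v0).
rewrite /jf /jw.
rewrite (_ : A = A - 1 + 1) ?(powRS _ v0); last by ring.
rewrite (_ : A - 1 + 1 - 1 = A - 1); last by ring.
rewrite (_ : b - 1 - (A - 1 + 1) = (b - 1 - A - 1) + 1); last by ring.
rewrite (_ : b - (A - 1 + 1) - 1 = (b - 1 - A - 1) + 1); last by ring.
rewrite (_ : b - 1 - A - 1 + 1 - 1 = (b - 1 - A - 1)); last by ring.
rewrite (powRS _ v1).
rewrite (_ : - k - 1 = - (k + 1)); last by ring.
rewrite (_ : - k = - (k + 1) + 1); last by ring.
rewrite (powRS _ bg).
rewrite /lam; field; rewrite gt_eqF//.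
Qed.

Lemma jw_continuous A b v : 0 < v -> {for v, continuous (jw A b)}.
Proof.
move=> v0; have v1 : 0 < 1 + v by rewrite addr_gt0.
by apply: isd_continuous (isd_mul (@isd_powR _ id (A - 1) _ _ v0 (isd_id v)) (@isd_powR _ (fun y => 1 + y) (b - A - 1) _ _ v1 (isd_add (isd_cst _ _) (isd_id _)))).
Qed.

Lemma jf_continuous A b k w v : -1 < w -> 0 < v -> {for v, continuous (jf A b k w)}.
Proof.
move=> w1 v0; have bg := base_gt0 w1 v0.
apply: (@continuousM _ _ (jw A b)); first exact: jw_continuous.
by apply: isd_continuous (@isd_powR _ (fun y => 1 + w * lam y) (- k) _ _ bg (isd_add (isd_cst _ _) (isd_mul (isd_cst w _) (isd_lam v0)))).
Qed.
End JFamily.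

Section JIntegrals.
Variable R : realType.
Notation mu := (@lebesgue_measure R).
Implicit Types (A b k w v : R).

Lemma cvg_powR_onep_y (c : R) : 0 < c -> (1 + v) `^ (- c) @[v --> +oo%R] --> (0 : R).
Proof.
move=> c0; apply/cvgrPdist_le => e e0; near=> v.
have v0 : 0 <= v by near: v; exact: nbhs_pinfty_ge.
have ve : e `^ (- c^-1) <= 1 + v.
  rewrite (@le_trans _ _ v) ?lerDr//; near: v; exact: nbhs_pinfty_ge.
rewrite sub0r normrN ger0_norm ?powR_ge0// powRN invf_ple ?posrE ?powR_gt0//; last first.
  by rewrite ltr_pwDl.
have := @ge0_ler_powR R c (ltW c0) _ _ _ _ ve; rewrite !nnegrE powR_ge0 addr_ge0//.
move=> /(_ isT isT); apply: le_trans.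
by rewrite -powRrM mulNr mulVf ?gt_eqF// powR_inv1// ltW.
Unshelve. all: by end_near. Qed.

Lemma cvg_lam_y : lam v @[v --> +oo%R] --> (1 : R).
Proof.
have h := cvg_powR_onep_y (@ltr01 R).
have := cvgB (cvg_cst (1:R)) h; rewrite subr0 => /(_ _ _) H.
apply: (cvg_trans (near_eq_cvg (_ : {near +oo%R, _ =1 (@lam R)})) H); near=> v.
have v0 : 0 <= v by near: v; exact: nbhs_pinfty_ge.
transitivity (1 - (1 + v) `^ (- 1)); first by [].
rewrite /lam powR_inv1 ?addr_ge0//.
by field; rewrite gt_eqF// ltr_pwDl.
Unshelve. all: by end_near. Qed.

Lemma cvg_powR_at0 A : 0 < A -> (v `^ A) @[v --> 0^'+] --> (0 : R).
Proof. exact: powR_cvg0. Qed.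

Lemma cvg_lamX_0 A : 0 < A -> (lam v `^ A) @[v --> 0^'+] --> (0 : R).
Proof.
move=> A0; apply: (squeeze_cvgr _ (cvg_cst 0) (powR_cvg0 A0)); near=> v.
have v0 : 0 < v by near: v; exact: nbhs_right_gt.
rewrite powR_ge0/= ge0_ler_powR// ?nnegrE ?ltW// ?lam_gt0// /lam.
by rewrite ltr_pdivrMr ?addr_gt0// ltr_pMr// ltrDl.
Unshelve. all: by end_near. Qed.

Lemma cvg_lamX_y A : (lam v `^ A) @[v --> +oo%R] --> (1 : R).
Proof.
have c1 : {for 1, continuous (fun z : R => z `^ A)}.
  exact: (@isd_continuous R (fun z => z `^ A) 1 _ (is_derive1_powR A ltr01)).
have := @cvg_comp _ _ _ (@lam R) (fun z => z `^ A) _ _ _ cvg_lam_y c1.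
by rewrite powR1.
Qed.

Lemma cvg_onepX_0 (c : R) : ((1 + v) `^ c) @[v --> 0^'+] --> (1 : R).
Proof.
have h : 0 < 1 + (0:R) by rewrite addr0.
have := isd_continuous (@isd_powR R (fun y => 1 + y) c 0 _ h (isd_add (isd_cst _ _) (isd_id _))).
by move/cvg_at_right_filter; rewrite addr0 powR1.
Qed.

(** Both terms of the majorant have explicit primitives, [lam^A / A] and
    [(1 + v)^(b - 1) / (b - 1)], up to the factor 2. The first dominates [jw] for [v <= 1], the
    second for [v > 1]. *)
Lemma jw_le A b v : 0 < A -> b < 1 -> 0 < v ->
  jw A b v <= 2 * (lam v `^ (A - 1) * (1 + v)^-1 ^+ 2 + (1 + v) `^ (b - 2)).
Proof.
move=> A0 b1 v0; have v1 : 0 < 1 + v by rewrite addr_gt0.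
have lE : jw A b v = lam v `^ (A - 1) * (1 + v) `^ (b - 2).
  rewrite /jw /lam powRM ?ltW// ?invr_gt0// -mulrA; congr (_ * _).
  rewrite -powR_inv1 ?ltW// -powRrM -powRD ?(gt_eqF v1) ?implybT//.
  by congr (_ `^ _); ring.
have [v_le1|v_gt1] := leP v 1.
  have : (1 + v) `^ (b - 2) <= 2 * (1 + v)^-1 ^+ 2.
    rewrite powRD ?(gt_eqF v1) ?implybT// powR_invn ?(ltW v1)// -exprVn.
    apply: ler_wpM2r; first by rewrite exprn_ge0// invr_ge0 ltW.
    have h1 : (1 + v) `^ b <= (1 + v) `^ 1 by apply: ler_powR; [rewrite lerDl ltW|exact: ltW].
    rewrite (le_trans h1)// powRr1 ?(ltW v1)//; lra.
  move=> h; rewrite lE mulrDr ler_wpDr ?mulr_ge0 ?powR_ge0//.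
  by rewrite mulrCA ler_wpM2l ?powR_ge0.
rewrite lE mulrDr ler_wpDl ?mulr_ge0 ?powR_ge0 ?exprn_ge0 ?invr_ge0 1?ltW//.
rewrite ltr_pM2r ?powR_gt0//.
have l2 : 2^-1 <= lam v by rewrite /lam ler_pdivlMr// ; lra.
have l1 : lam v <= 1 by exact/ltW/lam_lt1.
have : lam v `^ (A - 1) <= lam v `^ (- 1).
  by apply: ger_powR; rewrite ?l1 ?lam_gt0//; lra.
move/le_lt_trans; apply.
rewrite powR_inv1 ?ltW ?lam_gt0// invf_plt ?posrE ?lam_gt0//.
by rewrite /lam ltr_pdivlMr//; lra.
Qed.

Lemma integrable_jw A b : 0 < A -> b < 1 ->
  mu.-integrable `]0%R, +oo[ (EFin \o jw A b).
Proof.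
move=> A0 b1.
pose g v := lam v `^ (A - 1) * (1 + v)^-1 ^+ 2 + (1 + v) `^ (b - 2).
pose G v := A^-1 * lam v `^ A + (b - 1)^-1 * (1 + v) `^ (b - 1).
have b10 : b - 1 != 0 by rewrite subr_eq0 lt_eqF.
have dG v : 0 < v -> is_derive v 1 G (g v).
  move=> v0; have v1 : 0 < 1 + v by rewrite addr_gt0.
  apply: isd_eq (isd_add (isd_mul (isd_cst A^-1 v) (@isd_powR _ (@lam R) A _ _ (lam_gt0 v0) (isd_lam v0)))
   (isd_mul (isd_cst (b-1)^-1 v) (@isd_powR _ (fun y => 1 + y) (b - 1) _ _ v1 (isd_add (isd_cst _ _) (isd_id _))))) _.
  rewrite /g (_ : b - 1 - 1 = b - 2); last by ring.
  by field; rewrite b10 (gt_eqF A0) (gt_eqF v1).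
have cg v : 0 < v -> {for v, continuous g}.
  move=> v0; have v1 : 0 < 1 + v by rewrite addr_gt0.
  have d1 : is_derive v 1 (fun y : R => (1 + y)) (0 + 1) by exact: isd_add (isd_cst _ _) (isd_id _).
  apply: isd_continuous (isd_add (isd_mul (@isd_powR _ (@lam R) (A - 1) _ _ (lam_gt0 v0) (isd_lam v0))
    (isd_mul (isd_inv _ d1) (isd_inv _ d1))) (@isd_powR _ (fun y => 1 + y) (b - 2) _ _ v1 d1)); by rewrite gt_eqF.
have Gl0 : G v @[v --> 0^'+] --> (b - 1)^-1.
  have := cvgD (cvgM (cvg_cst A^-1) (cvg_lamX_0 A0)) (cvgM (cvg_cst (b-1)^-1) (cvg_onepX_0 (b - 1))).
  by rewrite mulr0 mulr1 add0r => /(_ _ _ _ _ _) H; exact: H.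
have Gly : G v @[v --> +oo%R] --> A^-1.
  have b1' : 0 < 1 - b by rewrite subr_gt0.
  have := cvgD (cvgM (cvg_cst A^-1) (cvg_lamX_y A)) (cvgM (cvg_cst (b-1)^-1) (cvg_powR_onep_y b1')).
  by rewrite mulr0 mulr1 addr0 opprB => /(_ _ _ _ _ _) H; exact: H.
have g0 v : 0 < v -> 0 <= g v.
  by move=> v0; rewrite addr_ge0 ?mulr_ge0 ?powR_ge0 ?exprn_ge0 ?invr_ge0 ?addr_ge0 ?ltW.
have ig := integral_FTC_ge0 dG cg Gl0 Gly g0.
have mg := measurable_continuous_gt0 cg.
have mw : measurable_fun (`]0%R, +oo[%classic : set R) (jw A b).
  exact: measurable_continuous_gt0 (@jw_continuous R A b).
have intg : mu.-integrable `]0%R, +oo[ (EFin \o (fun v => 2 * g v)).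
  apply/integrableP; split; first by apply/measurable_EFinP; exact: measurable_funM.
  apply: (@le_lt_trans _ _ (2%:E * \int[mu]_(x in `]0%R, +oo[) (g x)%:E)%E); last first.
    by rewrite ig -EFinM ltry.
  rewrite -ge0_integralZl//=; last 2 first.
  - exact/measurable_EFinP.
  - by move=> x; rewrite in_itv/= andbT lee_fin => /g0.
  rewrite le_eqVlt; apply/orP; left; apply/eqP; apply: eq_integral => v.
  rewrite inE/= in_itv/= andbT => v0.
  by rewrite ger0_norm ?mulr_ge0 ?g0.
apply: (le_integrable _ _ _ intg) => //.
  exact/measurable_EFinP.
move=> v /=; rewrite in_itv/= andbT => v0; rewrite lee_fin.
rewrite !ger0_norm ?jw_le//; last exact/ltW/jw_gt0.
by rewrite mulr_ge0// g0.
Qed.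

End JIntegrals.

Section JTheory.
Variable R : realType.
Notation mu := (@lebesgue_measure R).
Implicit Types (A b k w v : R).
Notation pos := (`]0%R, +oo[%classic : set R).

Let mpos : @measurable _ (measurableTypeR R) pos.
Proof. exact: measurable_itv. Qed.

(** If the integral were zero, [f] would vanish almost everywhere on the half line, which has
    infinite measure. *)
Lemma Rintegral_pos_gt0 (f : R -> R) : mu.-integrable pos (EFin \o f) ->
  (forall v, 0 < v -> 0 < f v) -> 0 < (\int[mu]_(v in pos) f v)%R.
Proof.
move=> intf f0.
have fge0 v : pos v -> 0 <= f v by rewrite /= in_itv/= andbT => /f0/ltW.
rewrite lt0r Rintegral_ge0// andbT; apply/eqP => I0.
have mf := measurable_int mu intf.
have e0 : (\int[mu]_(x in pos) `|(EFin \o f) x| = 0)%E.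
  rewrite (_ : 0%E = (\int[mu]_(v in pos) f v)%R%:E); last by rewrite I0.
  rewrite /Rintegral fineK; last exact: integrable_fin_num.
  by apply: eq_integral => v /set_mem vp /=; rewrite ger0_norm// fge0.
have /ae_eq_integral_abs := e0; move=> /(_ mpos mf).
case=> N [mN N0 sub].
have : (mu pos <= mu N)%E.
  apply: le_measure; rewrite ?inE//.
  move=> v pv; apply: sub => /= h; have := h pv.
  by case=> fv0; move: pv; rewrite /= in_itv/= andbT => /f0; rewrite fv0 ltxx.
by rewrite N0 lebesgue_measure_itv/= ltry/= ?oppr0 ?adde0 ?addye.
Qed.

(** Adding the powers of the two extreme values of the base covers both signs of [k] at once. The
    bound is uniform in [v] and in [w] between [u] and [u'], as domination under the integral sign
    requires. *)
Lemma base_powR_le (u u' k w v : R) : -1 < u -> u <= w -> w <= u' -> 0 < v ->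
  (1 + w * lam v) `^ (- k) <= Num.min 1 (1 + u) `^ (- k) + Num.max 1 (1 + u') `^ (- k).
Proof.
move=> u1 uw wu' v0.
have l0 := lam_gt0 v0; have l1 := lam_lt1 v0.
have m0 : 0 < Num.min 1 (1 + u) by rewrite lt_min ltr01; lra.
have M0 : 0 < Num.max 1 (1 + u') by rewrite lt_max ltr01.
have mx : Num.min 1 (1 + u) <= 1 + w * lam v.
  rewrite ge_min; have [w0|w0] := leP 0 w.
    by rewrite lerDl mulr_ge0// ltW.
  by apply/orP; right; nra.
have xM : 1 + w * lam v <= Num.max 1 (1 + u').
  rewrite le_max; have [w0|w0] := leP w 0.
    by rewrite gerDl mulr_le0_ge0// ltW.
  by apply/orP; right; nra.
have x0 : 0 < 1 + w * lam v by exact: lt_le_trans mx.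
have [k0|k0] := leP k 0.
  rewrite ler_wpDl ?powR_ge0//; apply: ge0_ler_powR; rewrite ?nnegrE ?oppr_ge0//; exact: ltW.
rewrite ler_wpDr ?powR_ge0// !powRN lef_pV2 ?posrE ?powR_gt0//.
by apply: ge0_ler_powR; rewrite ?nnegrE//; exact: ltW.
Qed.

Lemma measurable_jf A b k w : -1 < w -> measurable_fun pos (jf A b k w).
Proof. by move=> w1; apply: measurable_continuous_gt0 => v; exact: jf_continuous. Qed.

Lemma integrable_jf A b k w : 0 < A -> b < 1 -> -1 < w ->
  mu.-integrable pos (EFin \o jf A b k w).
Proof.
move=> A0 b1 w1.
set C := Num.min 1 (1 + w) `^ (- k) + Num.max 1 (1 + w) `^ (- k).
have iC : mu.-integrable pos (EFin \o (fun v => C * jw A b v)).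
  have := integrableZl mpos C (integrable_jw A0 b1).
  by apply: eq_integrable => //=; exact: mpos.
apply: (le_integrable _ _ _ iC) => //.
  by apply/measurable_EFinP; exact: measurable_jf.
move=> v /=; rewrite in_itv/= andbT => v0; rewrite lee_fin.
rewrite ger0_norm; last exact/ltW/jf_gt0.
apply: le_trans (ler_norm _); rewrite mulrC /jf ler_wpM2l//; first exact/ltW/jw_gt0.
exact: base_powR_le.
Qed.

(** With [l = lam v] the integrand becomes [l^(A-1) (1 - l)^(-b) (1 + w l)^(-k) dl] on [(0, 1)]:
    this is Euler's integral for [B(A, 1 - b) 2F1(k, A; A + 1 - b; -w)]. Hence the standing
    conditions [0 < A], [b < 1] and [-1 < w]. *)
Definition J A b k w : R := (\int[mu]_(v in pos) jf A b k w v)%R.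

Lemma J_gt0 A b k w : 0 < A -> b < 1 -> -1 < w -> 0 < J A b k w.
Proof.
move=> A0 b1 w1; apply: Rintegral_pos_gt0; first exact: integrable_jf.
by move=> v; exact: jf_gt0.
Qed.

Let eqR (f g : R -> R) : (forall v, 0 < v -> f v = g v) ->
  (\int[mu]_(v in pos) f v = \int[mu]_(v in pos) g v)%R.
Proof.
by move=> fg; apply: eq_Rintegral => v; rewrite inE/= in_itv/= andbT; exact: fg.
Qed.

Let intZ (c : R) (f : R -> R) : mu.-integrable pos (EFin \o f) ->
  mu.-integrable pos (EFin \o (fun v => c * f v)).
Proof.
move=> h; have := integrableZl mpos c h.
by apply: eq_integrable => //=; exact: mpos.
Qed.

Lemma J_rec A b k w : 0 < A -> b < 1 -> -1 < w ->
  J A b k w = J A b (k + 1) w + w * J (A + 1) b (k + 1) w.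
Proof.
move=> A0 b1 w1; have A1 : 0 < A + 1 by rewrite addr_gt0.
rewrite /J -RintegralZl//; last exact: integrable_jf.
rewrite -RintegralD//; last 2 first.
- exact: integrable_jf.
- exact/intZ/integrable_jf.
apply: eqR => v v0; rewrite jfS// jfk//; ring.
Qed.

Lemma cvg_jG0 A b k w : 0 < A -> b < 1 -> -1 < w -> jG A b k w v @[v --> 0^'+] --> (0 : R).
Proof.
move=> A0 b1 w1.
set C := Num.min 1 (1 + w) `^ (- k) + Num.max 1 (1 + w) `^ (- k).
have h : v `^ A * ((1 + v) `^ (b - 1 - A) * C) @[v --> 0^'+] --> (0 : R).
  have := cvgM (cvg_powR_at0 A0) (cvgM (cvg_onepX_0 (b - 1 - A)) (cvg_cst C)).
  by rewrite mul0r => /(_ _ _ _) H; exact: H.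
apply: (squeeze_cvgr _ (cvg_cst 0) h); near=> v.
have v0 : 0 < v by near: v; exact: nbhs_right_gt.
rewrite /jG !mulr_ge0 ?powR_ge0//= -mulrA !ler_wpM2l ?powR_ge0//.
exact: base_powR_le.
Unshelve. all: by end_near. Qed.

Lemma cvg_jGy A b k w : 0 < A -> b < 1 -> -1 < w -> jG A b k w v @[v --> +oo%R] --> (0 : R).
Proof.
move=> A0 b1 w1.
set C := Num.min 1 (1 + w) `^ (- k) + Num.max 1 (1 + w) `^ (- k).
have b1' : 0 < 1 - b by rewrite subr_gt0.
have h : (1 + v) `^ (- (1 - b)) * C @[v --> +oo%R] --> (0 : R).
  have := cvgM (cvg_powR_onep_y b1') (cvg_cst C).
  by rewrite mul0r => /(_ _) H; exact: H.
apply: (squeeze_cvgr _ (cvg_cst 0) h); near=> v.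
have v0 : 0 < v by near: v; exact: nbhs_pinfty_gt.
have v1 : 0 < 1 + v by rewrite addr_gt0.
rewrite /jG !mulr_ge0 ?powR_ge0//=.
apply: ler_pM; rewrite ?mulr_ge0 ?powR_ge0//; last exact: base_powR_le.
rewrite (_ : b - 1 - A = - A + - (1 - b)); last by ring.
rewrite powRD ?(gt_eqF v1) ?implybT// mulrA ler_piMl ?powR_ge0//.
rewrite powRN ler_pdivrMr ?powR_gt0// mul1r ge0_ler_powR ?nnegrE ?(ltW A0) ?(ltW v0) ?(ltW v1)//.
by rewrite lerDr.
Unshelve. all: by end_near. Qed.

Lemma J_ibp A b k w : 0 < A -> b < 1 -> -1 < w ->
  A * J A b k w - (A + 1 - b) * J (A + 1) b k w =
  k * w * (J (A + 1) b (k + 1) w - J (A + 2) b (k + 1) w).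
Proof.
move=> A0 b1 w1; have A1 : 0 < A + 1 by rewrite addr_gt0.
have A2 : 0 < A + 2 by rewrite addr_gt0.
have i1 : mu.-integrable pos (EFin \o (fun v => A * jf A b k w v - (A + 1 - b) * jf (A + 1) b k w v)).
  have := integrableB mpos (intZ A (integrable_jf k A0 b1 w1)) (intZ (A + 1 - b) (integrable_jf k A1 b1 w1)).
  by apply: eq_integrable => //; exact: mpos.
have i2 : mu.-integrable pos (EFin \o (fun v => jf (A + 1) b (k + 1) w v - jf (A + 2) b (k + 1) w v)).
  have := integrableB mpos (integrable_jf (k + 1) A1 b1 w1) (integrable_jf (k + 1) A2 b1 w1).
  by apply: eq_integrable => //; exact: mpos.
have i3 : mu.-integrable pos (EFin \o jg A b k w).
  have := integrableB mpos i1 (intZ (k * w) i2).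
  by apply: eq_integrable => //; exact: mpos.
have cj v : 0 < v -> {for v, continuous (jg A b k w)}.
  move=> v0; have cf A' k' := @jf_continuous R A' b k' w v w1 v0.
  apply: continuousB; first by apply: continuousB; apply: continuousM; (exact: cst_continuous || exact: cf).
  by apply: continuousM; [exact: cst_continuous|apply: continuousB; exact: cf].
have dG v : 0 < v -> is_derive v 1 (jG A b k w) (jg A b k w v) by exact: isd_jG.
have := Rintegral_FTC_gt0 dG cj (cvg_jG0 k A0 b1 w1) (cvg_jGy k A0 b1 w1) i3.
rewrite subrr /jg RintegralB//; last exact: intZ.
rewrite RintegralB//; last 2 first.
- exact/intZ/integrable_jf.
- exact/intZ/integrable_jf.
rewrite !RintegralZl//; last 2 first.
- exact: integrable_jf.
- exact: integrable_jf.
rewrite RintegralB//; last 2 first.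
- exact: integrable_jf.
- exact: integrable_jf.
by move/eqP; rewrite subr_eq0 => /eqP.
Qed.

Lemma isd_jfw A b k w v : -1 < w -> 0 < v ->
  is_derive w 1 (fun w => jf A b k w v) (- k * jf (A + 1) b (k + 1) w v).
Proof.
move=> w1 v0; have bg := base_gt0 w1 v0.
apply: isd_eq (isd_mul (isd_cst (jw A b v) _) (@isd_powR _ (fun w => 1 + w * lam v) (- k) _ _ bg
  (isd_add (isd_cst _ _) (isd_mul (isd_id _) (isd_cst (lam v) _))))) _.
by rewrite jfS// /jf opprD; ring.
Qed.

Lemma isd_J A b k w : 0 < A -> b < 1 -> -1 < w ->
  is_derive w 1 (J A b k) (- k * J (A + 1) b (k + 1) w).
Proof.
move=> A0 b1 w1; have A1 : 0 < A + 1 by rewrite addr_gt0.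
(* [u] is the midpoint of [-1] and [w], so the whole interval around [w] stays to the right of the
   singularity at [-1]. *)
set u := (w - 1) / 2; set u' := w + 1.
have u1 : -1 < u by rewrite /u ltr_pdivlMr//; lra.
have uw : u < w by rewrite /u ltr_pdivrMr//; lra.
have Iw : `]u, u'[%classic w by rewrite /= in_itv/= uw/= ltrDl.
have I1 x : `]u, u'[%classic x -> -1 < x by rewrite /= in_itv/= => /andP[+ _]; exact: lt_trans.
set C := Num.min 1 (1 + u) `^ (- (k + 1)) + Num.max 1 (1 + u') `^ (- (k + 1)).
have C0 : 0 <= C by rewrite addr_ge0 ?powR_ge0.
pose G v := `|k| * C * jw (A + 1) b v.
have iF x : `]u, u'[%classic x -> mu.-integrable pos (EFin \o jf A b k x).
  by move=> /I1 x1; exact: integrable_jf.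
have dF x v : `]u, u'[%classic x -> pos v -> derivable (fun w => jf A b k w v) x 1.
  move=> /I1 x1; rewrite /= in_itv/= andbT => v0.
  by have [] := isd_jfw A b k x1 v0.
have d1E x v : `]u, u'[%classic x -> pos v -> partial1of2 (jf A b k) x v = - k * jf (A + 1) b (k + 1) x v.
  move=> /I1 x1; rewrite /= in_itv/= andbT => v0.
  by rewrite partial1of2E; exact: (@derive_val _ _ _ _ _ _ _ (isd_jfw A b k x1 v0)).
have G0 v : 0 <= G v by rewrite !mulr_ge0 ?powR_ge0.
have iG : mu.-integrable pos (EFin \o G) by apply: intZ; exact: integrable_jw.
have Gub x v : `]u, u'[%classic x -> pos v -> `|partial1of2 (jf A b k) x v| <= G v.
  move=> Ix pv; rewrite d1E//; have x1 := I1 _ Ix.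
  move: pv Ix; rewrite /= !in_itv/= andbT => v0 /andP[ux xu'].
  rewrite normrM normrN /G -mulrA ler_wpM2l// ger0_norm; last exact/ltW/jf_gt0.
  rewrite mulrC /jf ler_wpM2l ?powR_ge0 ?mulr_ge0 ?powR_ge0//.
  by apply: base_powR_le => //; exact: ltW.
have h1 := derivable_under_integral mpos Iw iF dF G0 iG Gub.
have h2 := differentiation_under_integral mpos Iw iF dF G0 iG Gub.
apply: DeriveDef => //; rewrite -derive1E h2 /J -RintegralZl//; last exact: integrable_jf.
by apply: eq_Rintegral => v /set_mem pv; exact: d1E.
Qed.

End JTheory.

(** * The shrinkage function and its Riccati equation *)

Section Barrier.
Variable R : realType.

(** At a maximum point [c] of [f] on [[0, w]] with [f c > Y], continuity keeps [f] above [Y]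
    slightly to the left of [c]. There the derivative is negative, so the mean value theorem
    produces a value larger than the maximum. *)
Lemma barrier_le (f df : R -> R) (Y : R) : f 0 <= Y ->
  (forall w : R, 0 <= w -> is_derive w 1 f (df w)) ->
  (forall w : R, 0 < w -> Y < f w -> df w < 0) ->
  forall w, 0 <= w -> f w <= Y.
Proof.
move=> f0 dfE neg w w0; rewrite leNgt; apply/negP => Yw.
have cf x : 0 <= x -> {for x, continuous f} by move=> x0; exact: isd_continuous (dfE x x0).
have cw (a b : R) : 0 <= a -> {within `[a, b], continuous f}.
  move=> a0; apply/continuous_in_subspaceT => x /[!inE]/= /[!in_itv]/= /andP[ax _].
  by apply: cf; exact: le_trans ax.
have [c cI cmax] := EVT_max w0 (cw 0 w (lexx _)).
have Yc : Y < f c.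
  by apply: (lt_le_trans Yw); apply: cmax; rewrite in_itv/= w0 lexx.
move: cI; rewrite in_itv/= => /andP[]; rewrite le_eqVlt => /predU1P[c0|c0 cw'].
  by move: Yc; rewrite -c0 ltNge f0.
have /nbhs_ballP[e /= e0 he] : \forall y \near c, Y < f y.
  exact: (cvgr_gt _ (cf c (ltW c0))).
pose x := c - Num.min e c / 2.
have m0 : 0 < Num.min e c by rewrite lt_min e0.
have mc : Num.min e c <= c by rewrite ge_min lexx orbT.
have me : Num.min e c <= e by rewrite ge_min lexx.
have x0 : 0 < x by rewrite /x; lra.
have xc : x < c by rewrite /x; lra.
have [||z] := @MVT R f df x c xc.
- by move=> z; rewrite in_itv/= => /andP[xz _]; apply/dfE/ltW/(lt_trans x0).
- exact/cw/ltW.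
rewrite in_itv/= => /andP[xz zc] E.
have : df z < 0.
  apply: neg; first exact: lt_trans xz.
  apply: he; rewrite /ball/= ger0_norm ?subr_ge0 ?ltW//; rewrite /x in xz; lra.
have : f x <= f c by apply: cmax; rewrite in_itv/= (ltW x0)/= (le_trans (ltW xc)).
by nra.
Qed.
End Barrier.

Section Psi.
Variable R : realType.
Notation mu := (@lebesgue_measure R).
Notation pos := (`]0%R, +oo[%classic : set R).
Implicit Types (A b k w v D : R).

Definition psi A b k w : R := J (A + 1) b k w / J A b k w.

Definition dpsi A b k w : R :=
  k * (J (A + 1) b k w * J (A + 1) b (k + 1) w - J A b k w * J (A + 2) b (k + 1) w)
  / J A b k w ^+ 2.

Lemma psi_gt0 A b k w : 0 < A -> b < 1 -> -1 < w -> 0 < psi A b k w.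
Proof. by move=> A0 b1 w1; rewrite divr_gt0 ?J_gt0// addr_gt0. Qed.

Lemma isd_psi A b k w : 0 < A -> b < 1 -> -1 < w ->
  is_derive w 1 (psi A b k) (dpsi A b k w).
Proof.
move=> A0 b1 w1; have A1 : 0 < A + 1 by rewrite addr_gt0.
have J0 : J A b k w != 0 by rewrite gt_eqF// J_gt0.
apply: isd_eq (isd_mul (isd_J k A1 b1 w1) (isd_inv J0 (isd_J k A0 b1 w1))) _.
rewrite (_ : A + 1 + 1 = A + 2); last by ring.
rewrite /dpsi; move: (J A b k w) (J (A + 1) b k w) (J (A + 1) b (k + 1) w) (J (A + 2) b (k + 1) w) J0.
by move=> a0 a1 c1 c2 h; field.
Qed.

Lemma J_lt A b k w : 0 < A -> b < 1 -> -1 < w -> J (A + 1) b k w < J A b k w.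
Proof.
move=> A0 b1 w1; have A1 : 0 < A + 1 by rewrite addr_gt0.
rewrite -subr_gt0 /J -RintegralB//; [|exact: integrable_jf..].
apply: Rintegral_pos_gt0.
  have := integrableB (measurable_itv _ : @measurable _ (measurableTypeR R) pos) (integrable_jf k A0 b1 w1) (integrable_jf k A1 b1 w1).
  by apply: eq_integrable => //; exact: (measurable_itv _ : @measurable _ (measurableTypeR R) pos).
move=> v v0; rewrite jfS// subr_gt0 gtr_pMr ?lam_lt1// jf_gt0//.
Qed.

Lemma psi_lt1 A b k w : 0 < A -> b < 1 -> -1 < w -> psi A b k w < 1.
Proof. by move=> A0 b1 w1; rewrite ltr_pdivrMr ?J_gt0// mul1r J_lt. Qed.

(** The bound [A / (A + 1 - b)] is the value at [w = 0], the mean of a Beta law with parameters [A]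
    and [1 - b]. For [0 <= k] the right side of [J_ibp] is nonnegative: the factor [(1 + w l)^(-k)]
    favours small [l]. *)
Lemma psi_le A b k w : 0 < A -> b < 1 -> 0 <= k -> 0 <= w ->
  psi A b k w * (A + 1 - b) <= A.
Proof.
move=> A0 b1 k0 w0; have w1 : -1 < w by rewrite (lt_le_trans _ w0)// oppr_lt0.
have J0 := J_gt0 k A0 b1 w1.
have A1 : 0 < A + 1 by rewrite addr_gt0.
rewrite /psi mulrAC ler_pdivrMr// -subr_ge0 [X in _ - X]mulrC J_ibp//.
rewrite !mulr_ge0// subr_ge0 (_ : A + 2 = A + 1 + 1); last by ring.
exact/ltW/J_lt.
Qed.

(* J_ibp at (A, b) plus w times J_ibp at (A+1, b). *)
Lemma J_moment2 A b D w : 0 < A -> b < 1 -> 0 <= w ->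
  let k := A + D + 1 in
  A * J A b k w - (A + 1 - b) * J (A + 1) b k w - D * w * J (A + 1) b k w
  + (D - 1 + b) * w * J (A + 2) b k w = 0.
Proof.
move=> A0 b1 w0 k; have w1 : -1 < w by rewrite (lt_le_trans _ w0)// oppr_lt0.
have A1 : 0 < A + 1 by rewrite addr_gt0.
have A2 : 0 < A + 2 by rewrite addr_gt0.
have := J_ibp k A0 b1 w1; have := J_ibp k A1 b1 w1.
have := J_rec k A1 b1 w1; have := J_rec k A2 b1 w1.
rewrite (_ : A + 1 + 1 = A + 2); last by ring.
rewrite (_ : A + 1 + 2 = A + 2 + 1); last by ring.
move: (J A b k w) (J (A + 1) b k w) (J (A + 2) b k w) (J (A + 1) b (k + 1) w).
move: (J (A + 2) b (k + 1) w) (J (A + 2 + 1) b (k + 1) w).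
move=> c2 c3 a0 a1 a2 c1 -> -> F1 F0; rewrite /k in F1 F0 *.
by have := congr1 (fun z => w * z) F1; lra.
Qed.

(** [J_rec] and [J_ibp] express the two integrals of level [k + 1] that occur in [dpsi] through
    those of level [k]. In the proof the product [k * w * (1 + w) * c2] is kept whole, so no
    division by [w] or [1 + w] takes place. *)
Lemma psi_riccati A b D w : 0 < A -> b < 1 -> 0 < w ->
  let k := A + D + 1 in let m := psi A b k w in
  (1 + w) * (m + w * dpsi A b k w) = (1 - m) * (A - D * (w * m)) + b * m * (1 + w * m).
Proof.
move=> A0 b1 w0 k m; have w1 : -1 < w by rewrite (lt_trans _ w0)// oppr_lt0.
have A1 : 0 < A + 1 by rewrite addr_gt0.
have J0 := J_gt0 k A0 b1 w1.
have := J_ibp k A0 b1 w1; have := J_rec k A1 b1 w1.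
rewrite (_ : A + 1 + 1 = A + 2); last by ring.
rewrite /m /psi /dpsi; set a0 := J A b k w in J0 *; set a1 := J (A + 1) b k w.
set c1 := J (A + 1) b (k + 1) w; set c2 := J (A + 2) b (k + 1) w => E F.
have c1E : c1 = a1 - w * c2 by rewrite E; ring.
rewrite c1E in F *.
have G : k * w * (1 + w) * c2 = k * w * a1 - A * a0 + (A + 1 - b) * a1 by rewrite -(subrK (A * a0) (_ - _ + _)); nra.
apply: (mulIf (_ : a0 ^+ 2 != 0)); first by rewrite expf_neq0// gt_eqF.
have -> : (1 + w) * (a1 / a0 + w * (k * (a1 * (a1 - w * c2) - a0 * c2) / a0 ^+ 2)) * a0 ^+ 2
  = (1 + w) * a1 * a0 + k * w * (1 + w) * a1 ^+ 2 - (w * a1 + a0) * (k * w * (1 + w) * c2).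
  by field; rewrite gt_eqF.
rewrite G /k; field; rewrite gt_eqF//.
Qed.

Lemma jfSb A b k w v : 0 < v -> jf A (b + 1) k w v = jf A b k w v * (1 + v).
Proof.
move=> v0; have v1 : 0 < 1 + v by rewrite addr_gt0.
rewrite /jf /jw (_ : b + 1 - A - 1 = b - A - 1 + 1); last by ring.
by rewrite powRS//; ring.
Qed.

(** This is [1 / (1 + v) = 1 - lam v]. It raises [b] by one, and the integrals at [b + 1] converge
    because [b < 0]. *)
Lemma J_shift A b k w : 0 < A -> b < 0 -> -1 < w ->
  J A b k w = J A (b + 1) k w - J (A + 1) (b + 1) k w.
Proof.
move=> A0 b0 w1; have A1 : 0 < A + 1 by rewrite addr_gt0.
have b1 : b + 1 < 1 by rewrite gtrDr.
rewrite /J -RintegralB//; [|exact: integrable_jf..].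
apply: eq_Rintegral => v; rewrite inE/= in_itv/= andbT => v0.
have v1 : 0 < 1 + v by rewrite addr_gt0.
by rewrite jfS// jfSb// /lam; field; rewrite gt_eqF.
Qed.

(* Jensen's inequality for the convex function l |-> l (1 + w l) / (1 - l),
   in the form of a tangent line at psi. *)
Lemma psi_neg_b A b D w : 0 < A -> b < 0 -> 0 <= w ->
  - b * (psi A b (A + D + 1) w * (1 + w * psi A b (A + D + 1) w))
  <= (1 - psi A b (A + D + 1) w) * (A - D * (w * psi A b (A + D + 1) w)).
Proof.
move=> A0 b0 w0; set m := psi _ _ _ _; have w1 : -1 < w by rewrite (lt_le_trans _ w0)// oppr_lt0.
have A1 : 0 < A + 1 by rewrite addr_gt0.
have b1 : b < 1 by rewrite (lt_trans b0).
have b1' : b + 1 < 1 by rewrite gtrDr.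
set k := A + D + 1 in m *.
have J0 := J_gt0 k A0 b1 w1.
have m1 : 0 < 1 - m by rewrite subr_gt0 psi_lt1.
have mE : J (A + 1) b k w = m * J A b k w by rewrite /m /psi divfK// gt_eqF.
(* Integration by parts at [(A, b + 1, k - 1)]. Divided by [J A b k w], it says that
   [A - D * (w * m)] is [- b] times the mean of [v * (1 + w * lam v)], which is
   [l (1 + w l) / (1 - l)] for [l = lam v]. *)
have E1 : A * J A b k w - D * w * J (A + 1) b k w = - b * J (A + 1) (b + 1) (k - 1) w.
  have := J_ibp (k - 1) A0 b1' w1; have := J_rec (k - 1) A0 b1 w1.
  have := J_shift (k - 1) A0 b0 w1; have := J_shift k A1 b0 w1.
  rewrite subrK (_ : A + 1 + 1 = A + 2); last by ring.
  have kE : k - 1 = A + D by rewrite /k addrK.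
  move: (J A b k w) (J (A + 1) b k w) (J (A + 1) (b + 1) k w) (J (A + 2) (b + 1) k w).
  move: (J A b (k - 1) w) (J A (b + 1) (k - 1) w) (J (A + 1) (b + 1) (k - 1) w).
  move=> a0' c0 c1 a0 a1 d1 d2 -> -> E F; rewrite kE in F *.
  by have := congr1 (fun z => A * z) E; lra.
(* Intercept and slope of the tangent at [l = m] to [l (1 + w l) / (1 - l)], written as
   [- (1 + w) - w l + (1 + w) / (1 - l)]. *)
pose al := - (1 + w) + (1 + w) * (2 / (1 - m) - (1 - m)^-1 ^+ 2).
pose be := - w + (1 + w) * (1 - m)^-1 ^+ 2.
have tangent : al * J A b k w + be * J (A + 1) b k w <= J (A + 1) (b + 1) (k - 1) w.
  have mpos : @measurable _ (measurableTypeR R) pos by exact: measurable_itv.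
  have intZ (c A' : R) : 0 < A' -> mu.-integrable pos (EFin \o (fun v => c * jf A' b k w v)).
    move=> A0'; have := integrableZl mpos c (integrable_jf k A0' b1 w1).
    by apply: eq_integrable => //; exact: mpos.
  have intD : mu.-integrable pos (EFin \o (fun v => al * jf A b k w v + be * jf (A + 1) b k w v)).
    have := integrableD mpos (intZ al _ A0) (intZ be _ A1).
    by apply: eq_integrable => //; exact: mpos.
  rewrite /J -!RintegralZl//; [|exact: integrable_jf..].
  rewrite -RintegralD//; [|exact: intZ..].
  apply: le_Rintegral => //; first exact: integrable_jf.
  move=> v; rewrite /= in_itv/= andbT => v0.
  have v1 : 0 < 1 + v by rewrite addr_gt0.
  have -> : jf (A + 1) (b + 1) (k - 1) w v = jf A b k w v * (v * (1 + w * lam v)).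
    rewrite jfSb// jfS// jfk// subrK /lam; field; by rewrite gt_eqF.
  rewrite jfS// -subr_ge0 (_ : _ - _ = jf A b k w v *
     (v * (1 + w * lam v) - al - be * lam v)); last by ring.
  rewrite mulr_ge0//; first exact/ltW/jf_gt0.
  rewrite (_ : _ - _ = (1 + w) * (1 + v) * ((1 - m - (1 + v)^-1) / (1 - m)) ^+ 2).
    by rewrite mulr_ge0 ?sqr_ge0// mulr_ge0 ?(ltW v1)// addr_ge0.
  rewrite /al /be /lam; field; by rewrite !gt_eqF.
have E2 : A - D * (w * m) = - b * (J (A + 1) (b + 1) (k - 1) w / J A b k w).
  apply: (mulIf (_ : J A b k w != 0)); first by rewrite gt_eqF.
  rewrite -mulrA divfK ?gt_eqF// -E1 mE.
  by move: (J A b k w) => a0; ring.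
rewrite E2 [X in _ <= X]mulrCA ler_wpM2l//; first by rewrite oppr_ge0 ltW.
rewrite [X in _ <= X]mulrA ler_pdivlMr//.
have := ler_wpM2l (ltW m1) tangent; rewrite mE; apply: le_trans.
rewrite le_eqVlt; apply/orP; left; apply/eqP.
by rewrite /al /be; move: (J A b k w) => a0; field; rewrite gt_eqF.
Qed.

End Psi.

(** * Bounds on [phi] and its derivative, and the sign of [Delta] *)

Section PsiBounds.
Variable R : realType.
Implicit Types (A b k w v D : R).

(** Put [y = w * psi]. Above [A / D], [psi_le] in the form [m (1 - b) <= A (1 - m)] bounds the right
    side of the Riccati equation by [m (b (1 + y) - (1 - b) (D y - A) / A)]. The bracket changes
    sign exactly at [y = A / (D - b (A + D))], which therefore serves as the barrier. *)
Lemma phi_le A b D w : 0 < A -> 0 <= b -> b < 1 -> 0 <= A + D ->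
  0 < D - b * (A + D) -> 0 <= w ->
  w * psi A b (A + D + 1) w * (D - b * (A + D)) <= A.
Proof.
move=> A0 b0 b1 AD0 Dd w0; have : 0 <= A + D + 1 by rewrite addr_ge0.
set k := A + D + 1 => k0.
rewrite -ler_pdivlMr//.
pose f x : R := x * psi A b k x.
pose df x : R := psi A b k x + x * dpsi A b k x.
apply: (@barrier_le R f df (A / (D - b * (A + D)))) => //.
- by rewrite /f mul0r divr_ge0// ltW.
- move=> x x0; have x1 : -1 < x by rewrite (lt_le_trans _ x0)// oppr_lt0.
  by apply: isd_eq (isd_mul (isd_id _) (isd_psi k A0 b1 x1)) _; rewrite mul1r.
move=> x x0 Yx.
have x1 : -1 < x by rewrite (lt_trans _ x0)// oppr_lt0.
have m0 := psi_gt0 k A0 b1 x1.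
have ml := psi_le A0 b1 k0 (ltW x0).
have := psi_riccati D A0 b1 x0; cbv zeta; rewrite -/k => E.
rewrite -(pmulr_rlt0 _ (_ : 0 < 1 + x)); last by rewrite addr_gt0.
rewrite /df E; move: Yx; rewrite /f ltr_pdivrMr//.
move: m0 ml; clear E; move: (psi A b k x) => m m0 ml; set y := x * m => Yx.
have h1 : m * (1 - b) <= A * (1 - m) by lra.
have h2 : A * b * (1 + y) < (1 - b) * (D * y - A) by lra.
have h3 : 0 < D * y - A.
  have y0 : 0 <= y by rewrite mulr_ge0// ltW.
  have : 0 <= y * (b * (A + D)) by rewrite mulr_ge0// mulr_ge0.
  by lra.
rewrite -(pmulr_rlt0 _ A0).
have h4 : m * (1 - b) * (D * y - A) <= A * (1 - m) * (D * y - A) by rewrite ler_wpM2r// ltW.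
have h5 : m * (A * b * (1 + y)) < m * ((1 - b) * (D * y - A)) by rewrite ltr_pM2l.
by lra.
Qed.

(* Since [m + w * dpsi = phi' = m * (w * phi' / phi)] for [phi = w * m], this bounds the
   logarithmic derivative of [phi]. *)
Lemma phi_logder_ge A b D w : 0 < A -> 0 <= b -> b < 1 -> 0 < D ->
  0 < D - b * (A + D) -> 0 < w ->
  let m := psi A b (A + D + 1) w in
  A < D * (w * m) -> - (b * (A + 1) / (1 - b)) * m <= m + w * dpsi A b (A + D + 1) w.
Proof.
move=> A0 b0 b1 D0 Dd w0 m; set k := A + D + 1 in m *.
have w1 : -1 < w by rewrite (lt_trans _ w0)// oppr_lt0.
have k0 : 0 <= A + D by rewrite addr_ge0// ltW.
have m0 : 0 < m := psi_gt0 k A0 b1 w1.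
have m1 : m < 1 := psi_lt1 k A0 b1 w1.
have yl := phi_le A0 b0 b1 k0 Dd (ltW w0); rewrite -/k -/m in yl.
have A1 : 0 < A + 1 by rewrite addr_gt0.
have /= E := psi_riccati D A0 b1 w0; rewrite -/k -/m in E.
have b1' : 0 < 1 - b by rewrite subr_gt0.
set l' := b * (A + 1) / (1 - b).
have l'E : l' * (1 - b) = b * (A + 1) by rewrite /l' divfK// gt_eqF.
have l'0 : 0 <= l' by rewrite /l' divr_ge0 ?(ltW b1')// mulr_ge0// ltW.
move=> xi0; set y := w * m in xi0 yl E.
have y0 : 0 < y by rewrite mulr_gt0.
have w10 : 0 < 1 + w by rewrite addr_gt0.
rewrite -(ler_pM2l w10) E.
suff : (1 - m) * (D * y - A) <= b * m * (1 + y) + l' * (1 + w) * m by lra.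
have h1 : D * y - A <= b * (A + D) * w * m by rewrite -mulrA -/y; lra.
(* Replacing [(A, D)] by [(A + 1, D - 1)] preserves [A + D] and hence [k], but [phi_le] applies to
   the shifted pair only if [D - 1 > b (A + D)]. In the opposite case [b (A + D) <= l'], and [h1]
   alone is enough. *)
have [Dle|Dgt] := leP (D - 1) (b * (A + D)).
  have h2 : b * (A + D) <= l'.
    rewrite -(ler_pM2r b1') l'E -mulrA ler_wpM2l//; lra.
  have h3 : (1 - m) * (D * y - A) <= D * y - A by rewrite ler_piMl ?subr_ge0 ?(ltW xi0)//; lra.
  have h4 : b * (A + D) * (w * m) <= l' * (w * m) by rewrite ler_wpM2r// ltW.
  have h5 : 0 <= b * m * (1 + y) by rewrite mulr_ge0//; [rewrite mulr_ge0// ltW|rewrite addr_ge0// ltW].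
  have h6 : 0 <= l' * m by rewrite mulr_ge0// ltW.
  by lra.
set Dn := D - 1 - b * (A + D).
have Dn0 : 0 < Dn by rewrite subr_gt0.
have := @phi_le (A + 1) b (D - 1) w A1 b0 b1.
rewrite (_ : A + 1 + (D - 1) + 1 = k); last by rewrite /k; ring.
rewrite (_ : D - 1 - b * (A + 1 + (D - 1)) = Dn); last by rewrite /Dn; ring.
rewrite (_ : A + 1 + (D - 1) = A + D); last by ring.
move=> /(_ k0 Dn0 (ltW w0)).
have /= := J_moment2 D A0 b1 (ltW w0); rewrite -/k.
have J0 := J_gt0 k A0 b1 w1; have J1 := J_gt0 k A1 b1 w1.
rewrite /psi (_ : A + 1 + 1 = A + 2); last by ring.
have mE : J (A + 1) b k w = m * J A b k w by rewrite /m /psi divfK// gt_eqF.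
move: J0 J1 mE (J (A + 2) b k w); move: (J A b k w) (J (A + 1) b k w) => a0 a1 J0 J1 mE a2.
set f1 := w * (a2 / a1) => M f1le.
(* [f1] is [phi] at the shifted parameters. The second moment relation thus reads [D y - A = m ((D -
   1 + b) f1 - (A + 1 - b))], and bounding [f1] gives [X1], a bound on [(D y - A) / m] that does not
   grow with [w], unlike [h1]. *)
have M' : A - (A + 1 - b) * m - D * y + (D - 1 + b) * m * f1 = 0.
  apply: (mulIf (_ : a0 != 0)); first by rewrite gt_eqF.
  rewrite mul0r -M /f1 mE /y; field; by rewrite !gt_eqF.
have f1le' : f1 <= (A + 1) / Dn by rewrite ler_pdivlMr.
have lE2 : b * (A + 2 - b) / (1 - b) = l' + b.
  by rewrite /l'; field; rewrite gt_eqF.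
have bE : b * (A + D) = l' + b * Dn / (1 - b).
  by rewrite /l' /Dn; field; rewrite gt_eqF.
have X1 : D * y - A <= m * (b * (A + D) * ((A + 2 - b) / Dn)).
  have -> : D * y - A = m * ((D - 1 + b) * f1 - (A + 1 - b)) by lra.
  rewrite ler_wpM2l ?(ltW m0)//.
  have h : (D - 1 + b) * f1 <= (D - 1 + b) * ((A + 1) / Dn).
    rewrite ler_wpM2l//; have : 0 <= b * (A + D) by rewrite mulr_ge0// addr_ge0 ?ltW.
    by move: Dn0; rewrite /Dn; lra.
  apply: (le_trans (lerB h (lexx _))); rewrite le_eqVlt; apply/orP; left; apply/eqP.
  by rewrite /Dn; field; rewrite -/Dn gt_eqF.
(* The bounds [h1] and [X1] coincide at this value of [w]. On each side the smaller of the two is at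
   most [m (l' (1 + w) + b)]. *)
have ws : w <= (A + 2 - b) / Dn \/ (A + 2 - b) / Dn <= w by apply/orP; exact: le_total.
have h5 : 0 <= b * m * y.
  by rewrite mulr_ge0 ?(ltW y0)// mulr_ge0 ?(ltW m0).
have xi1 : (1 - m) * (D * y - A) <= D * y - A by rewrite ler_piMl ?subr_ge0 ?(ltW xi0)//; lra.
case: ws => ws.
  have q : b * Dn / (1 - b) * w <= l' + b.
    rewrite -lE2 mulrAC ler_pM2r ?invr_gt0// -mulrA ler_wpM2l//.
    by move: ws; rewrite ler_pdivlMr// mulrC.
  have q2 : m * (b * Dn / (1 - b) * w) <= m * (l' + b) by rewrite ler_wpM2l// ltW.
  by move: h1; rewrite bE; lra.
have q : b * (A + D) * ((A + 2 - b) / Dn) = l' * ((A + 2 - b) / Dn) + (l' + b).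
  rewrite bE -lE2; field; by rewrite !gt_eqF.
have q2 : l' * ((A + 2 - b) / Dn) <= l' * w by rewrite ler_wpM2l.
have q3 : m * (b * (A + D) * ((A + 2 - b) / Dn)) <= m * (l' * w + (l' + b)).
  by rewrite ler_wpM2l ?(ltW m0)// q; lra.
by lra.
Qed.

(* For [b = a + 2] and the other parameters of the theorem, the second alternative is
   [g(a) <= 0]. *)
Definition params_ok A b D N : Prop := [/\ 0 < A, b < 1, 0 < D, 0 <= N &
  (b < 0 /\ (N / 2 + 1) * A <= 2 * (A - b) * D) \/
  (0 <= b /\ (N / 2 + 1) * A + 2 * (b * (2 * A + 1 - b)) * (A + D) <= 2 * (A - b) * D)].

(** With [l = b (2 A + 1 - b)], the second alternative forces [l (A + D) < (A - b) D], hence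
    [l < A - b]. The denominator of the barrier is positive when [b A < (1 - b) D], which follows
    through [b (A - b - l) <= l (1 - b)]. *)
Lemma params_ok_Dd A b D N : params_ok A b D N -> 0 <= b ->
  [/\ 0 < D - b * (A + D), b * (2 * A + 1 - b) < A - b & b * (A + 1) / (1 - b) <= A - b].
Proof.
move=> [A0 b1 D0 N0 [[/lt_geF ->//]|[b0 H] _]].
have b1' : 0 < 1 - b by rewrite subr_gt0.
set l := b * (2 * A + 1 - b) in H *.
have nA : 0 < (N / 2 + 1) * A by rewrite mulr_gt0// ltr_wpDl// divr_ge0.
have l0 : 0 <= l by rewrite mulr_ge0//; lra.
have lA : 0 <= l * A by rewrite mulr_ge0// ltW.
have h1 : 0 < A - b - l by rewrite -(pmulr_lgt0 _ D0); lra.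
split; last 2 first.
- by rewrite -subr_gt0.
- by rewrite ler_pdivrMr//; rewrite /l in h1; lra.
have h2 : A * l < D * (A - b - l) by lra.
have h3 : b * (A - b - l) <= l * (1 - b).
  rewrite /l; have : 0 <= b * (A + 1) by rewrite mulr_ge0// addr_ge0// ltW.
  by lra.

have h4 : A * (b * (A - b - l)) <= A * (l * (1 - b)) by rewrite ler_pM2l.
have h5 : A * l * (1 - b) < D * (A - b - l) * (1 - b) by rewrite ltr_pM2r.
rewrite -(pmulr_lgt0 _ h1); lra.
Qed.

Lemma phi_bounded A b D N : params_ok A b D N ->
  exists Y : R, 0 <= Y /\ forall w, 0 <= w -> w * psi A b (A + D + 1) w <= Y.
Proof.
move=> ok; have [A0 b1 D0 N0 _] := ok.
have k0 : 0 <= A + D by rewrite addr_ge0// ltW.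
have [b0|b0] := ltP b 0.
  exists (A / D); split; first by rewrite divr_ge0// ltW.
  move=> w w0; have w1 : -1 < w by rewrite (lt_le_trans _ w0)// oppr_lt0.
  have := psi_neg_b D A0 b0 w0.
  have := psi_gt0 (A + D + 1) A0 b1 w1; have := psi_lt1 (A + D + 1) A0 b1 w1.
  move: (psi _ _ _ _) => m m1 m0 h; rewrite ler_pdivlMr// mulrC -subr_ge0.
  have m1' : 0 < 1 - m by rewrite subr_gt0.
  rewrite -(pmulr_rge0 _ m1'); apply: le_trans h.
  by rewrite !mulr_ge0 ?oppr_ge0 ?addr_ge0 ?(ltW b0) ?(ltW m0) ?mulr_ge0 ?(ltW m0).
have [Dd _ _] := params_ok_Dd ok b0.
exists (A / (D - b * (A + D))); split; first by rewrite divr_ge0// ltW.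
by move=> w w0; rewrite ler_pdivlMr// phi_le.
Qed.

(** Once [phi] is bounded, every other term of the Riccati equation is bounded. The factor [1 + w]
    is kept because it yields the decay of [Xi], and with it the regularity of the [Z]-field at
    [Z = 0]. *)
Lemma dpsi_bounded A b D N : params_ok A b D N ->
  exists C : R, forall w, 0 <= w -> (1 + w) * `|w * dpsi A b (A + D + 1) w| <= C.
Proof.
move=> ok; have [A0 b1 D0 N0 _] := ok.
have [Y [Y0 yY]] := phi_bounded ok.
exists (A + D * Y + `|b| * (1 + Y) + 1 + Y) => w; rewrite le_eqVlt => /predU1P[<-|w0].
  rewrite mul0r normr0 mulr0 addr_ge0// addr_ge0// addr_ge0 ?mulr_ge0 ?addr_ge0//.
    exact: ltW.
  by rewrite mulr_ge0// ltW.
have w1 : -1 < w by rewrite (lt_trans _ w0)// oppr_lt0.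
have /= := psi_riccati D A0 b1 w0; have := yY _ (ltW w0).
have := psi_gt0 (A + D + 1) A0 b1 w1; have := psi_lt1 (A + D + 1) A0 b1 w1.
move: (psi _ _ _ _) (w * dpsi _ _ _ _) => m z m1 m0 {}yY E.
have w10 : 0 < 1 + w by rewrite addr_gt0.
rewrite -[X in X * _]ger0_norm ?(ltW w10)// -normrM.
have y0 : 0 <= w * m by rewrite mulr_ge0// ltW.
have m1' : 0 <= 1 - m by rewrite subr_ge0 ltW.
have -> : (1 + w) * z = (1 - m) * A - (1 - m) * (D * (w * m)) + b * (m * (1 + w * m)) - (m + w * m) by lra.
have t1 : (1 - m) * A <= A by rewrite ler_piMl ?(ltW A0)// lerBlDr lerDl ltW.
have t2 : 0 <= (1 - m) * A by rewrite mulr_ge0// ltW.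
have t3 : (1 - m) * (D * (w * m)) <= D * Y.
  apply: (@le_trans _ _ (D * (w * m))); last by rewrite ler_pM2l.
  by rewrite ler_piMl ?(mulr_ge0 (ltW D0) y0)//; lra.
have t4 : 0 <= (1 - m) * (D * (w * m)) by rewrite mulr_ge0// mulr_ge0// ltW.
have : `|b * (m * (1 + w * m))| <= `|b| * (1 + Y).
  rewrite normrM ler_wpM2l// ger0_norm; last first.
    by rewrite mulr_ge0 ?(ltW m0)// addr_ge0.
  apply: (@le_trans _ _ (1 + w * m)); last by rewrite lerD2l.
  by rewrite ler_piMl ?(ltW m1)// addr_ge0.
rewrite ler_norml => /andP[t5 t6].
by rewrite ler_norml; apply/andP; split; lra.
Qed.

(** For the theorem's parameters [2 (A + 1 - b)] is [p] and [N] is [n], so the left side is [Delta].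
    In terms of [phi = w * m] it equals [2 (m ((N/2 + 1) phi - 2 (A - b)) - 2 (1 + phi) phi')]: an
    upper bound on [phi] and a lower bound on [phi'] decide its sign. *)
Lemma riskdiff_le0 A b D N w : params_ok A b D N -> 0 <= w ->
  let m := psi A b (A + D + 1) w in let m' := dpsi A b (A + D + 1) w in
  - 2 * (2 * (A + 1 - b) * m + 2 * (w * m')) + N * (w * m ^+ 2)
  - 2 * w * (m ^+ 2 + w * (2 * m * m')) <= 0.
Proof.
move=> ok; have [A0 b1 D0 N0 cnd] := ok.
rewrite le_eqVlt => /predU1P[<-|w0]; cbv zeta.
  have w1 : -1 < 0 :> R by rewrite oppr_lt0.
  rewrite !mul0r !mulr0 mul0r addr0 addr0 subr0.
  have := psi_gt0 (A + D + 1) A0 b1 w1; move: (psi _ _ _ _) => m m0.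
  have : 0 <= (A + 1 - b) * m by rewrite mulr_ge0// ?ltW//; lra.
  lra.
have w1 : -1 < w by rewrite (lt_trans _ w0)// oppr_lt0.
set m := psi A b (A + D + 1) w; set m' := dpsi A b (A + D + 1) w.
have m0 : 0 < m by exact: psi_gt0.
have m1 : m < 1 by exact: psi_lt1.
have y0 : 0 < w * m by rewrite mulr_gt0.
rewrite (_ : _ - _ = 2 * (m * ((N / 2 + 1) * (w * m) - 2 * (A - b))
   - 2 * (1 + w * m) * (m + w * m'))); last by field.
rewrite pmulr_rle0// subr_le0.
have nu0 : 0 < N / 2 + 1 by rewrite ltr_wpDl// divr_ge0.
set nu := N / 2 + 1 in nu0 cnd *.
(* The easy regime, [phi <= A / D] and [phi' >= 0]. It covers all [w] when [b < 0], and the part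
   below [A / D] when [0 <= b]. *)
have yAD (H : nu * A <= 2 * (A - b) * D) : D * (w * m) <= A -> 0 <= m + w * m' ->
   m * (nu * (w * m) - 2 * (A - b)) <= 2 * (1 + w * m) * (m + w * m').
  move=> yA P0; apply: (@le_trans _ _ 0).
    rewrite pmulr_rle0// subr_le0 -(ler_pM2r D0); apply: le_trans H.
    by rewrite -mulrA ler_pM2l// mulrC.
  by rewrite !mulr_ge0// addr_ge0// ltW.
have /= E := psi_riccati D A0 b1 w0; rewrite -/m -/m' in E.
have w10 : 0 < 1 + w by rewrite addr_gt0.
case: cnd => [[b0 H]|[b0 H]].
  have h := psi_neg_b D A0 b0 (ltW w0); rewrite -/m in h.
  apply: yAD => //.
    rewrite -subr_ge0; have m1' : 0 < 1 - m by rewrite subr_gt0.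
    rewrite -(pmulr_rge0 _ m1'); apply: le_trans h.
    by rewrite mulr_ge0 ?oppr_ge0 ?(ltW b0)// mulr_ge0 ?(ltW m0)// addr_ge0// ltW.
  by rewrite -(pmulr_rge0 _ w10) E; lra.
have [Dd _ l'A] := params_ok_Dd ok b0.
have b1' : 0 < 1 - b by rewrite subr_gt0.
have [yA|yA] := leP (D * (w * m)) A.
  apply: yAD => //.
    have : 0 <= b * (2 * A + 1 - b) * (A + D).
      by rewrite mulr_ge0 ?addr_ge0 ?(ltW A0) ?(ltW D0)// mulr_ge0//; lra.
    lra.
  rewrite -(pmulr_rge0 _ w10) E addr_ge0//.
    by rewrite mulr_ge0// subr_ge0// ltW.
  by rewrite mulr_ge0//; [rewrite mulr_ge0// ltW|rewrite addr_ge0// ltW].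
have := phi_logder_ge A0 b0 b1 D0 Dd w0 yA; rewrite -/m -/m'.
set l' := b * (A + 1) / (1 - b) in l'A *.
have l'E : l' * (1 - b) = b * (A + 1) by rewrite /l' divfK// gt_eqF.
have l'0 : 0 <= l' by rewrite /l' divr_ge0 ?(ltW b1')// mulr_ge0// addr_ge0// ltW.
move=> P0.
have k0 : 0 <= A + D by rewrite addr_ge0// ltW.
have yl := phi_le A0 b0 b1 k0 Dd (ltW w0); rewrite -/m in yl.
apply: (@le_trans _ _ (2 * (1 + w * m) * (- l' * m))); last first.
  by rewrite ler_wpM2l// mulr_ge0// addr_ge0// ltW.
rewrite [X in _ <= X](_ : _ = m * (- (2 * (1 + w * m) * l'))); last by ring.
rewrite ler_pM2l//.
suff : (w * m) * (nu + 2 * l') <= 2 * (A - b - l') by lra.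
(* With [phi_le], what remains is [A (nu + 2 l') <= 2 (A - b - l') (D - b (A + D))]. Since
   [l' (1 - b) = b (A + 1)], this rearranges into the second alternative of [params_ok]. *)
rewrite -(ler_pM2r Dd).
apply: (@le_trans _ _ (A * (nu + 2 * l'))).
  rewrite mulrAC ler_wpM2r// addr_ge0 ?(ltW nu0)// mulr_ge0//.
have EE : (A + D) * (l' * (1 - b)) = (A + D) * (b * (A + 1)) by rewrite l'E.
lra.
Qed.

End PsiBounds.

(** * Lebesgue measure on tuples *)

Section TupleMeasure.
Variable R : realType.
Notation mR := (measurableTypeR R).
Notation leb := (@lebesgue_measure R).

Definition consT (k : nat) (x : mR * k.-tuple mR) : k.+1.-tuple mR := [tuple of x.1 :: x.2].

Definition unconsT (k : nat) (t : k.+1.-tuple mR) : mR * k.-tuple mR := (thead t, [tuple of behead t]).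

Lemma consTK k : cancel (@consT k) (@unconsT k).
Proof.
move=> [x t]; rewrite /consT /unconsT/=; congr pair.
by apply: val_inj.
Qed.

Lemma measurable_consT k : measurable_fun setT (@consT k).
Proof. by apply: measurable_cons; [exact: measurable_fst|exact: measurable_snd]. Qed.

Lemma measurable_unconsT k : measurable_fun setT (@unconsT k).
Proof.
apply/measurable_fun_pairP; split.
  exact: (@measurable_tnth _ mR k.+1 ord0).
exact: measurable_behead.
Qed.

Section step.
Variables (k : nat) (m : {sigma_finite_measure set (k.-tuple mR) -> \bar R}).

Definition mt_step : set (k.+1.-tuple mR) -> \bar R :=
  pushforward (leb \x m)%E (@consT k).

Let mt_step0 : mt_step set0 = 0%E.
Proof. by rewrite /mt_step /pushforward preimage_set0 measure0. Qed.

Let mt_step_ge0 A : (0 <= mt_step A)%E.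
Proof. by rewrite /mt_step /pushforward; exact: measure_ge0. Qed.

Let mt_step_sigma_additive : semi_sigma_additive mt_step.
Proof.
move=> F mF tF mUF; rewrite /mt_step /pushforward preimage_bigcup.
apply: measure_semi_sigma_additive.
- by move=> n; rewrite -[X in measurable X]setTI; exact: measurable_consT.
- apply/trivIsetP => /= i j _ _ ij; rewrite -preimage_setI.
  by move/trivIsetP : tF => /(_ _ _ _ _ ij) ->//; rewrite preimage_set0.
- by rewrite -preimage_bigcup -[X in measurable X]setTI; exact: measurable_consT.
Qed.

HB.instance Definition _ := isMeasure.Build _ _ _ mt_step
  mt_step0 mt_step_ge0 mt_step_sigma_additive.

Let sf : sigma_finite setT mt_step.
Proof.
have /sigma_finiteP[F [TF ndF Foo]] := sigma_finiteT leb.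
have /sigma_finiteP[G [TG ndG Goo]] := sigma_finiteT m.
(* Rectangles of finite product measure, pulled back along the inverse of [consT]. *)
exists (fun n => @unconsT k @^-1` (F n `*` G n)).
  rewrite -preimage_bigcup (_ : \bigcup_n _ = setT) ?preimage_setT//.
  rewrite -setXTT TF TG predeqE => -[x y]; split.
    by move=> [/= n _ []/= ? ?]; split; exists n.
  move=> [/= [n _ Fnx] [l _ Gly]]; exists (maxn n l) => //; split.
  - by move: x Fnx; exact/subsetPset/ndF/leq_maxl.
  - by move: y Gly; exact/subsetPset/ndG/leq_maxr.
move=> n; have [mFn Fnoo] := Foo n; have [mGn Gnoo] := Goo n; split.
  by rewrite -[X in measurable X]setTI; apply: measurable_unconsT => //; exact: measurableX.
rewrite /mt_step /pushforward -comp_preimage.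
rewrite (_ : @unconsT k \o @consT k = id); last by apply/funext => x; exact: consTK.
rewrite preimage_id product_measure1E//.
by rewrite lte_mul_pinfty// ge0_fin_numE.
Qed.

HB.instance Definition _ := Measure_isSigmaFinite.Build _ _ _ mt_step sf.
End step.

Let z0 : 0.-tuple mR := [tuple].

(* Built through [consT], so that its integrals are the iterated integrals of [intRn]. *)
Fixpoint mt (k : nat) : {sigma_finite_measure set (k.-tuple mR) -> \bar R} :=
  match k with
  | 0 => [the {sigma_finite_measure set (0.-tuple mR) -> \bar R} of dirac z0]
  | k'.+1 => [the {sigma_finite_measure set (k'.+1.-tuple mR) -> \bar R} of mt_step (mt k')]
  end.

Lemma ge0_integral_mtS k (F : k.+1.-tuple mR -> \bar R) :
  measurable_fun setT F -> (forall t, 0 <= F t)%E ->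
  (\int[mt k.+1]_t F t = \int[leb]_x \int[mt k]_t F (consT (x, t)))%E.
Proof.
move=> mF F0.
rewrite /= /mt_step ge0_integral_pushforward//; last exact: measurable_consT.
rewrite preimage_setT fubini_tonelli1//; last by move=> x /=.
exact: measurableT_comp mF (@measurable_consT k).
Qed.

Definition rv k (t : k.-tuple mR) : 'rV[R]_k := \row_i tnth t i.

Lemma rv_cons k x (t : k.-tuple mR) : row_mx (const_mx x : 'rV[R]_1) (rv t) = rv (consT (x, t)).
Proof.
apply/rowP => i; rewrite !mxE; case: splitP => j ij; rewrite !mxE.
  by rewrite /consT (tnth_nth 0) ij (ord1 j).
by rewrite /consT !(tnth_nth 0) ij.
Qed.

Lemma intRnE k (F : 'rV[R]_k -> \bar R) :
  measurable_fun setT (fun t => F (rv t)) -> (forall v, 0 <= F v)%E ->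
  intRn F = (\int[mt k]_t F (rv t))%E.
Proof.
elim: k F => [|k IH] F mF F0.
  rewrite /= integral_dirac// diracT mul1e; congr F.
  by apply/rowP; case.
rewrite ge0_integral_mtS//=.
apply: eq_integral => x _; rewrite IH//.
  apply: eq_integral => t _; by rewrite -rv_cons.
have := measurableT_comp mF (@measurable_consT k).
have mp : measurable_fun setT (pair x : k.-tuple mR -> mR * k.-tuple mR).
  exact: pair1_measurable.
move=> /measurableT_comp/(_ mp); apply: eq_measurable_fun => t _ /=.
by rewrite -rv_cons.
Qed.
End TupleMeasure.

Section Coordinates.
Variable R : realType.
Notation mR := (measurableTypeR R).
Notation leb := (@lebesgue_measure R).
Notation mt := (@mt R).

Definition upd k (i : 'I_k) (s : mR) (t : k.-tuple mR) : k.-tuple mR :=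
  [tuple if j == i then s else tnth t j | j < k].

Lemma tnth_upd k (i j : 'I_k) s t : tnth (upd i s t) j = if j == i then s else tnth t j.
Proof. by rewrite tnth_mktuple. Qed.

Lemma upd_cons0 k x s (t : k.-tuple mR) : upd ord0 s (consT (x, t)) = consT (s, t).
Proof.
apply: eq_from_tnth => j; rewrite tnth_upd; case: (unliftP ord0 j) => [l ->|->].
  by rewrite [lift ord0 l == _]eq_sym (negbTE (neq_lift _ _)) !tnthS.
by rewrite eqxx.
Qed.

Lemma upd_consS k i x s (t : k.-tuple mR) :
  upd (lift ord0 i) s (consT (x, t)) = consT (x, upd i s t).
Proof.
apply: eq_from_tnth => j; rewrite tnth_upd; case: (unliftP ord0 j) => [l ->|->].
  by rewrite (inj_eq (@lift_inj _ ord0)) !tnthS tnth_upd.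
by rewrite (negbTE (neq_lift _ _)).
Qed.

Lemma integrable_consT k (F : k.+1.-tuple mR -> \bar R) :
  (mt k.+1).-integrable setT F -> (leb \x mt k)%E.-integrable setT (F \o @consT R k).
Proof.
move=> /integrableP[mF F1]; apply/integrableP; split.
  exact: measurableT_comp mF (@measurable_consT R k).
move: F1; rewrite /= /mt_step ge0_integral_pushforward//.
- exact: measurable_consT.
- exact: measurableT_comp.
Qed.

Lemma integral_mtS k (F : k.+1.-tuple mR -> \bar R) :
  (mt k.+1).-integrable setT F ->
  (\int[mt k.+1]_t F t = \int[leb \x mt k]_z F (consT z))%E.
Proof.
move=> iF; rewrite /= /mt_step integral_pushforward//.
- exact: measurable_consT.
- exact: measurable_int iF.
- exact: integrable_consT.
Qed.

(** Fubini, by induction on the position of [i]. When [i] is not the first coordinate, the slices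
    are integrable only for almost every value of the first one, which suffices to apply the
    induction hypothesis. *)
Lemma integral_coord0 k (i : 'I_k) (F : k.-tuple mR -> \bar R) :
  (mt k).-integrable setT F ->
  (forall t, \int[leb]_s F (upd i s t) = 0)%E -> (\int[mt k]_t F t = 0)%E.
Proof.
elim: k i F => [[]//|k IH] i F iF F0.
rewrite integral_mtS//.
have iF' := integrable_consT iF.
case: (unliftP ord0 i) => [j|] iE.
  rewrite -(integral12_prod_meas1 iF').
  have mF := measurable_fubini_F iF'.
  rewrite (@ae_eq_integral _ _ _ _ _ (cst 0%E))//; first exact: integral0.
  have [N [mN N0 sub]] := ae_integrable1 iF'.
  exists N; split => // x /= h; apply: sub => /= h2; apply: h => _.
  rewrite /fubini_F; apply: (IH j) => // t.
  by have := F0 (consT (x, t)); rewrite iE; under eq_integral do rewrite upd_consS.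
rewrite -(integral21_prod_meas1 iF').
rewrite integral0_eq// => t _; rewrite /fubini_G/=.
have := F0 (consT (0 : mR, t)); rewrite iE.
by under eq_integral do rewrite upd_cons0.
Qed.

Lemma ge0_integral_prodT k (f : 'I_k -> mR -> R) :
  (forall i, measurable_fun setT (f i)) -> (forall i x, 0 <= f i x) ->
  (\int[mt k]_t (\prod_i f i (tnth t i))%:E = \prod_i \int[leb]_x (f i x)%:E)%E.
Proof.
elim: k f => [|k IH] f mf f0.
  rewrite /= integral_dirac// ?diracT ?mul1e ?big_ord0//.
  apply/measurable_EFinP; apply: measurable_prod => -[]//.
rewrite ge0_integral_mtS//; last 2 first.
- apply/measurable_EFinP; apply: measurable_prod => i _.
  exact: (measurableT_comp (mf i) (@measurable_tnth _ mR k.+1 i)).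
- by move=> t; rewrite lee_fin prodr_ge0.
rewrite big_ord_recl -IH//.
have int0 : (0 <= \int[mt k]_t (\prod_i f (lift ord0 i) (tnth t i))%:E)%E.
  by apply: integral_ge0 => t _; rewrite lee_fin prodr_ge0.
rewrite -ge0_integralZr//; last 2 first.
- by apply/measurable_EFinP.
- by move=> x _; rewrite lee_fin.
apply: eq_integral => x _.
rewrite -ge0_integralZl//; last 3 first.
- apply/measurable_EFinP; apply: measurable_prod => i _.
  exact: (measurableT_comp (mf _) (@measurable_tnth _ mR k i)).
- by move=> t _; rewrite lee_fin prodr_ge0.
- by rewrite lee_fin.
apply: eq_integral => t _; rewrite big_ord_recl EFinM; congr (_%:E * _%:E)%E.
by apply: eq_bigr => i _; rewrite tnthS.
Qed.

End Coordinates.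

Section Stein1.
Variable R : realType.
Notation leb := (@lebesgue_measure R).

Definition bump (T r : R) : R := Num.max (T - r) 0.

(** Where [(y - c)^2 < T - r], the integrand is the derivative of [- (T - r - (y - c)^2) G y], which
    vanishes at both endpoints of that interval; elsewhere the integrand is zero. *)
Lemma stein1 (c T r : R) (G g : R -> R) :
  (forall y : R, is_derive y 1 G (g y)) -> continuous g ->
  (\int[leb]_y (((y - c) ^+ 2 + r < T)%R%:R * (2 * (y - c) * G y)
     - bump T ((y - c) ^+ 2 + r) * g y)%:E = 0)%E.
Proof.
move=> dG cg; set tau := T - r.
have condE y : ((y - c) ^+ 2 + r < T) = ((y - c) ^+ 2 < tau) by rewrite -ltrBrDr.
have bumpE y : bump T ((y - c) ^+ 2 + r) = Num.max (tau - (y - c) ^+ 2) 0.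
  by congr Num.max; rewrite /tau; ring.
have [tau0|tau0] := leP tau 0.
  rewrite integral0_eq// => y _; rewrite condE bumpE ltNge.
  have -> : tau <= (y - c) ^+ 2 by rewrite (le_trans tau0)// sqr_ge0.
  by rewrite max_r ?mul0r ?subrr// subr_le0 (le_trans tau0)// sqr_ge0.
pose s := Num.sqrt tau.
have s0 : 0 < s by rewrite sqrtr_gt0.
have s2 : s ^+ 2 = tau by rewrite sqr_sqrtr// ltW.
pose f y := 2 * (y - c) * G y - (tau - (y - c) ^+ 2) * g y.
pose F y := - ((tau - (y - c) ^+ 2) * G y).
have dF (y : R) : is_derive y 1 F (f y).
  have d1 : is_derive y 1 (fun y => y - c) (1 + 0) by exact: isd_add (isd_id _) (isd_cst _ _).
  apply: isd_eq (isd_opp (isd_mul (isd_add (isd_cst tau y) (isd_opp (isd_mul d1 d1))) (dG y))) _.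
  by rewrite /f; ring.
have cG : continuous G by move=> y; exact: isd_continuous (dG y).
have cf : continuous f.
  have c1 : continuous (fun y : R => y - c) by move=> y; apply: continuousB; [exact: cvg_id|exact: cst_continuous].
  move=> y; apply: (@continuousB _ _ _ (fun y => 2 * (y - c) * G y)
      (fun y => (tau - (y - c) ^+ 2) * g y)).
    apply: (@continuousM _ _ (fun y => 2 * (y - c))); last exact: cG.
    by apply: continuousM; [exact: cst_continuous|exact: c1].
  apply: (@continuousM _ _ (fun y => tau - (y - c) ^+ 2)); last exact: cg.
  apply: continuousB; first exact: cst_continuous.
  by apply: continuousM; exact: c1.
rewrite (_ : (fun y => _) = (EFin \o f) \_ (`]c - s, c + s[)); last first.
  apply/funext => y; rewrite patchE condE bumpE.
  have E : (y \in (`]c - s, c + s[%classic : set R)) = ((y - c) ^+ 2 < tau).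
    rewrite -s2 -(real_normK (num_real (y - c))) ltr_pXn2r ?nnegrE ?(ltW s0)// ltr_norml.
    apply/idP/idP; first by rewrite inE/= in_itv/= => /andP[h1 h2]; apply/andP; split; lra.
    by move=> /andP[h1 h2]; rewrite inE/= in_itv/=; apply/andP; split; lra.
  rewrite E; case: ltP => h.
    by rewrite mul1r max_l ?subr_ge0 ?ltW.
  by rewrite mul0r max_r ?subr_le0// mul0r subrr.
rewrite -integral_mkcond.
transitivity (\int[leb]_(z in `[(c - s)%R, (c + s)%R]) (f z)%:E)%E.
  rewrite [RHS]integral_itv_bndoo//.
  by apply: measurable_funTS; apply/measurable_EFinP; exact: continuous_measurable_fun.
rewrite (@continuous_FTC2 _ f F).
- have -> : F (c + s) = 0 by rewrite /F -s2; ring.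
  have -> : F (c - s) = 0 by rewrite /F -s2; ring.
  by rewrite sube0.
- by rewrite ltrD2l gt0_cp.
- exact: continuous_subspaceT.
- split => [y _||].
  + by have [] := dF y.
  + by apply: cvg_at_right_filter; exact: isd_continuous (dF _).
  + by apply: cvg_at_left_filter; exact: isd_continuous (dF _).
- by move=> y _; rewrite derive1E; exact: (@derive_val _ _ _ _ _ _ _ (dF y)).
Qed.

End Stein1.

(** * Stein's identity on balls *)

Section Fields1.
Variable R : realType.
Variables ps dps : R -> R.
Hypothesis dpsE : forall w : R, 0 <= w -> is_derive w 1 ps (dps w).
Hypothesis dps_cont : forall w : R, 0 <= w -> {for w, continuous dps}.
Hypothesis ps01 : forall w, 0 <= w -> 0 <= ps w <= 1.
Variables Y C : R.
Hypothesis phiY : forall w, 0 <= w -> w * ps w <= Y.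
Hypothesis dpsC : forall w, 0 <= w -> (1 + w) * `|w * dps w| <= C.

Let Y0 : 0 <= Y. Proof. by have := phiY (lexx 0); rewrite mul0r. Qed.
Let C0 : 0 <= C. Proof. by apply: le_trans (dpsC (lexx 0)); rewrite mul0r normr0 mulr0. Qed.

(** For [S > 0], [S * Th W] is the squared norm of [psi W X], the quadratic part of the loss
    difference. [Xi w] is [w] times the derivative of [Th], which appears when [Th W] is
    differentiated in [Z]. *)
Definition Th w := w * ps w ^+ 2.
Definition Xi w := w * (ps w ^+ 2 + w * (2 * ps w * dps w)).

Let ps_cont w : 0 <= w -> {for w, continuous ps}.
Proof. by move=> w0; exact: isd_continuous (dpsE w0). Qed.

Let continuousP (f g : R -> R) w : {for w, continuous f} -> {for w, continuous g} ->
  {for w, continuous (fun x => f x * g x)}.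
Proof. exact: continuousM. Qed.

Let continuousA (f g : R -> R) w : {for w, continuous f} -> {for w, continuous g} ->
  {for w, continuous (fun x => f x + g x)}.
Proof. exact: continuousD. Qed.

Lemma isd_Th (w : R) : 0 <= w -> is_derive w 1 Th (ps w ^+ 2 + w * (2 * ps w * dps w)).
Proof.
move=> w0; apply: isd_eq (isd_mul (isd_id w) (isd_mul (dpsE w0) (dpsE w0))) _; ring.
Qed.

Lemma Th_cont (w : R) : 0 <= w -> {for w, continuous Th}.
Proof. by move=> w0; exact: isd_continuous (isd_Th w0). Qed.

Lemma Xi_cont (w : R) : 0 <= w -> {for w, continuous Xi}.
Proof.
move=> w0; have ci : {for w, continuous (fun x : R => x)} by exact: cvg_id.
have c2 : {for w, continuous (fun=> 2 : R)} by exact: cst_continuous.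
have cps := ps_cont w0; have cd := dps_cont w0.
apply: continuousP => //; apply: continuousA; first exact: continuousP.
by apply: continuousP => //; apply: continuousP => //; exact: continuousP.
Qed.

Lemma dps_le w : 0 <= w -> `|w * dps w| <= C.
Proof.
move=> w0; apply: le_trans (dpsC w0); rewrite ler_peMl// lerDl//.
Qed.

Lemma Th_ge0 w : 0 <= w -> 0 <= Th w.
Proof. by move=> w0; rewrite /Th mulr_ge0 ?sqr_ge0. Qed.

Lemma Th_le w : 0 <= w -> Th w <= Y.
Proof.
move=> w0; have /andP[p0 p1] := ps01 w0; apply: le_trans (phiY w0).
by rewrite /Th expr2 mulrA ler_piMr// mulr_ge0.
Qed.

(** Decay of order [1 / w] is what counts near [Z = 0], where [W] tends to infinity as soon as [X]
    is nonzero. *)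
Lemma Th_decay w : 0 <= w -> w * Th w <= Y ^+ 2.
Proof.
move=> w0; have /andP[p0 p1] := ps01 w0.
rewrite /Th (_ : _ * _ = (w * ps w) ^+ 2); last by ring.
by rewrite lerXn2r ?nnegrE ?mulr_ge0// phiY.
Qed.

Lemma Xi_le w : 0 <= w -> `|Xi w| <= Y + 2 * Y * C.
Proof.
move=> w0; have /andP[p0 p1] := ps01 w0.
rewrite (_ : Xi w = Th w + 2 * (w * ps w) * (w * dps w)); last by rewrite /Xi /Th; ring.
apply: le_trans (ler_normD _ _) _; rewrite lerD//.
  by rewrite ger0_norm ?Th_ge0 ?Th_le.
rewrite normrM ger0_norm ?mulr_ge0//.
by apply: ler_pM => //; [rewrite !mulr_ge0|rewrite ler_pM2l ?phiY|exact: dps_le].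
Qed.

Lemma Xi_decay w : 0 <= w -> w * `|Xi w| <= Y ^+ 2 + 2 * Y * C.
Proof.
move=> w0; have /andP[p0 p1] := ps01 w0.
rewrite -[X in X * _]ger0_norm// -normrM.
rewrite (_ : w * Xi w = w * Th w + 2 * (w * ps w) * (w * (w * dps w))); last by rewrite /Xi /Th; ring.
apply: le_trans (ler_normD _ _) _; rewrite lerD//.
  by rewrite ger0_norm ?mulr_ge0 ?Th_ge0 ?Th_decay.
rewrite normrM ger0_norm ?mulr_ge0//.
apply: ler_pM => //; [by rewrite !mulr_ge0|by rewrite ler_pM2l ?phiY|].
rewrite normrM ger0_norm//; apply: le_trans (dpsC w0).
by rewrite ler_wpM2r// lerDr.
Qed.

Section xfield.
Variables q u : R.
Hypotheses (q0 : 0 <= q) (u0 : 0 <= u).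

Let W (s : R) := (s ^+ 2 + q) * u.
Let W0 s : 0 <= W s. Proof. by rewrite mulr_ge0// addr_ge0// sqr_ge0. Qed.
Let dW (s : R) : is_derive s 1 W (2 * s * u).
Proof.
apply: isd_eq (isd_mul (isd_add (isd_mul (isd_id s) (isd_id s)) (isd_cst q s)) (isd_cst u s)) _; ring.
Qed.

Lemma isd_xfield (s : R) : is_derive s 1 (fun s => ps (W s) * s) (ps (W s) + 2 * (s ^+ 2 * u) * dps (W s)).
Proof.
apply: isd_eq (isd_mul (@isd_comp _ ps W s _ _ (dpsE (W0 s)) (dW s)) (isd_id s)) _; ring.
Qed.

Lemma continuous_xfield : continuous (fun s => ps (W s) + 2 * (s ^+ 2 * u) * dps (W s)).
Proof.
move=> s; suff: {for s, continuous (fun s : R => ps (W s) + 2 * (s ^+ 2 * u) * dps (W s))} by [].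
have cW : {for s, continuous W} by exact: isd_continuous (dW s).
have ci : {for s, continuous (fun x : R => x)} by exact: cvg_id.
have cc (c : R) : {for s, continuous (fun=> c : R)} by exact: cst_continuous.
apply: continuousA.
  by apply: (@continuous_comp _ _ _ W ps) => //; exact: ps_cont.
apply: continuousP; last by apply: (@continuous_comp _ _ _ W dps) => //; exact: dps_cont.
by do 3?apply: continuousP => //.
Qed.
End xfield.

Section zfield.
Variables q r : R.
Hypotheses (q0 : 0 <= q) (r0 : 0 <= r).

Let W (s : R) := q * (s ^+ 2 + r)^-1.
Let D0 s : 0 <= s ^+ 2 + r. Proof. by rewrite addr_ge0// sqr_ge0. Qed.
Let W0 s : 0 <= W s. Proof. by rewrite mulr_ge0// invr_ge0 D0. Qed.
Let f s := s * Th (W s).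
Let df s := Th (W s) - 2 * (s ^+ 2 * (s ^+ 2 + r)^-1) * Xi (W s).

Let dD (s : R) : is_derive s 1 (fun s => s ^+ 2 + r) (2 * s).
Proof.
by apply: isd_eq (isd_add (isd_mul (isd_id s) (isd_id s)) (isd_cst r s)) _; ring.
Qed.

Let dW (s : R) : s ^+ 2 + r != 0 -> is_derive s 1 W (q * (- (2 * s) / (s ^+ 2 + r) ^+ 2)).
Proof.
move=> D; apply: isd_eq (isd_mul (isd_cst q s) (@isd_inv _ (fun s => s ^+ 2 + r) s _ D (dD s))) _; ring.
Qed.

(** For [r = 0] one has [W s = q / s^2], so the [1 / w] decay of [Th] and [Xi] becomes a quadratic
    bound at [s = 0]. *)
Let df_small s : q != 0 -> r = 0 -> `|df s| <= (Y ^+ 2 + 2 * (Y ^+ 2 + 2 * Y * C)) / q * s ^+ 2.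
Proof.
move=> qn0 r00; have qp : 0 < q by rewrite lt0r qn0.
have [->|sn0] := eqVneq s 0.
  by rewrite /df /W r00 addr0 expr0n/= invr0 mulr0 /Th mul0r mul0r mulr0 mul0r subrr normr0 mulr0.
have s2 : 0 < s ^+ 2 by rewrite exprn_even_gt0.
have Ws : W s = q / s ^+ 2 by rewrite /W r00 addr0.
have Wp : 0 < W s by rewrite Ws divr_gt0.
rewrite /df r00 addr0 mulfV ?gt_eqF// mulr1.
have e : s ^+ 2 / q = (W s)^-1 by rewrite Ws invf_div.
rewrite -mulrA [q^-1 * _]mulrC e.
apply: le_trans (ler_normB _ _) _; rewrite [X in _ <= X]mulrDl; apply: lerD.
  by rewrite ger0_norm ?Th_ge0 ?W0// ler_pdivlMr// mulrC Th_decay// W0.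
rewrite normrM ger0_norm// -mulrA ler_pM2l// ler_pdivlMr// mulrC; exact/Xi_decay/W0.
Qed.

(* At [s ^+ 2 + r = 0] the division is junk; the field is still C^1 there because
   [Th] and [Xi] decay like [1 / w]. *)
Lemma isd_zfield (s : R) : is_derive s 1 f (df s).
Proof.
have [qE|qn0] := eqVneq q 0.
  have WE x : W x = 0 by rewrite /W qE mul0r.
  have -> : f = fun=> 0 by apply/funext => x; rewrite /f WE /Th mul0r mulr0.
  by rewrite /df WE /Th /Xi !mul0r mulr0 subrr; exact: isd_cst.
have qp : 0 < q by rewrite lt0r qn0.
have [D|D] := eqVneq (s ^+ 2 + r) 0; last first.
  apply: isd_eq (isd_mul (isd_id s) (@isd_comp _ Th W s _ _ (isd_Th (W0 s)) (dW D))) _.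
  rewrite /df /Xi [X in _ = _ - _ * (X * _)]/W; field; exact: D.
have /andP[/eqP s2 /eqP rE] : (s ^+ 2 == 0) && (r == 0).
  by rewrite -paddr_eq0 ?sqr_ge0// D.
have sE : s = 0 by apply/eqP; move/eqP: s2; rewrite expf_eq0.
rewrite sE.
have df0 : df 0 = 0.
  apply/eqP; rewrite -normr_le0; apply: le_trans (df_small 0 qn0 rE) _.
  by rewrite expr0n/= mulr0.
rewrite df0.
have f0 : f 0 = 0 by rewrite /f mul0r.
have L : h^-1 *: ((f \o shift 0) (h *: 1) - f 0) @[h --> 0^'] --> (0 : R).
  have b : (Y ^+ 2 / q) * h ^+ 2 @[h --> (0:R)^'] --> (0 : R).
    have c : {for 0, continuous (fun h : R => (Y ^+ 2 / q) * (h * h))}.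
      by apply: continuousP; [exact: cst_continuous|apply: continuousP; exact: cvg_id].
    have := (continuous_withinNx _ _).1 c.
    by rewrite mul0r mulr0.
  apply: (squeeze_cvgr _ (cvg_cst 0) b); near=> h.
  have h0 : h != 0 by near: h; exact: nbhs_dnbhs_neq.
  have h2 : 0 < h ^+ 2 by rewrite exprn_even_gt0.
  rewrite f0 subr0 /= addr0 /GRing.scale/= mulr1 /f mulrA mulVf// mul1r.
  have Wh : W h = q / h ^+ 2 by rewrite /W rE addr0.
  have Wp : 0 < W h by rewrite Wh divr_gt0.
  rewrite Th_ge0//= -mulrA [q^-1 * _]mulrC (_ : h ^+ 2 / q = (W h)^-1); last by rewrite Wh invf_div.
  by rewrite ler_pdivlMr// mulrC Th_decay.
apply: DeriveDef; first by apply/cvg_ex; exists 0.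
exact/cvg_lim.
Unshelve. all: by end_near. Qed.

Lemma continuous_zfield : continuous df.
Proof.
move=> s.
have [qE|qn0] := eqVneq q 0.
  have WE x : W x = 0 by rewrite /W qE mul0r.
  have -> : df = fun=> 0 by apply/funext => x; rewrite /df WE /Th /Xi !mul0r mulr0 subrr.
  exact: cst_continuous.
have [D|D] := eqVneq (s ^+ 2 + r) 0; last first.
  have cW : {for s, continuous W} by exact: isd_continuous (dW D).
  have ci : {for s, continuous (fun x : R => x)} by exact: cvg_id.
  have cD : {for s, continuous (fun s : R => (s ^+ 2 + r)^-1)} by exact: isd_continuous (@isd_inv _ (fun s => s ^+ 2 + r) s _ D (dD s)).
  have cc (c : R) : {for s, continuous (fun=> c : R)} by exact: cst_continuous.
  suff: {for s, continuous (fun s : R => Th (W s) - 2 * (s ^+ 2 * (s ^+ 2 + r)^-1) * Xi (W s))} by [].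
  apply: continuousB.
    by apply: (@continuous_comp _ _ _ W Th) => //; exact: Th_cont.
  apply: continuousP; last by apply: (@continuous_comp _ _ _ W Xi) => //; exact: Xi_cont.
  by do 4?apply: continuousP => //.
have /andP[/eqP s2 /eqP rE] : (s ^+ 2 == 0) && (r == 0).
  by rewrite -paddr_eq0 ?sqr_ge0// D.
have sE : s = 0 by apply/eqP; move/eqP: s2; rewrite expf_eq0.
rewrite sE.
have df0 : df 0 = 0.
  apply/eqP; rewrite -normr_le0; apply: le_trans (df_small 0 qn0 rE) _.
  by rewrite expr0n/= mulr0.
rewrite /continuous_at df0.
set c := (Y ^+ 2 + 2 * (Y ^+ 2 + 2 * Y * C)) / q.
have b : c * h ^+ 2 @[h --> (0:R)] --> (0 : R).
  have cc : {for 0, continuous (fun h : R => c * (h * h))}.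
    by apply: continuousP; [exact: cst_continuous|apply: continuousP; exact: cvg_id].
  by move: cc; rewrite /prop_for /continuous_at mul0r mulr0.
have L : `|df h| @[h --> (0 : R)] --> (0 : R).
  apply: (squeeze_cvgr _ (cvg_cst 0) b); near=> h.
  by rewrite normr_ge0/= df_small.
exact: norm_cvg0 L.
Unshelve. all: by end_near. Qed.
End zfield.

End Fields1.

Section Ball.
Variable R : realType.
Notation mR := (measurableTypeR R).
Notation leb := (@lebesgue_measure R).
Notation mt := (@mt R).

Definition sqdist k (c : 'I_k -> R) (t : k.-tuple mR) : R := \sum_i (tnth t i - c i) ^+ 2.

Lemma sqdist_ge0 k (c : 'I_k -> R) t : 0 <= sqdist c t.
Proof. by apply: sumr_ge0 => i _; exact: sqr_ge0. Qed.

Lemma measurable_sqdist k (c : 'I_k -> R) : measurable_fun setT (sqdist c).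
Proof.
apply: measurable_sum => i; apply: measurable_funX; apply: measurable_funB => //.
exact: measurable_tnth.
Qed.

Lemma measurable_ltR d (E : measurableType d) (f : E -> R) (T : R) : measurable_fun setT f ->
  measurable_fun setT (fun t => (f t < T)%R%:R : R).
Proof.
move=> mf.
have -> : (fun t => (f t < T)%R%:R : R) = \1_(f @^-1` `]-oo, T[).
  apply/funext => t; rewrite indicE; congr (nat_of_bool _)%:R.
  by apply/idP/idP; rewrite inE/= in_itv.
by apply: measurable_indic; rewrite -[X in measurable X]setTI; apply: mf.
Qed.

Lemma le_abs_of_sqr_lt (x T : R) : x ^+ 2 < T -> `|x| <= 1 + T.
Proof.
move=> h; have T0 : 0 < T by apply: le_lt_trans h; exact: sqr_ge0.
rewrite -[X in _ <= X]ger0_norm ?addr_ge0 ?(ltW T0)//.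
rewrite -ler_sqr ?nnegrE// !real_normK ?num_real//; nra.
Qed.

Lemma coord_le_of_sqdist k (c : 'I_k -> R) t T i : sqdist c t < T -> `|tnth t i - c i| <= 1 + T.
Proof.
move=> h; apply: le_abs_of_sqr_lt; apply: le_lt_trans h.
rewrite /sqdist (bigD1 i)//= lerDl; apply: sumr_ge0 => j _; exact: sqr_ge0.
Qed.

(** The ball lies in a cube of half-side [1 + T], a crude substitute for the square root of [T]; the
    integral over the cube factorizes. *)
Lemma integral_ball_fin k (c : 'I_k -> R) T :
  (\int[mt k]_t ((sqdist c t < T)%R%:R : R)%:E < +oo)%E.
Proof.
pose I i : set mR := `[c i - (1 + T), c i + (1 + T)]%classic.
have mI i : measurable_fun setT (\1_(I i) : mR -> R) by apply: measurable_indic; exact: measurable_itv.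
apply: (@le_lt_trans _ _ (\int[mt k]_t (\prod_i \1_(I i) (tnth t i))%:E)%E).
  apply: ge0_le_integral => //.
  - by apply/measurable_EFinP; apply: measurable_ltR; exact: measurable_sqdist.
  - apply/measurable_EFinP; apply: measurable_prod => i _.
    exact: (measurableT_comp (mI i) (@measurable_tnth _ mR k i)).
  move=> t _; rewrite lee_fin; have [h|_] := ltP (sqdist c t) T; last first.
    by apply: prodr_ge0 => i _; rewrite indicE.
  rewrite big1// => i _; rewrite indicE mem_set// /I/= in_itv/=.
  have := coord_le_of_sqdist i h; rewrite ler_norml => /andP[h1 h2].
  by apply/andP; split; lra.
rewrite (@ge0_integral_prodT R k (fun i => \1_(I i)))//.
rewrite ltey_eq; apply/orP; left; apply: prode_fin_num => i _.
rewrite integral_indic ?setIT//=; last exact: measurable_itv.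
by rewrite lebesgue_measure_itv/=; case: ifP => // _; rewrite -EFinD.
Qed.

Lemma integrable_ball k (c : 'I_k -> R) T (M : R) (F : k.-tuple mR -> R) :
  measurable_fun setT F -> (forall t, `|F t| <= M * (sqdist c t < T)%R%:R) ->
  (mt k).-integrable setT (EFin \o F).
Proof.
move=> mF FM.
have mb : measurable_fun setT (fun t => (sqdist c t < T)%R%:R : R).
  by apply: measurable_ltR; exact: measurable_sqdist.
have ib : (mt k).-integrable setT (EFin \o (fun t => (sqdist c t < T)%R%:R : R)).
  apply/integrableP; split; first exact/measurable_EFinP.
  apply: le_lt_trans (integral_ball_fin c T); apply: ge0_le_integral => //.
  - by apply/measurable_EFinP; exact: measurableT_comp.
  - exact/measurable_EFinP.
  - by move=> t _; rewrite lee_fin ger0_norm.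
have ibM := integrableZl measurableT M ib.
apply: (le_integrable _ _ _ ibM) => //; first exact/measurable_EFinP.
by move=> t _; rewrite lee_fin; apply: le_trans (FM t) _; exact: ler_norm.
Qed.

Lemma measurable_bump d (E : measurableType d) (f : E -> R) (T : R) : measurable_fun setT f ->
  measurable_fun setT (fun t => bump T (f t)).
Proof. by move=> mf; apply: measurable_maxr => //; exact: measurable_funB. Qed.

Lemma bump_le (T r : R) : 0 <= r -> `|bump T r| <= `|T| * (r < T)%R%:R.
Proof.
move=> r0; rewrite /bump; have [h|h] := ltP r T.
  rewrite mulr1 max_l ?subr_ge0 ?(ltW h)// ger0_norm ?subr_ge0 ?(ltW h)//.
  by rewrite ger0_norm ?(le_trans r0 (ltW h))// lerBlDr lerDl.
by rewrite max_r ?subr_le0// normr0 mulr0.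
Qed.

Definition stein_integrand k (i : 'I_k) (c : 'I_k -> R) T (G g : k.-tuple mR -> R) t : R :=
  (sqdist c t < T)%R%:R * (2 * (tnth t i - c i) * G t) - bump T (sqdist c t) * g t.

Lemma measurable_stein_integrand k (i : 'I_k) c T (G g : k.-tuple mR -> R) :
  measurable_fun setT G -> measurable_fun setT g ->
  measurable_fun setT (stein_integrand i c T G g).
Proof.
move=> mG mg; apply: measurable_funB.
  apply: measurable_funM; first by apply: measurable_ltR; exact: measurable_sqdist.
  apply: measurable_funM => //; apply: measurable_funM => //.
  by apply: measurable_funB => //; exact: measurable_tnth.
by apply: measurable_funM => //; apply: measurable_bump; exact: measurable_sqdist.
Qed.

Lemma integrable_stein_integrand k (i : 'I_k) c T K (G g : k.-tuple mR -> R) :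
  measurable_fun setT G -> measurable_fun setT g ->
  (forall t, `|G t| <= `|tnth t i| * K) -> (forall t, `|g t| <= K) ->
  (mt k).-integrable setT (EFin \o stein_integrand i c T G g).
Proof.
move=> mG mg GK gK.
pose M := 2 * (1 + T) * ((`|c i| + (1 + T)) * K) + `|T| * K.
apply: (@integrable_ball k c T M); first exact: measurable_stein_integrand.
move=> t; rewrite /stein_integrand.
have K0 : 0 <= K := le_trans (normr_ge0 _) (gK t).
apply: le_trans (ler_normB _ _) _; rewrite [X in _ <= X]mulrDl; apply: lerD; last first.
  rewrite normrM -mulrA [K * _]mulrC mulrA; apply: ler_pM => //.
  exact/bump_le/sqdist_ge0.
have [h|h] := ltP (sqdist c t) T; last by rewrite mul0r normr0 mulr0.
have T0 : 0 <= 1 + T.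
  by rewrite addr_ge0//; apply: le_trans (ltW h); exact: sqdist_ge0.
have h1 := coord_le_of_sqdist i h.
rewrite mul1r mulr1 !normrM ger0_norm//; apply: ler_pM => //.
  by rewrite ler_pM2l.
apply: le_trans (GK t) _; rewrite ler_wpM2r//.
by rewrite -[tnth t i](subrK (c i)) addrC; apply: le_trans (ler_normD _ _) _; rewrite lerD2l.
Qed.

Lemma sqdist_upd k (i : 'I_k) c s (t : k.-tuple mR) :
  sqdist c (upd i s t) = (s - c i) ^+ 2 + \sum_(j < k | j != i) (tnth t j - c j) ^+ 2.
Proof.
rewrite /sqdist (bigD1 i)//= tnth_upd eqxx; congr (_ + _).
by apply: eq_bigr => j /negbTE ji; rewrite tnth_upd ji.
Qed.

Lemma stein_coord k (i : 'I_k) c T K (G g : k.-tuple mR -> R) :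
  measurable_fun setT G -> measurable_fun setT g ->
  (forall t, `|G t| <= `|tnth t i| * K) -> (forall t, `|g t| <= K) ->
  (forall t (s : R), is_derive s 1 (fun s : R => G (upd i s t)) (g (upd i s t))) ->
  (forall t, continuous (fun s : R => g (upd i s t))) ->
  (\int[mt k]_t (stein_integrand i c T G g t)%:E = 0)%E.
Proof.
move=> mG mg GK gK dG cg.
apply: (@integral_coord0 _ _ i); first exact: integrable_stein_integrand GK gK.
move=> t; rewrite -[RHS](stein1 (c i) T (\sum_(j < k | j != i) (tnth t j - c j) ^+ 2) (dG t) (cg t)).
by apply: eq_integral => s _; rewrite /stein_integrand sqdist_upd tnth_upd eqxx.
Qed.

End Ball.

Section NullCoord.
Variable R : realType.
Notation mR := (measurableTypeR R).
Notation leb := (@lebesgue_measure R).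
Notation mt := (@mt R).

Lemma mt_coord0 k (l : 'I_k) : mt k [set t | tnth t l = 0] = 0%E.
Proof.
have mZ : measurable [set t : k.-tuple mR | tnth t l = 0].
  have -> : [set t : k.-tuple mR | tnth t l = 0] = setT `&` (fun t : k.-tuple mR => tnth t l) @^-1` [set (0:R)].
    by rewrite setTI; apply/seteqP; split.
  by apply: (@measurable_tnth _ mR k l) => //; exact: measurable_set1.
rewrite -[X in mt k X]setIT -integral_indic//.
pose f (i : 'I_k) : mR -> R := if i == l then \1_[set (0:R)] else cst 1.
have mf i : measurable_fun setT (f i).
  rewrite /f; case: ifP => _ //; apply: measurable_indic; exact: measurable_set1.
have f0 i x : 0 <= f i x by rewrite /f; case: ifP => // _; rewrite ?indicE.
rewrite (eq_integral (fun t => (\prod_i f i (tnth t i))%:E)).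
  rewrite ge0_integral_prodT// (bigD1 l)//= /f eqxx integral_indic//.
  rewrite setIT; apply: (etrans (congr1 (fun z => z * _)%E (lebesgue_measure_set1 (0:R)))).
  exact: mul0e.
move=> t _; rewrite (bigD1 l)//= big1 ?mulr1; last by move=> i /negbTE il; rewrite /f il.
by rewrite /f eqxx !indicE; congr EFin.
Qed.

End NullCoord.

Section Inv.
Variable R : realType.

Lemma measurable_funV_ge0 d (E : measurableType d) (f : E -> R) :
  measurable_fun setT f -> (forall x, 0 <= f x) -> measurable_fun setT (fun x => (f x)^-1).
Proof.
move=> mf f0; have -> : (fun x => (f x)^-1) = (fun x => f x `^ (-1)).
  by apply/funext => x; rewrite powR_inv1.
exact: (measurableT_comp (measurable_powR _)).
Qed.

Lemma measurable_comp_ge0 d (E : measurableType d) (g : R -> R) (f : E -> R) :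
  (forall w : R, 0 <= w -> {for w, continuous g}) ->
  measurable_fun setT f -> (forall x, 0 <= f x) -> measurable_fun setT (fun x => g (f x)).
Proof.
move=> cg mf f0.
have c' : continuous (fun w : R => g `|w|).
  move=> w; apply: (@continuous_comp _ _ _ (fun w : R => `|w|) g); first exact: norm_continuous.
  exact: cg.
have := measurableT_comp (continuous_measurable_fun c') mf.
by apply: eq_measurable_fun => x _ /=; rewrite ger0_norm.
Qed.

End Inv.

Section VectorStein.
Variable R : realType.
Notation mR := (measurableTypeR R).
Notation leb := (@lebesgue_measure R).
Notation mt := (@mt R).
Variables ps dps : R -> R.
Hypothesis dpsE : forall w : R, 0 <= w -> is_derive w 1 ps (dps w).
Hypothesis dps_cont : forall w : R, 0 <= w -> {for w, continuous dps}.
Hypothesis ps01 : forall w, 0 <= w -> 0 <= ps w <= 1.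
Variables Y C : R.
Hypothesis phiY : forall w, 0 <= w -> w * ps w <= Y.
Hypothesis dpsC : forall w, 0 <= w -> (1 + w) * `|w * dps w| <= C.
Variables (p n : nat) (th : 'I_p -> R).
Notation k := (p + n)%N.
Implicit Types t : k.-tuple mR.

Definition xc (i : 'I_p) t : R := tnth t (lshift n i).
Definition zc (j : 'I_n) t : R := tnth t (rshift p j).
Definition qx t : R := \sum_i xc i t ^+ 2.
Definition sz t : R := \sum_j zc j t ^+ 2.
Definition Wt t : R := qx t * (sz t)^-1.
Definition ctr (l : 'I_k) : R := match fintype.split l with inl i => th i | inr _ => 0 end.

Lemma ctrl i : ctr (lshift n i) = th i.
Proof. by rewrite /ctr (unsplitK (inl i)). Qed.
Lemma ctrr i : ctr (rshift p i) = 0.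
Proof. by rewrite /ctr (unsplitK (inr i)). Qed.

Lemma qx_ge0 t : 0 <= qx t. Proof. by apply: sumr_ge0 => i _; exact: sqr_ge0. Qed.
Lemma sz_ge0 t : 0 <= sz t. Proof. by apply: sumr_ge0 => i _; exact: sqr_ge0. Qed.
Lemma Wt_ge0 t : 0 <= Wt t. Proof. by rewrite mulr_ge0 ?qx_ge0 ?invr_ge0 ?sz_ge0. Qed.

Definition vloss t : R := \sum_i (xc i t - th i) ^+ 2.
Definition uloss t : R := \sum_i ((1 - ps (Wt t)) * xc i t - th i) ^+ 2.
(** Where [sz t] is nonzero, [hdiff] is [uloss - vloss]. Stein's identity turns its two terms into
    divergences: [rdiff], the [Delta] of the overview, is [-2] times the divergence of [psi W X] in
    [X] plus the divergence of [Th W Z] in [Z]. *)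
Definition hdiff t : R := \sum_i (-2 * ((xc i t - th i) * (ps (Wt t) * xc i t))) + sz t * Th ps (Wt t).
Definition rdiff t : R :=
  -2 * (p%:R * ps (Wt t) + 2 * (Wt t * dps (Wt t))) + n%:R * Th ps (Wt t) - 2 * Xi ps dps (Wt t).

Lemma sqdist_ctr t : sqdist ctr t = vloss t + sz t.
Proof.
rewrite /sqdist big_split_ord/=; congr (_ + _); apply: eq_bigr => i _.
  by rewrite ctrl.
by rewrite ctrr subr0.
Qed.

Lemma ulossE t : sz t != 0 -> uloss t = vloss t + hdiff t.
Proof.
move=> s0; rewrite /hdiff /Th [in sz t * _]/Wt.
have -> : sz t * (qx t * (sz t)^-1 * ps (Wt t) ^+ 2) = \sum_i xc i t ^+ 2 * ps (Wt t) ^+ 2.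
  by rewrite -mulr_suml -/(qx t); field.
rewrite /uloss /vloss -!big_split/=; apply: eq_bigr => i _; ring.
Qed.

Lemma measurable_xc i : measurable_fun setT (xc i).
Proof. exact: measurable_tnth. Qed.
Lemma measurable_zc i : measurable_fun setT (zc i).
Proof. exact: measurable_tnth. Qed.
Lemma measurable_sz : measurable_fun setT sz.
Proof. by apply: measurable_sum => j; apply: measurable_funX; exact: measurable_zc. Qed.
Lemma measurable_Wt : measurable_fun setT Wt.
Proof.
apply: measurable_funM.
  by apply: measurable_sum => j; apply: measurable_funX; exact: measurable_xc.
by apply: measurable_funV_ge0 => [|t]; [exact: measurable_sz|exact: sz_ge0].
Qed.

Lemma measurable_compW (g : R -> R) : (forall w : R, 0 <= w -> {for w, continuous g}) ->
  measurable_fun setT (g \o Wt).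
Proof. by move=> cg; apply: measurable_comp_ge0 => //; [exact: measurable_Wt|exact: Wt_ge0]. Qed.

Let mps : measurable_fun setT (ps \o Wt).
Proof. by apply: measurable_compW => w w0; exact: isd_continuous (dpsE w0). Qed.
Let mdps : measurable_fun setT (dps \o Wt).
Proof. exact: measurable_compW. Qed.
Let mTh : measurable_fun setT (Th ps \o Wt).
Proof. by apply: measurable_compW => w; apply: Th_cont. Qed.
Let mXi : measurable_fun setT (Xi ps dps \o Wt).
Proof. by apply: measurable_compW => w; apply: Xi_cont. Qed.

Lemma measurable_vloss : measurable_fun setT vloss.
Proof.
by apply: measurable_sum => i; apply: measurable_funX; apply: measurable_funB => //; exact: measurable_xc.
Qed.

Lemma measurable_uloss : measurable_fun setT uloss.
Proof.
apply: measurable_sum => i; apply: measurable_funX; apply: measurable_funB => //.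
by apply: measurable_funM; [apply: measurable_funB|exact: measurable_xc].
Qed.

Lemma measurable_rdiff : measurable_fun setT rdiff.
Proof.
apply: measurable_funB; last by apply: measurable_funM.
apply: measurable_funD; apply: measurable_funM => //.
apply: measurable_funD; apply: measurable_funM => //.
by apply: measurable_funM => //; exact: measurable_Wt.
Qed.

Definition xG i t : R := ps (Wt t) * xc i t.
Definition xg i t : R := ps (Wt t) + 2 * (xc i t ^+ 2 * (sz t)^-1) * dps (Wt t).
Definition zG j t : R := zc j t * Th ps (Wt t).
Definition zg j t : R := Th ps (Wt t) - 2 * (zc j t ^+ 2 * (sz t)^-1) * Xi ps dps (Wt t).

Let Y0 : 0 <= Y. Proof. by have := phiY (lexx 0); rewrite mul0r. Qed.
Let C0 : 0 <= C. Proof. by apply: le_trans (dpsC (lexx 0)); rewrite mul0r normr0 mulr0. Qed.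
Let Kbound : exists K, [/\ 0 <= K, 1 <= K, Y <= K, 1 + 2 * C <= K &
  forall w, 0 <= w -> Y + 2 * `|Xi ps dps w| <= K].
Proof.
have X0 : 0 <= Y + 2 * Y * C by rewrite addr_ge0// !mulr_ge0.
have Xb w (w0 : 0 <= w) := Xi_le ps01 phiY dpsC w0.
move: (Y + 2 * Y * C) X0 Xb => X X0 Xb; exists (1 + 2 * C + Y + 2 * X).
have y0 := Y0; have c0 := C0.
by split; [lra|lra|lra|lra|move=> w w0; have := Xb w w0; lra].
Qed.

Let stein_x i T : (\int[mt k]_t (stein_integrand (lshift n i) ctr T (xG i) (xg i) t)%:E = 0)%E /\
  (mt k).-integrable setT (EFin \o stein_integrand (lshift n i) ctr T (xG i) (xg i)).
Proof.
have [Kb [K0 K1 KY KC KX]] := Kbound.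
have mG : measurable_fun setT (xG i) by apply: measurable_funM => //; exact: measurable_xc.
have mg : measurable_fun setT (xg i).
  apply: measurable_funD => //; apply: measurable_funM => //; apply: measurable_funM => //.
  apply: measurable_funM; first by apply: measurable_funX; exact: measurable_xc.
  by apply: measurable_funV_ge0 => [|t]; [exact: measurable_sz|exact: sz_ge0].
have GK t : `|xG i t| <= `|tnth t (lshift n i)| * Kb.
  have /andP[p0 p1] := ps01 (Wt_ge0 t).
  rewrite /xG normrM mulrC; apply: ler_pM => //; by rewrite ger0_norm//; exact: le_trans K1.
have gK t : `|xg i t| <= Kb.
  have /andP[p0 p1] := ps01 (Wt_ge0 t).
  apply: le_trans (ler_normD _ _) _; rewrite [`|ps _|]ger0_norm//.
  have h : `|2 * (xc i t ^+ 2 * (sz t)^-1) * dps (Wt t)| <= 2 * `|Wt t * dps (Wt t)|.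
    rewrite -mulrA normrM [`|2|]ger0_norm// ler_pM2l// normrM [X in _ <= X]normrM ler_wpM2r//.
    have x0 : 0 <= xc i t ^+ 2 * (sz t)^-1 by apply: mulr_ge0; rewrite ?sqr_ge0 ?invr_ge0 ?sz_ge0.
    rewrite (ger0_norm x0) ger0_norm ?Wt_ge0//.
    rewrite /Wt ler_wpM2r ?invr_ge0 ?sz_ge0// /qx (bigD1 i)//= lerDl.
    by apply: sumr_ge0 => j _; exact: sqr_ge0.
  have := dps_le dpsC (Wt_ge0 t); lra.
split; last exact: integrable_stein_integrand GK gK.
have szu t s : sz (upd (lshift n i) s t) = sz t.
  by apply: eq_bigr => j _; rewrite /zc tnth_upd eq_rlshift.
have xcu t s : xc i (upd (lshift n i) s t) = s by rewrite /xc tnth_upd eqxx.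
pose q t := \sum_(j < p | j != i) xc j t ^+ 2.
have q0 t : 0 <= q t by apply: sumr_ge0 => j _; exact: sqr_ge0.
have Wu t s : Wt (upd (lshift n i) s t) = (s ^+ 2 + q t) * (sz t)^-1.
  rewrite /Wt szu; congr (_ * _); rewrite /qx (bigD1 i)//= xcu; congr (_ + _).
  by apply: eq_bigr => j /negbTE ji; rewrite /xc tnth_upd eq_lshift ji.
apply: stein_coord mG mg GK gK _ _.
- move=> t s; rewrite /xG /xg Wu xcu szu.
  have -> : (fun s => ps (Wt (upd (lshift n i) s t)) * xc i (upd (lshift n i) s t)) =
    (fun s => ps ((s ^+ 2 + q t) * (sz t)^-1) * s) by apply/funext => s'; rewrite Wu xcu.
  by apply: isd_xfield => //; rewrite invr_ge0 sz_ge0.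
- move=> t; rewrite /xg.
  have -> : (fun s => ps (Wt (upd (lshift n i) s t)) + 2 * (xc i (upd (lshift n i) s t) ^+ 2 *
      (sz (upd (lshift n i) s t))^-1) * dps (Wt (upd (lshift n i) s t))) =
    (fun s => ps ((s ^+ 2 + q t) * (sz t)^-1) + 2 * (s ^+ 2 * (sz t)^-1) * dps ((s ^+ 2 + q t) * (sz t)^-1)).
    by apply/funext => s'; rewrite Wu xcu szu.
  by apply: continuous_xfield => //; rewrite invr_ge0 sz_ge0.
Qed.

Let stein_z j T : (\int[mt k]_t (stein_integrand (rshift p j) ctr T (zG j) (zg j) t)%:E = 0)%E /\
  (mt k).-integrable setT (EFin \o stein_integrand (rshift p j) ctr T (zG j) (zg j)).
Proof.
have [Kb [K0 K1 KY KC KX]] := Kbound.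
have mG : measurable_fun setT (zG j) by apply: measurable_funM => //; exact: measurable_zc.
have mg : measurable_fun setT (zg j).
  apply: measurable_funB => //; apply: measurable_funM => //; apply: measurable_funM => //.
  apply: measurable_funM; first by apply: measurable_funX; exact: measurable_zc.
  by apply: measurable_funV_ge0 => [|t]; [exact: measurable_sz|exact: sz_ge0].
have zz t : 0 <= zc j t ^+ 2 * (sz t)^-1 <= 1.
  rewrite mulr_ge0 ?invr_ge0 ?sz_ge0 ?sqr_ge0//=.
  have [->|s0] := eqVneq (sz t) 0; first by rewrite invr0 mulr0.
  have sp : 0 < sz t by rewrite lt0r s0 sz_ge0.
  rewrite ler_pdivrMr// mul1r /sz (bigD1 j)//= lerDl.
  by apply: sumr_ge0 => l _; exact: sqr_ge0.
have ThY t := Th_le ps01 phiY (Wt_ge0 t).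
have Th0 t := Th_ge0 ps (Wt_ge0 t).
have GK t : `|zG j t| <= `|tnth t (rshift p j)| * Kb.
  rewrite /zG normrM; apply: ler_pM => //; rewrite ger0_norm//.
  by apply: le_trans KY.
have gK t : `|zg j t| <= Kb.
  have /andP[z0 z1] := zz t.
  apply: le_trans (ler_normB _ _) _; rewrite [`|Th ps _|]ger0_norm//.
  have h : `|2 * (zc j t ^+ 2 * (sz t)^-1) * Xi ps dps (Wt t)| <= 2 * `|Xi ps dps (Wt t)|.
    rewrite -mulrA normrM [`|2|]ger0_norm// ler_pM2l// normrM [`|_ ^+ 2 * _|]ger0_norm//.
    by rewrite ler_piMl.
  have := KX _ (Wt_ge0 t); have := ThY t; lra.
split; last exact: integrable_stein_integrand GK gK.
pose r t := \sum_(l < n | l != j) zc l t ^+ 2.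
have r0 t : 0 <= r t by apply: sumr_ge0 => l _; exact: sqr_ge0.
have zcu t s : zc j (upd (rshift p j) s t) = s by rewrite /zc tnth_upd eqxx.
have szu t s : sz (upd (rshift p j) s t) = s ^+ 2 + r t.
  rewrite /sz (bigD1 j)//= zcu; congr (_ + _).
  by apply: eq_bigr => l /negbTE lj; rewrite /zc tnth_upd eq_rshift lj.
have Wu t s : Wt (upd (rshift p j) s t) = qx t * (s ^+ 2 + r t)^-1.
  rewrite /Wt szu; congr (_ * _); apply: eq_bigr => i _.
  by rewrite /xc tnth_upd eq_lrshift.
apply: stein_coord mG mg GK gK _ _.
- move=> t s; rewrite /zG /zg Wu zcu szu.
  have -> : (fun s => zc j (upd (rshift p j) s t) * Th ps (Wt (upd (rshift p j) s t))) =
    (fun s => s * Th ps (qx t * (s ^+ 2 + r t)^-1)) by apply/funext => s'; rewrite Wu zcu.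
  exact: (isd_zfield dpsE ps01 phiY dpsC (qx_ge0 t) (r0 t)).
- move=> t; rewrite /zg.
  have -> : (fun s => Th ps (Wt (upd (rshift p j) s t)) - 2 * (zc j (upd (rshift p j) s t) ^+ 2 *
      (sz (upd (rshift p j) s t))^-1) * Xi ps dps (Wt (upd (rshift p j) s t))) =
    (fun s => Th ps (qx t * (s ^+ 2 + r t)^-1) - 2 * (s ^+ 2 * (s ^+ 2 + r t)^-1) * Xi ps dps (qx t * (s ^+ 2 + r t)^-1)).
    by apply/funext => s'; rewrite Wu zcu szu.
  exact: (continuous_zfield dpsE dps_cont ps01 phiY dpsC (qx_ge0 t) (r0 t)).
Qed.

(** A Stein integrand carries the factor [2 (t_i - c_i)]. The cross term of [hdiff] has coefficient
    [-2] and its quadratic term has coefficient [1], whence the weights [-1] and [1/2]. *)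
Let total T t : \sum_i (-1 * stein_integrand (lshift n i) ctr T (xG i) (xg i) t) +
   \sum_j (2^-1 * stein_integrand (rshift p j) ctr T (zG j) (zg j) t) =
   (sqdist ctr t < T)%R%:R * hdiff t - bump T (sqdist ctr t) * (rdiff t / 2).
Proof.
have e1 : \sum_i (-1 * stein_integrand (lshift n i) ctr T (xG i) (xg i) t) =
  (sqdist ctr t < T)%R%:R * (\sum_i (-2 * ((xc i t - th i) * (ps (Wt t) * xc i t)))) +
  bump T (sqdist ctr t) * (p%:R * ps (Wt t) + 2 * (Wt t * dps (Wt t))).
  have -> : p%:R * ps (Wt t) + 2 * (Wt t * dps (Wt t)) = \sum_i xg i t.
    rewrite /xg big_split/= sumr_const card_ord mulr_natl; congr (_ + _).
    by rewrite -mulr_suml -mulr_sumr -mulr_suml -/(qx t) -/(Wt t) mulrA.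
  rewrite !mulr_sumr -big_split/=; apply: eq_bigr => i _.
  rewrite /stein_integrand /xG ctrl -/(xc i t); ring.
have e2 : \sum_j (2^-1 * stein_integrand (rshift p j) ctr T (zG j) (zg j) t) =
  (sqdist ctr t < T)%R%:R * (sz t * Th ps (Wt t)) -
  bump T (sqdist ctr t) * ((n%:R * Th ps (Wt t) - 2 * Xi ps dps (Wt t)) / 2).
  have -> : n%:R * Th ps (Wt t) - 2 * Xi ps dps (Wt t) = \sum_j zg j t.
    rewrite /zg sumrB sumr_const card_ord mulr_natl; congr (_ - _).
    rewrite -mulr_suml -mulr_sumr -mulr_suml -/(sz t).
    (* At [sz t = 0] the sum of the ratios [zc j t ^+ 2 / sz t] is 0 instead of 1. The identity
       survives because the inverse of 0 is 0, so [Wt t = 0] and [Xi] vanishes there. *)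
    have [s0|s0] := eqVneq (sz t) 0; last by rewrite divff// mulr1.
    by rewrite /Wt s0 invr0 !mulr0 /Xi !mul0r mulr0.
  rewrite /sz mulr_suml mulr_suml !mulr_sumr -sumrB; apply: eq_bigr => j _.
  by rewrite /stein_integrand /zG ctrr -/(zc j t); field.
by rewrite e1 e2 /hdiff /rdiff; field.
Qed.

Let total_int T :
  (\int[mt k]_t ((sqdist ctr t < T)%R%:R * hdiff t - bump T (sqdist ctr t) * (rdiff t / 2))%:E = 0)%E /\
  (mt k).-integrable setT (EFin \o (fun t =>
     (sqdist ctr t < T)%R%:R * hdiff t - bump T (sqdist ctr t) * (rdiff t / 2))).
Proof.
pose Fx i t := ((-1)%:E * (stein_integrand (lshift n i) ctr T (xG i) (xg i) t)%:E)%E.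
pose Fz j t := ((2^-1)%:E * (stein_integrand (rshift p j) ctr T (zG j) (zg j) t)%:E)%E.
have iFx i : (mt k).-integrable setT (fun t => Fx i t).
  by apply: integrableZl => //; have [] := stein_x i T.
have iFz j : (mt k).-integrable setT (fun t => Fz j t).
  by apply: integrableZl => //; have [] := stein_z j T.
have ifx : (mt k).-integrable setT (fun t => \sum_(i < p) Fx i t)%E by apply: integrable_sum.
have ifz : (mt k).-integrable setT (fun t => \sum_(j < n) Fz j t)%E by apply: integrable_sum.
have E t : (((sqdist ctr t < T)%R%:R * hdiff t - bump T (sqdist ctr t) * (rdiff t / 2))%:E =
   \sum_(i < p) Fx i t + \sum_(j < n) Fz j t)%E.
  by rewrite -total EFinD -!sumEFin.
split.
  rewrite (eq_integral _ _ (fun t _ => E t)) integralD// !integral_sum//.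
  rewrite !big1 ?adde0// => j _.
    by have [E0 i0] := stein_z j T; rewrite /Fz integralZl// E0 mule0.
  by have [E0 i0] := stein_x j T; rewrite /Fx integralZl// E0 mule0.
by apply: (eq_integrable _ (fun t => \sum_(i < p) Fx i t + \sum_(j < n) Fz j t)%E) => //;
  [move=> t _; rewrite /= E|exact: integrableD].
Qed.

Lemma vloss_ball_integrable T :
  (mt k).-integrable setT (EFin \o (fun t => (sqdist ctr t < T)%R%:R * vloss t)).
Proof.
have v0 t : 0 <= vloss t by apply: sumr_ge0 => i _; exact: sqr_ge0.
apply: (@integrable_ball _ _ ctr T T).
  apply: measurable_funM; last exact: measurable_vloss.
  by apply: measurable_ltR; exact: measurable_sqdist.
move=> t; rewrite ger0_norm ?mulr_ge0// mulrC.
have [h|h] := ltP (sqdist ctr t) T; last by rewrite !mulr0.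
by rewrite !mulr1; apply/ltW; apply: le_lt_trans h; rewrite sqdist_ctr lerDl sz_ge0.
Qed.

Lemma vloss_ball_fin T : (\int[mt k]_t ((sqdist ctr t < T)%R%:R * vloss t)%:E < +oo)%E.
Proof.
have /integrableP[_] := vloss_ball_integrable T; apply: le_lt_trans.
rewrite [X in (_ <= X)%E](eq_integral (fun t => ((sqdist ctr t < T)%R%:R * vloss t)%:E))//.
move=> t _; rewrite /= ger0_norm// mulr_ge0//.
by apply: sumr_ge0 => i _; exact: sqr_ge0.
Qed.

Hypothesis n0 : (0 < n)%N.
Hypothesis rdiff_le0 : forall t, rdiff t <= 0.

Lemma risk_identity T :
  (\int[mt k]_t ((sqdist ctr t < T)%R%:R * vloss t)%:E =
   \int[mt k]_t ((sqdist ctr t < T)%R%:R * uloss t)%:E +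
   \int[mt k]_t (bump T (sqdist ctr t) * (- rdiff t / 2))%:E)%E.
Proof.
have [E0 iE] := total_int T.
have mI : measurable_fun setT (fun t => (sqdist ctr t < T)%R%:R : R).
  by apply: measurable_ltR; exact: measurable_sqdist.
have mB : measurable_fun setT (fun t => bump T (sqdist ctr t)).
  by apply: measurable_bump; exact: measurable_sqdist.
have v0 t : 0 <= vloss t by apply: sumr_ge0 => i _; exact: sqr_ge0.
have u0 t : 0 <= uloss t by apply: sumr_ge0 => i _; exact: sqr_ge0.
have b0 t : 0 <= bump T (sqdist ctr t) by rewrite le_max lexx orbT.
have r0 t : 0 <= - rdiff t / 2 by rewrite divr_ge0// oppr_ge0.
have mvl := measurable_vloss; have mul' := measurable_uloss.
have mrd : measurable_fun setT (fun t => - rdiff t / 2).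
  by apply: measurable_funM => //; apply: measurableT_comp => //; exact: measurable_rdiff.
have iV := vloss_ball_integrable T.
rewrite -ge0_integralD//; last 4 first.
- by move=> t _; rewrite lee_fin mulr_ge0.
- by apply/measurable_EFinP; exact: measurable_funM.
- by move=> t _; rewrite lee_fin mulr_ge0.
- by apply/measurable_EFinP; exact: measurable_funM.
rewrite -[LHS]adde0 -E0 -integralD//.
apply: ae_eq_integral => //.
- apply: emeasurable_funD; exact: (measurable_int (mt k)).
- by apply: emeasurable_funD; apply/measurable_EFinP; exact: measurable_funM.
(* [ulossE] can fail only where [sz] vanishes, a set contained in the null hyperplane on which this
   single coordinate is zero. *)
pose j0 : 'I_n := Ordinal n0.
exists [set t | tnth t (rshift p j0) = 0]; split.
- have -> : [set t : k.-tuple mR | tnth t (rshift p j0) = 0] =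
     setT `&` (fun t : k.-tuple mR => tnth t (rshift p j0)) @^-1` [set (0:R)].
    by rewrite setTI; apply/seteqP; split.
  by apply: (@measurable_tnth _ mR k (rshift p j0)) => //; exact: measurable_set1.
- exact: mt_coord0.
move=> t /=; apply: contra_notP => tn0 _; rewrite -!EFinD; congr EFin.
rewrite ulossE; first by ring.
rewrite gt_eqF// /sz (bigD1 j0)//= ltr_pwDl//.
  by rewrite exprn_even_gt0//=; apply/eqP.
by apply: sumr_ge0 => l _; exact: sqr_ge0.
Qed.

End VectorStein.

(** * From balls to arbitrary radial weights *)

Section PushDensity.
Context (R : realType) (d : measure_display) (T : measurableType d).
Variable mu : {measure set T -> \bar R}.
Notation mR := (measurableTypeR R).
Variables (F : T -> \bar R) (rho : T -> mR).
Hypotheses (mF : measurable_fun setT F) (F0 : forall t, (0 <= F t)%E) (mrho : measurable_fun setT rho).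

(** The image under [rho] of the measure with density [F]. The three proofs are arguments so that
    the measure structure can be attached to the function itself. *)
Definition pushdens of measurable_fun setT F & (forall t, (0 <= F t)%E) & measurable_fun setT rho :=
  fun B : set mR => (\int[mu]_(t in rho @^-1` B) F t)%E.

Let m := pushdens mF F0 mrho.
Let m0 : m set0 = 0%E. Proof. by rewrite /m /pushdens preimage_set0 integral_set0. Qed.
Let m_ge0 B : (0 <= m B)%E. Proof. by apply: integral_ge0 => t _. Qed.
Let m_add : semi_sigma_additive m.
Proof.
move=> B mB tB mUB; rewrite /m /pushdens preimage_bigcup.
have mpB k : measurable (rho @^-1` B k).
  by rewrite -[X in measurable X]setTI; exact: mrho.
rewrite ge0_integral_bigcup//; last 2 first.
- exact: measurable_funTS.
- apply/trivIsetP => /= i j _ _ ij; rewrite -preimage_setI.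
  by move/trivIsetP : tB => /(_ _ _ _ _ ij) ->//; rewrite preimage_set0.
by apply: is_cvg_ereal_nneg_natsum_cond => k _ _; apply: integral_ge0 => t _.
Qed.
HB.instance Definition _ := isMeasure.Build _ _ _ (pushdens mF F0 mrho) m0 m_ge0 m_add.

End PushDensity.

Section Compare.
Context (R : realType) (d : measure_display) (E : measurableType d).
Variable mu : {sigma_finite_measure set E -> \bar R}.
Notation mR := (measurableTypeR R).
Notation leb := (@lebesgue_measure R).

Lemma measurable_ltR2 d' (X : measurableType d') (f g : X -> R) :
  measurable_fun setT f -> measurable_fun setT g ->
  measurable_fun setT (fun t => (f t < g t)%R%:R : R).
Proof.
move=> mf mg; have := @measurable_ltR R _ X (fun t => f t - g t) 0 (measurable_funB mf mg).
by apply: eq_measurable_fun => x _; rewrite subr_lt0.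
Qed.

Lemma integral_ind_lt (r T : R) :
  (\int[leb]_s ((r < s)%R%:R * (s < T)%R%:R)%:E = (bump T r)%:E)%E.
Proof.
transitivity (\int[leb]_s (\1_(`]r, T[%classic : set mR) s)%:E)%E.
  apply: eq_integral => s _; rewrite indicE; congr EFin; rewrite -natrM mulnb; congr (nat_of_bool _)%:R.
  by apply/idP/idP; rewrite inE/= in_itv.
rewrite integral_indic//.
rewrite setIT; apply: etrans (lebesgue_measure_itv _) _; rewrite /= lte_fin /bump.
have [h|h] := ltP r T; first by rewrite max_l ?subr_ge0 ?(ltW h).
by rewrite max_r ?subr_le0.
Qed.

Lemma layer_cake (F h : E -> R) : measurable_fun setT F -> (forall t, 0 <= F t) ->
  measurable_fun setT h -> (forall t, 0 <= h t) ->
  (\int[mu]_t (F t * h t)%:E =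
   \int[leb]_u \int[mu]_t ((0 < u)%R%:R * (u < h t)%R%:R * F t)%:E)%E.
Proof.
move=> mF F0 mh h0.
pose f (z : E * mR) := ((0 < z.2)%R%:R * (z.2 < h z.1)%R%:R * F z.1)%:E.
have mf : measurable_fun setT f.
  apply/measurable_EFinP; apply: measurable_funM; last exact: measurableT_comp mF measurable_fst.
  apply: measurable_funM; apply: measurable_ltR2 => //; exact: measurableT_comp mh measurable_fst.
have f0 z : (0 <= f z)%E by rewrite lee_fin !mulr_ge0.
rewrite -[RHS](@fubini_tonelli _ _ _ _ _ mu leb f mf f0).
apply: eq_integral => t _; rewrite /f/=.
under eq_integral do rewrite EFinM muleC.
rewrite ge0_integralZl//.
- by rewrite integral_ind_lt /bump subr0 max_l.
- apply/measurable_EFinP; apply: measurable_funM; apply: measurable_ltR2 => //.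
- by rewrite lee_fin.
Qed.

Variables (rho : E -> mR) (U V L : E -> R).
Hypotheses (mrho : measurable_fun setT rho) (mU : measurable_fun setT U) (mV : measurable_fun setT V)
  (mL : measurable_fun setT L).
Hypotheses (U0 : forall t, 0 <= U t) (V0 : forall t, 0 <= V t) (L0 : forall t, 0 <= L t).
Hypothesis Vfin : forall T, (\int[mu]_t ((rho t < T)%R%:R * V t)%:E < +oo)%E.
Hypothesis UV : forall T, (\int[mu]_t ((rho t < T)%R%:R * V t)%:E =
   \int[mu]_t ((rho t < T)%R%:R * U t)%:E + \int[mu]_t (bump T (rho t) * L t)%:E)%E.

Let Q (s : mR) : \bar R := (\int[mu]_t ((rho t < s)%R%:R * L t)%:E)%E.
Let fQ (z : mR * E) := ((rho z.2 < z.1)%R%:R * L z.2)%:E.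
Let mfQ : measurable_fun setT fQ.
Proof.
apply/measurable_EFinP; apply: measurable_funM; last exact: measurableT_comp mL measurable_snd.
apply: measurable_ltR2; last exact: measurable_fst.
exact: measurableT_comp mrho measurable_snd.
Qed.
Let fQ0 z : (0 <= fQ z)%E. Proof. by rewrite lee_fin mulr_ge0. Qed.
Let mQ : measurable_fun setT Q.
Proof. exact: (@measurable_fun_fubini_tonelli_F _ _ _ _ _ mu fQ mfQ fQ0). Qed.
Let Q0 s : (0 <= Q s)%E. Proof. by apply: integral_ge0 => t _; exact: (fQ0 (s, t)). Qed.

Let mEU : measurable_fun setT (EFin \o U). Proof. exact/measurable_EFinP. Qed.
Let mEV : measurable_fun setT (EFin \o V). Proof. exact/measurable_EFinP. Qed.
Let EU0 t : (0 <= (EFin \o U) t)%E. Proof. by rewrite lee_fin. Qed.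
Let EV0 t : (0 <= (EFin \o V) t)%E. Proof. by rewrite lee_fin. Qed.
Let mid : measurable_fun setT (fun s : mR => s : mR). Proof. exact: measurable_id. Qed.

Let kU : {measure set mR -> \bar R} := pushdens mu mEU EU0 mrho.
Let kV : {measure set mR -> \bar R} := pushdens mu mEV EV0 mrho.
Let kQ : {measure set mR -> \bar R} := pushdens leb mQ Q0 mid.

Let ray (F : E -> R) T :
  (\int[mu]_(t in rho @^-1` `]-oo, T[) (F t)%:E = \int[mu]_t ((rho t < T)%R%:R * F t)%:E)%E.
Proof.
rewrite integral_mkcond; apply: eq_integral => t _; rewrite patchE.
have -> : (t \in rho @^-1` `]-oo, T[%classic) = (rho t < T).
  by apply/idP/idP; rewrite inE/= in_itv.
by case: ifP => _; rewrite ?mul1r ?mul0r.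
Qed.

(** Tonelli, since [(T - rho)^+] is the length of the set of [s] with [rho < s < T]. The correction
    term in [UV] thus becomes the mass that a measure on the line gives to a ray. *)
Let rayQ T : kQ `]-oo, T[%classic = (\int[mu]_t (bump T (rho t) * L t)%:E)%E.
Proof.
rewrite [LHS](_ : _ = \int[leb]_(s in `]-oo, T[) Q s)%E// integral_mkcond.
pose g (z : mR * E) := ((z.1 < T)%R%:R * ((rho z.2 < z.1)%R%:R * L z.2))%:E.
have mg : measurable_fun setT g.
  apply/measurable_EFinP; apply: measurable_funM; last exact/measurable_EFinP.
  by apply: measurable_ltR2 => //; exact: measurable_fst.
have g0 z : (0 <= g z)%E by rewrite lee_fin !mulr_ge0.
transitivity (\int[leb]_s \int[mu]_t g (s, t))%E.
  apply: eq_integral => s _; rewrite patchE.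
  have -> : (s \in `]-oo, T[%classic) = (s < T) by apply/idP/idP; rewrite inE/= in_itv.
  case: ifP => h; first by apply: eq_integral => t _; rewrite /g/= h mul1r.
  by rewrite integral0_eq// => t _; rewrite /g/= h mul0r.
rewrite (@fubini_tonelli _ _ _ _ _ leb mu g mg g0).
apply: eq_integral => t _; rewrite /g/=.
transitivity (\int[leb]_s ((L t)%:E * ((rho t < s)%R%:R * (s < T)%R%:R)%:E))%E.
  by apply: eq_integral => s _; rewrite -EFinM; congr EFin; ring.
rewrite ge0_integralZl//.
- by rewrite integral_ind_lt -EFinM mulrC.
- apply/measurable_EFinP; apply: measurable_funM; apply: measurable_ltR2 => //.
- by rewrite lee_fin.
Qed.

(** [UV] is this equality on open left rays. These form a generating family closed under
    intersection, and the rays ending at the natural numbers exhaust the line with finite [kV] mass,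
    so the equality extends to all Borel sets. *)
Let kVE (A : set mR) : measurable A -> kV A = (kU A + kQ A)%E.
Proof.
move=> mA; rewrite -[RHS](measure_addE kU kQ).
apply: (@measure_unique _ R mR (@RGenInftyO.G R) (fun n => `]-oo, n%:R[%classic) _ _ _ _ kV (measure_add kU kQ)) => //.
- exact: RGenInftyO.measurableE.
- move=> _ _ [x ->] [y ->]; exists (Num.min x y); apply/seteqP; split=> z/=; rewrite !in_itv/= lt_min.
    by move=> [-> ->].
  by move/andP.
- by move=> i; exists i%:R.
- rewrite -subTset => x _; exists (Num.truncn `|x|).+1 => //=; rewrite in_itv/=.
  exact: le_lt_trans (ler_norm _) (truncnS_gt _).
- move=> _ [x ->]; rewrite [RHS]measure_addE rayQ /kV /kU /pushdens.
  by rewrite [LHS](ray V) [X in (X + _)%E](ray U) UV.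
- by move=> i; rewrite /kV /pushdens [X in (X < _)%E](ray V).
Qed.

Let cut (h : mR -> R) (u : R) : set mR := [set r | (0 < u) && (u < h r)].

(** The layer cake formula reduces [h] to its superlevel sets. These may be arbitrary Borel sets,
    which is why the comparison had to be extended from rays to measures. *)
Lemma compare_rho (h : mR -> R) : measurable_fun setT h -> (forall r, 0 <= h r) ->
  (\int[mu]_t (U t * h (rho t))%:E <= \int[mu]_t (V t * h (rho t))%:E)%E.
Proof.
move=> mh h0.
have mhr : measurable_fun setT (fun t => h (rho t)) by exact: measurableT_comp mh mrho.
have G (F : E -> R) (u : R) : ((\int[mu]_t ((0 < u)%R%:R * (u < h (rho t))%R%:R * F t)%:E) =
   \int[mu]_(t in rho @^-1` cut h u) (F t)%:E)%E.
  rewrite [RHS]integral_mkcond; apply: eq_integral => t _; rewrite patchE.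
  have -> : (t \in rho @^-1` cut h u) = (0 < u) && (u < h (rho t)).
    by apply/idP/idP; rewrite inE.
  by case: (0 < u); case: (u < h (rho t)); rewrite ?mul1r ?mul0r.
have mA (u : R) : measurable (cut h u).
  rewrite /cut; have [u0|_] := ltP 0 u => /=; last first.
    by rewrite (_ : [set _ | _] = set0) ?measurable0//; apply/seteqP; split.
  rewrite (_ : [set _ | _] = setT `&` h @^-1` `]u, +oo[).
    by apply: mh => //; exact: measurable_itv.
  by rewrite setTI; apply/seteqP; split=> r/=; rewrite in_itv/= andbT.
have mm (F : E -> R) : measurable_fun setT F -> (forall t, 0 <= F t) ->
   measurable_fun setT (fun u : mR => \int[mu]_t ((0 < u)%R%:R * (u < h (rho t))%R%:R * F t)%:E)%E.
  move=> mF F0.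
  pose f (z : mR * E) := ((0 < z.1)%R%:R * (z.1 < h (rho z.2))%R%:R * F z.2)%:E.
  apply: (@measurable_fun_fubini_tonelli_F _ _ _ _ _ mu f).
    apply/measurable_EFinP; apply: measurable_funM; last exact: measurableT_comp mF measurable_snd.
    apply: measurable_funM; apply: measurable_ltR2 => //; exact: measurableT_comp mhr measurable_snd.
  by move=> z; rewrite lee_fin !mulr_ge0.
rewrite !layer_cake//; apply: ge0_le_integral => //.
- by move=> u _; apply: integral_ge0 => t _; rewrite lee_fin !mulr_ge0.
- exact: mm.
- exact: mm.
move=> u _; rewrite !G.
rewrite -[X in (_ <= X)%E]/(kV (cut h u)) kVE//.
by rewrite leeDl.
Qed.

End Compare.

Section IntRn.
Variable R : realType.
Notation mR := (measurableTypeR R).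
Notation leb := (@lebesgue_measure R).

Lemma eq_intRn k (F G : 'rV[R]_k -> \bar R) : F =1 G -> intRn F = intRn G.
Proof. by move=> /funext ->. Qed.

Lemma intRnD p n (G : 'rV[R]_(p + n) -> \bar R) :
  intRn (fun x : 'rV_p => intRn (fun z : 'rV_n => G (row_mx x z))) = intRn G.
Proof.
elim: p G => [|p IH] G.
  by rewrite /=; apply: eq_intRn => z; rewrite row_thin_mx.
rewrite /=; apply: eq_integral => x _; rewrite -IH.
apply: eq_intRn => u; apply: eq_intRn => z; congr G.
by rewrite row_mxA castmx_id.
Qed.

(** The closed form of the estimator is available only for [S > 0], and nothing is assumed on [F]
    where [sqnorm] vanishes. All such points have first coordinate zero, so in the iterated integral
    only the value of the outer integrand at 0 can change. *)
Lemma intRn_eq_off0 n (F G : 'rV[R]_n -> \bar R) : (0 < n)%N ->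
  measurable_fun setT (fun t => G (rv t)) -> (forall v, 0 <= G v)%E ->
  (forall v, 0 < sqnorm v -> F v = G v) -> intRn F = intRn G.
Proof.
case: n F G => // n F G _ mG G0 FG /=.
set gF := fun x => intRn _; set gG := fun x => intRn _.
have mcons x : measurable_fun setT (fun t : n.-tuple mR => G (rv (consT (x, t)))).
  have := measurableT_comp mG (@measurable_consT R n).
  by move=> /measurableT_comp/(_ (pair1_measurable x)).
have mgG : measurable_fun setT gG.
  pose f (z : mR * n.-tuple mR) := G (rv (consT z)).
  have mf : measurable_fun setT f by exact: measurableT_comp mG (@measurable_consT R n).
  have := @measurable_fun_fubini_tonelli_F _ _ _ _ _ (mt R n) f mf (fun z => G0 _).
  apply: eq_measurable_fun => x _; rewrite /gG intRnE//.
  - by apply: eq_integral => t _; rewrite rv_cons.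
  - by apply: eq_measurable_fun (mcons x) => t _; rewrite rv_cons.
have FE x : x != 0 -> gF x = gG x.
  move=> x0; apply: eq_intRn => v; apply: FG.
  rewrite /sqnorm big_ord_recl ltr_pwDl//; last by apply: sumr_ge0 => i _; exact: sqr_ge0.
  rewrite exprn_even_gt0//= mxE; case: splitP => // j _; by rewrite mxE.
apply: ae_eq_integral => //.
  rewrite -/gF; have -> : gF = (fun x => if x == 0 then gF 0 else gG x).
    by apply/funext => x; case: eqVneq => [->//|/FE].
  apply: measurable_fun_ifT => //.
  apply: (measurable_fun_bool true).
  rewrite (_ : _ `&` _ = [set (0 : R)]); first exact: measurable_set1.
  by apply/seteqP; split=> x /=; [move=> [_ /eqP]|move=> ->; rewrite eqxx].
exists [set (0 : R)]; split; first exact: measurable_set1.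
  exact: lebesgue_measure_set1.
by move=> x /=; apply: contra_notP => x0 _; apply: FE; apply/eqP.
Qed.

End IntRn.

(** * Risk of a shrinkage estimator compared with the risk of [X] *)

Section RiskCompare.
Variable R : realType.
Notation mR := (measurableTypeR R).
Notation leb := (@lebesgue_measure R).
Variables (p n : nat) (f : R -> R) (theta : 'rV[R]_p) (eta : R).
Hypotheses (mf : measurable_fun setT f) (f0 : forall t : R, 0 <= t -> 0 <= f t) (eta0 : 0 < eta).

Definition shrink_loss (ps : R -> R) (x : 'rV[R]_p) (z : 'rV[R]_n) : R :=
  eta * sqnorm ((1 - ps (sqnorm x / sqnorm z)) *: x - theta) * dens f theta eta x z.

Lemma sqnorm_ge0 k (v : 'rV[R]_k) : 0 <= sqnorm v.
Proof. by apply: sumr_ge0 => i _; exact: sqr_ge0. Qed.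

Lemma dens_ge0 x (z : 'rV[R]_n) : 0 <= dens f theta eta x z.
Proof.
by rewrite mulr_ge0 ?powR_ge0// f0// mulr_ge0 ?(ltW eta0)// addr_ge0 ?sqnorm_ge0.
Qed.

Lemma shrink_loss_ge0 ps x z : 0 <= shrink_loss ps x z.
Proof. by apply: mulr_ge0 (dens_ge0 _ _); rewrite mulr_ge0 ?(ltW eta0) ?sqnorm_ge0. Qed.

Lemma measurable_sqnorm d (E : measurableType d) k (v : E -> 'rV[R]_k) :
  (forall i, measurable_fun setT (fun e => v e ord0 i)) -> measurable_fun setT (fun e => sqnorm (v e)).
Proof. by move=> mv; apply: measurable_sum => i; exact: measurable_funX. Qed.

Lemma measurable_shrink_loss d (E : measurableType d) ps (x : E -> 'rV[R]_p) (z : E -> 'rV[R]_n) :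
  (forall w : R, 0 <= w -> {for w, continuous ps}) ->
  (forall i, measurable_fun setT (fun e => x e ord0 i)) ->
  (forall i, measurable_fun setT (fun e => z e ord0 i)) ->
  measurable_fun setT (fun e => shrink_loss ps (x e) (z e)).
Proof.
move=> cps mx mz.
have mW : measurable_fun setT (fun e => sqnorm (x e) / sqnorm (z e)).
  apply: measurable_funM; first exact: measurable_sqnorm.
  by apply: measurable_funV_ge0 => [|e]; [exact: measurable_sqnorm|exact: sqnorm_ge0].
have mps : measurable_fun setT (fun e => ps (sqnorm (x e) / sqnorm (z e))).
  by apply: measurable_comp_ge0 => // e; rewrite divr_ge0 ?sqnorm_ge0.
apply: measurable_funM.
  apply: measurable_funM => //; apply: measurable_sqnorm => i.
  rewrite (_ : (fun _ => _) = (fun e => (1 - ps (sqnorm (x e) / sqnorm (z e))) * x e ord0 i - theta ord0 i)).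
    apply: measurable_funB => //; apply: measurable_funM => //; exact: measurable_funB.
  by apply/funext => e; rewrite !mxE.
apply: measurable_funM => //; apply: measurableT_comp mf _; apply: measurable_funM => //.
apply: measurable_funD; apply: measurable_sqnorm => // i.
rewrite (_ : (fun _ => _) = (fun e => x e ord0 i - theta ord0 i)); first exact: measurable_funB.
by apply/funext => e; rewrite !mxE.
Qed.

Lemma risk_shrinkE (d : 'rV[R]_p -> R -> 'rV[R]_p) (ps : R -> R) : (0 < n)%N ->
  (forall w : R, 0 <= w -> {for w, continuous ps}) ->
  (forall x s, 0 < s -> d x s = (1 - ps (sqnorm x / s)) *: x) ->
  risk n f d theta eta = (\int[mt R (p + n)]_t (shrink_loss ps (lsubmx (rv t)) (rsubmx (rv t)))%:E)%E.
Proof.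
move=> n0 cps dE.
transitivity (intRn (fun x : 'rV[R]_p => intRn (fun z : 'rV[R]_n => (shrink_loss ps x z)%:E))).
  apply: eq_intRn => x; apply: intRn_eq_off0 => //.
  - apply/measurable_EFinP; apply: measurable_shrink_loss => // i.
    rewrite (_ : (fun _ => _) = (fun t => tnth t i)); first exact: measurable_tnth.
    by apply/funext => t; rewrite !mxE.
  - by move=> z; rewrite lee_fin shrink_loss_ge0.
  - by move=> z z0; rewrite /shrink_loss dE.
rewrite -[RHS](intRnE (F := fun v => (shrink_loss ps (lsubmx v) (rsubmx v))%:E)); last 2 first.
- apply/measurable_EFinP; apply: measurable_shrink_loss => // i.
  + rewrite (_ : (fun _ => _) = (fun t => tnth t (lshift n i))); first exact: measurable_tnth.
    by apply/funext => t; rewrite !mxE.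
  + rewrite (_ : (fun _ => _) = (fun t => tnth t (rshift p i))); first exact: measurable_tnth.
    by apply/funext => t; rewrite !mxE.
- by move=> v; rewrite lee_fin shrink_loss_ge0.
rewrite -intRnD; apply: eq_intRn => x; apply: eq_intRn => z.
by rewrite row_mxKl row_mxKr.
Qed.

Variables ps dps : R -> R.
Hypothesis dpsE : forall w : R, 0 <= w -> is_derive w 1 ps (dps w).
Hypothesis dps_cont : forall w : R, 0 <= w -> {for w, continuous dps}.
Hypothesis ps01 : forall w, 0 <= w -> 0 <= ps w <= 1.
Variables Y C : R.
Hypothesis phiY : forall w, 0 <= w -> w * ps w <= Y.
Hypothesis dpsC : forall w, 0 <= w -> (1 + w) * `|w * dps w| <= C.
Hypothesis diff_le0 : forall w, 0 <= w ->
  -2 * (p%:R * ps w + 2 * (w * dps w)) + n%:R * Th ps w - 2 * Xi ps dps w <= 0.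

Lemma risk_shrink_le (d : 'rV[R]_p -> R -> 'rV[R]_p) : (0 < n)%N ->
  (forall x s, 0 < s -> d x s = (1 - ps (sqnorm x / s)) *: x) ->
  (risk n f d theta eta <= risk n f (fun x _ => x) theta eta)%E.
Proof.
move=> n0 dE.
have cps (w : R) : 0 <= w -> {for w, continuous ps} by move=> w0; exact: isd_continuous (dpsE w0).
rewrite (risk_shrinkE n0 cps dE).
rewrite (@risk_shrinkE (fun x _ => x) (fun=> 0) n0); last 2 first.
- by move=> w _; exact: cst_continuous.
- by move=> x s _; rewrite subr0 scale1r.
pose th i := theta ord0 i.
(* The radial weight absorbs the factor [eta] of the loss and all of the density. The maximum makes
   it nonnegative on the whole line; it is inert at the values of [rho], where [f] is evaluated at a
   nonnegative point. *)
pose h (r : mR) : R := eta * (powR eta ((p + n)%:R / 2) * Num.max (f (eta * r)) 0).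
have mh : measurable_fun setT h.
  apply: measurable_funM => //; apply: measurable_funM => //; apply: measurable_maxr => //.
  by apply: measurableT_comp mf _; exact: measurable_funM.
have h0 r : 0 <= h r by rewrite !mulr_ge0 ?(ltW eta0) ?powR_ge0// le_max lexx orbT.
have loss g (t : (p + n).-tuple mR) : shrink_loss g (lsubmx (rv t)) (rsubmx (rv t)) =
   uloss g th t * h (sqdist (ctr th) t).
  have rhoE : sqnorm (lsubmx (rv t) - theta) + sqnorm (rsubmx (rv t)) = sqdist (ctr th) t.
    rewrite sqdist_ctr; congr (_ + _); apply: eq_bigr => i _; by rewrite !mxE.
  have qE : sqnorm (lsubmx (rv t)) = qx t by apply: eq_bigr => i _; rewrite !mxE.
  have zE : sqnorm (rsubmx (rv t)) = sz t by apply: eq_bigr => i _; rewrite !mxE.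
  have uE : sqnorm ((1 - g (Wt t)) *: lsubmx (rv t) - theta) = uloss g th t.
    by apply: eq_bigr => i _; rewrite !mxE.
  rewrite /shrink_loss /dens rhoE qE zE -/(Wt t) uE /h.
  rewrite (max_l (f0 _)) ?mulr_ge0 ?(ltW eta0) ?sqdist_ge0//; ring.
have lossV t : uloss (fun=> 0) th t = vloss th t.
  by apply: eq_bigr => i _; rewrite subr0 mul1r.
under eq_integral do rewrite loss.
under [X in (_ <= X)%E]eq_integral do rewrite loss lossV.
have rd (t : (p + n).-tuple mR) : rdiff ps dps t <= 0 by apply: diff_le0; exact: Wt_ge0.
apply: (@compare_rho R _ _ (mt R (p + n)) (sqdist (ctr th)) (uloss ps th) (vloss th)
  (fun t => - rdiff ps dps t / 2)) => //.
- exact: measurable_sqdist.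
- exact: (measurable_uloss dpsE).
- exact: measurable_vloss.
- apply: measurable_funM => //; apply: measurableT_comp => //.
  exact: (measurable_rdiff dpsE).
- by move=> t; apply: sumr_ge0 => i _; exact: sqr_ge0.
- by move=> t; apply: sumr_ge0 => i _; exact: sqr_ge0.
- by move=> t; rewrite divr_ge0// oppr_ge0.
- exact: vloss_ball_fin.
- move=> T; exact: (risk_identity dpsE dps_cont ps01 phiY dpsC).
Qed.

End RiskCompare.

(** * The generalized Bayes estimator in closed form *)

Section Affine.
Variable R : realType.
Notation mR := (measurableTypeR R).
Notation leb := (@lebesgue_measure R).

Definition affine (c d : R) (x : mR) : mR := c * x + d.

Lemma measurable_affine c d : measurable_fun setT (affine c d).
Proof. by apply: measurable_funD => //; exact: measurable_funM. Qed.

HB.instance Definition _ c d := isMeasurableFun.Build _ _ _ _ (affine c d) (measurable_affine c d).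

Let affine_itv (c d : R) (X : set mR) : c != 0 -> ocitv X ->
  leb X = (`|c|%:E * leb (affine c d @^-1` X))%E.
Proof.
move=> c0 [[a b] _ <-] /=.
have [cp|cn] := ltP 0 c.
  have -> : affine c d @^-1` `]a, b] = `](a - d) / c, (b - d) / c]%classic.
    apply/seteqP; split=> x /=; rewrite /affine !in_itv/= ltr_pdivrMr// ler_pdivlMr// => /andP[h1 h2];
    by apply/andP; split; lra.
  rewrite [LHS](lebesgue_measure_itv `]a, b]) [X in (_ * X)%E](lebesgue_measure_itv `](a - d) / c, (b - d) / c]) /=.
  rewrite !lte_fin ltr_pM2r ?invr_gt0// ltrD2r; case: ifP => _; last by rewrite mule0.
  by rewrite -!EFinD -EFinM gtr0_norm//; congr EFin; field.
have cl : c < 0 by rewrite lt_neqAle c0.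
(* A negative factor turns the half-open interval around; its length, and hence its measure, is
   unaffected. *)
have -> : affine c d @^-1` `]a, b] = `[(b - d) / c, (a - d) / c[%classic.
  apply/seteqP; split=> x /=; rewrite /affine !in_itv/= ltr_ndivlMr// ler_ndivrMr// => /andP[h1 h2];
  by apply/andP; split; lra.
rewrite [LHS](lebesgue_measure_itv `]a, b]) [X in (_ * X)%E](lebesgue_measure_itv `[(b - d) / c, (a - d) / c[) /=.
rewrite !lte_fin ltr_nM2r ?invr_lt0// ltrD2r; case: ifP => _; last by rewrite mule0.
by rewrite -!EFinD -EFinM ltr0_norm//; congr EFin; field.
Qed.

Lemma ge0_integral_affine (c d : R) (g : mR -> \bar R) : c != 0 ->
  measurable_fun setT g -> (forall x, 0 <= g x)%E ->
  (\int[leb]_x g x = `|c|%:E * \int[leb]_x g (c * x + d)%R)%E.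
Proof.
move=> c0 mg g0.
pose nu' : {measure set mR -> \bar R} := mscale (NngNum (normr_ge0 c)) (pushforward leb (affine c d)).
pose nu := nu' (measurable_affine c d).
transitivity (\int[nu]_x g x)%E.
  by apply: eq_measure_integral => A mA _; apply: lebesgue_measure_unique => // X oX; exact: affine_itv.
rewrite ge0_integral_mscale//; congr (_ * _)%E.
by rewrite ge0_integral_pushforward// preimage_setT.
Qed.

Lemma ge0_integral_mt_affine k (c : R) (d : 'I_k -> R) (g : k.-tuple mR -> \bar R) : c != 0 ->
  measurable_fun setT g -> (forall x, 0 <= g x)%E ->
  (\int[mt R k]_t g t = (`|c| ^+ k)%:E * \int[mt R k]_t g [tuple (c * tnth t i + d i)%R | i < k])%E.
Proof.
move=> c0.
have maff n (e : 'I_n -> R) : measurable_fun setT (fun t : n.-tuple mR => [tuple (c * tnth t i + e i)%R | i < n] : n.-tuple mR).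
  apply/measurable_fun_tnthP => i.
  rewrite (_ : _ \o _ = (fun t : n.-tuple mR => c * tnth t i + e i)); last first.
    by apply/funext => t /=; rewrite tnth_mktuple.
  by apply: measurable_funD => //; apply: measurable_funM => //; exact: measurable_tnth.
elim: k d g => [|k IH] d g mg g0.
  rewrite expr0 mul1e; apply: eq_integral => t _; congr g; by apply: eq_from_tnth => -[].
have mg' := measurableT_comp mg (maff _ d).
rewrite (ge0_integral_mtS mg g0) (ge0_integral_mtS mg'); last by move=> t; exact: g0.
have mcons x : measurable_fun setT (fun t : k.-tuple mR => g (consT (x, t))).
  exact: (measurableT_comp (measurableT_comp mg (@measurable_consT R k)) (pair1_measurable x)).
have mI (h : k.+1.-tuple mR -> \bar R) : measurable_fun setT h -> (forall t, 0 <= h t)%E ->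
   measurable_fun setT (fun x : mR => \int[mt R k]_t h (consT (x, t)))%E.
  move=> mh h0; exact: (@measurable_fun_fubini_tonelli_F _ _ _ _ _ (mt R k) (h \o @consT R k)
    (measurableT_comp mh (@measurable_consT R k)) (fun z => h0 _)).
rewrite (ge0_integral_affine (d ord0) c0 (mI g mg g0)); last by move=> x; exact: integral_ge0.
rewrite exprS EFinM -muleA; congr (_ * _)%E.
rewrite -ge0_integralZl//; last 2 first.
- exact: mI mg' (fun t => g0 _).
- by move=> x _; apply: integral_ge0 => t _ /=.
apply: eq_integral => x _.
rewrite (IH (fun i => d (lift ord0 i)) _ (mcons _)) => [|t]; last exact: g0.
congr (_ * _)%E; apply: eq_integral => t _ /=; congr g.
apply: eq_from_tnth => i; rewrite tnth_mktuple.
have [j ->|->] := unliftP ord0 i; first by rewrite /consT/= !tnthS tnth_mktuple.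
by rewrite !tnth0.
Qed.

End Affine.

Section Feynman.
Variable R : realType.
Notation mR := (measurableTypeR R).
Notation leb := (@lebesgue_measure R).
Notation pos := (`]0%R, +oo[%classic : set R).

Definition pind (v : R) : R := (0 < v)%R%:R.

Lemma integral_pindE (g : R -> R) : (\int[leb]_(v in pos) (g v)%:E = \int[leb]_v (pind v * g v)%:E)%E.
Proof.
rewrite integral_mkcond; apply: eq_integral => v _; rewrite patchE /pind.
have -> : (v \in pos) = (0 < v) by apply/idP/idP; rewrite inE/= in_itv/= andbT.
by case: ifP => _; rewrite ?mul1r ?mul0r.
Qed.

Lemma measurable_pind : measurable_fun setT pind.
Proof. exact: (@measurable_ltR2 _ _ _ (fun=> 0) (fun v : mR => v)). Qed.

Lemma measurable_pindM (h : R -> R) : (forall v : R, 0 < v -> {for v, continuous h}) ->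
  measurable_fun setT (fun v : mR => (pind v * h v)%:E).
Proof.
move=> ch; apply/measurable_EFinP; have mh := measurable_continuous_gt0 ch.
rewrite (_ : (fun v => _) = (h \_ pos)).
  exact: (measurable_restrictT h (measurable_itv _ : @measurable _ mR pos)).1.
apply/funext => v; rewrite patchE /pind.
have -> : (v \in pos) = (0 < v) by apply/idP/idP; rewrite inE/= in_itv/= andbT.
by case: ifP => _; rewrite ?mul1r ?mul0r.
Qed.

(** Substitute [(X / Y) v] for [v]. Here [jw A (1 - m)] is [v^(A-1) (1 + v)^(-(m+A))], the integrand
    of the Beta integral [B(A, m)]. *)
Lemma feynman (A m X Y : R) : 0 < X -> 0 < Y ->
  (\int[leb]_(v in pos) (v `^ (A - 1) * (X + v * Y) `^ (- (m + A)))%:E =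
   (X `^ (- m) * Y `^ (- A))%:E * \int[leb]_(v in pos) (jw A (1 - m) v)%:E)%E.
Proof.
move=> X0 Y0; have c0 : 0 < X / Y by rewrite divr_gt0.
rewrite !integral_pindE.
have pw (g : R -> R) (dg v e : R) : is_derive v 1 g dg -> 0 < g v -> {for v, continuous (fun v => g v `^ e)}.
  by move=> h g0; exact: isd_continuous (@isd_powR R g e v dg g0 h).
have m1 : measurable_fun setT (fun v : mR => (pind v * (v `^ (A - 1) * (X + v * Y) `^ (- (m + A))))%:E).
  apply: measurable_pindM => v v0; apply: continuousM; first exact: pw (isd_id v) v0.
  by apply: pw (isd_add (isd_cst X v) (isd_mul (isd_id v) (isd_cst Y v))) _; rewrite addr_gt0 ?mulr_gt0.
rewrite (ge0_integral_affine 0 (lt0r_neq0 c0) m1); last first.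
  by move=> v; rewrite lee_fin !mulr_ge0 ?powR_ge0.
have m2 := measurableT_comp m1 (measurable_affine (X / Y) 0).
rewrite -ge0_integralZl//; last first.
  by move=> v _; rewrite lee_fin !mulr_ge0 ?powR_ge0.
rewrite -ge0_integralZl//; last 3 first.
- by apply: measurable_pindM => v v0; apply: jw_continuous.
- by move=> v _; rewrite lee_fin !mulr_ge0 ?powR_ge0.
- by rewrite lee_fin !mulr_ge0 ?powR_ge0.
apply: eq_integral => v _; rewrite -!EFinM addr0; congr EFin.
rewrite /pind pmulr_rgt0//; have [v0|_] := ltP 0 v; last by rewrite !mul0r !mulr0.
rewrite !mul1r gtr0_norm// /jw.
have v1 : 0 < 1 + v by rewrite addr_gt0.
rewrite (_ : X + X / Y * v * Y = X * (1 + v)); last by field; rewrite gt_eqF.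
rewrite (_ : 1 - m - A - 1 = - (m + A)); last by ring.
rewrite !powRM ?invr_ge0 ?(ltW X0) ?(ltW Y0) ?(ltW v0) ?(ltW c0) ?(ltW v1)//.
rewrite -powR_inv1 ?(ltW Y0)// -powRrM.
have e1 : X * (X `^ (A - 1) * X `^ (- (m + A))) = X `^ (- m).
  rewrite -powRD ?(gt_eqF X0) ?implybT// -powRS//; congr powR; ring.
have e2 : Y `^ (-1) * Y `^ (-1 * (A - 1)) = Y `^ (- A).
  rewrite -powRD ?(gt_eqF Y0) ?implybT//; congr powR; ring.
rewrite -e1 -e2; ring.
Qed.

End Feynman.

(** * Integrals of multivariate Student weights *)

Section Student.
Variable R : realType.
Notation mR := (measurableTypeR R).
Notation leb := (@lebesgue_measure R).
Notation pos := (`]0%R, +oo[%classic : set R).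

Lemma jw_ge0 A b v : 0 <= jw A b v :> R. Proof. by rewrite mulr_ge0 ?powR_ge0. Qed.

Lemma integral_jw_fin (A b : R) : 0 < A -> b < 1 ->
  (\int[leb]_v (pind v * jw A b v)%:E < +oo)%E.
Proof.
move=> A0 b1; rewrite -integral_pindE.
have /integrableP[_] := integrable_jw A0 b1; apply: le_lt_trans.
under [X in (_ <= X)%E]eq_integral do rewrite /= ger0_norm ?jw_ge0//.
by [].
Qed.

Lemma ler_powRN (x y c : R) : 0 < x -> x <= y -> 0 <= c -> y `^ (- c) <= x `^ (- c).
Proof.
move=> x0 xy c0; have y0 := lt_le_trans x0 xy.
by rewrite !powRN lef_pV2 ?posrE ?powR_gt0// ge0_ler_powR// nnegrE ltW.
Qed.

(** Compare with [h], which is [(1 + v)^(-2 r)] on the open half line, at [v = |x| + 1]: one has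
    [(|x| + 2)^2 <= 8 (1 + x^2)]. The shift by 1 keeps the argument positive at [x = 0], and one
    copy of [h] serves each sign of [x]. *)
Lemma student1_fin (r : R) : 1 / 2 < r -> (\int[leb]_x ((1 + x ^+ 2) `^ (- r))%:E < +oo)%E.
Proof.
move=> r2; have r0 : 0 < r by lra.
pose h (v : mR) : \bar R := (pind v * jw 1 (2 - 2 * r) v)%:E.
have mh : measurable_fun setT h by apply: measurable_pindM => v; exact: jw_continuous.
have h0 v : (0 <= h v)%E by rewrite lee_fin mulr_ge0 ?jw_ge0.
have m1 := measurableT_comp mh (measurable_affine 1 1).
have m2 := measurableT_comp mh (measurable_affine (-1) 1).
have fh : (\int[leb]_v h v < +oo)%E by apply: integral_jw_fin; lra.
have hE v : h v = (pind v * (1 + v) `^ (- (2 * r)))%:E.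
  rewrite /h /pind /jw subrr powRr0 mul1r; congr (_ * _ `^ _)%:E; ring.
apply: (@le_lt_trans _ _ (\int[leb]_x ((8 `^ r)%:E * (h (affine 1 1 x) + h (affine (-1) 1 x))))%E).
  apply: ge0_le_integral => //.
  - by move=> x _; rewrite lee_fin powR_ge0.
  - apply/measurable_EFinP; apply: measurableT_comp (measurable_powR _) _.
    by apply: measurable_funD => //; exact: measurable_funX.
  - apply: emeasurable_funM => //; exact: emeasurable_funD.
  move=> x _; rewrite !hE -EFinD -EFinM lee_fin /affine.
  have x2 : 0 < 1 + x ^+ 2 by rewrite ltr_wpDr ?sqr_ge0.
  have key (y : R) : y ^+ 2 = x ^+ 2 -> 0 <= y -> (1 + x ^+ 2) `^ (- r) <= 8 `^ r * (1 + (y + 1)) `^ (- (2 * r)).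
    move=> yx y0; have y1 : 0 < 1 + (y + 1) by lra.
    have -> : 8 `^ r * (1 + (y + 1)) `^ (- (2 * r)) = ((1 + (y + 1)) ^+ 2 / 8) `^ (- r).
      rewrite powRM ?sqr_ge0// -[8^-1]powR_inv1// -powRrM mulN1r opprK mulrC.
      by rewrite -powR_mulrn ?(ltW y1)// -powRrM; congr (_ `^ _ * _); ring.
    apply: ler_powRN; [by rewrite divr_gt0// exprn_gt0| |exact: ltW].
    by rewrite -yx ler_pdivrMr//; nra.
  have [x0|x0] := leP 0 x.
    apply: (le_trans (key x erefl x0)); rewrite ler_wpM2l ?powR_ge0//.
    rewrite mul1r /pind (_ : 0 < x + 1 = true) ?mul1r; last by apply/idP; lra.
    by rewrite lerDl mulr_ge0 ?powR_ge0.
  have nx : 0 <= - x by lra.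
  apply: (le_trans (key (- x) (sqrrN x) nx)); rewrite ler_wpM2l ?powR_ge0//.
  rewrite mulN1r [X in _ <= _ + X](_ : _ = (1 + (- x + 1)) `^ (- (2 * r))).
    by rewrite lerDr mulr_ge0 ?powR_ge0.
  by rewrite /pind (_ : 0 < - x + 1 = true) ?mul1r//; apply/idP; lra.
rewrite ge0_integralZl//; last 2 first.
- exact: emeasurable_funD.
- by move=> x _; rewrite adde_ge0.
rewrite ge0_integralD//.
have e1 := ge0_integral_affine 1 (oner_neq0 R) mh h0.
have n1 : -1 != 0 :> R by rewrite oppr_eq0 oner_neq0.
have e2 := ge0_integral_affine 1 n1 mh h0.
rewrite normrN normr1 mul1e in e2; rewrite normr1 mul1e in e1.
rewrite -[X in (_ * (X + _))%E]e1 -[X in (_ * (_ + X))%E]e2.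
by rewrite lte_mul_pinfty ?lee_fin ?powR_ge0// lte_add_pinfty.
Qed.

Variable p : nat.
Notation usq := (sqdist (fun=> 0 : R)).
Definition student_integral (c : R) : \bar R := (\int[mt R p]_t ((1 + usq t) `^ (- c))%:E)%E.

(** Write the power as a product of [p] equal factors with exponent [- c / p] and keep only
    [t_i ^ 2] in the [i]-th one. The integral of the resulting product factorizes, each factor
    converging because [c / p > 1/2]. *)
Lemma student_fin c : (0 < p)%N -> p%:R / 2 < c -> (student_integral c < +oo)%E.
Proof.
move=> p0 pc; have pR : 0 < p%:R :> R by rewrite ltr0n.
pose r := c / p%:R.
have r2 : 1 / 2 < r by rewrite /r ltr_pdivlMr//; lra.
have r0 : 0 <= r by lra.
apply: (@le_lt_trans _ _ (\int[mt R p]_t (\prod_i (1 + (tnth t i) ^+ 2) `^ (- r))%:E)%E).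
  apply: ge0_le_integral => //.
  - by move=> t _; rewrite lee_fin powR_ge0.
  - apply/measurable_EFinP; apply: measurableT_comp (measurable_powR _) _.
    by apply: measurable_funD => //; exact: measurable_sqdist.
  - apply/measurable_EFinP; apply: measurable_prod => i _; apply: measurableT_comp (measurable_powR _) _.
    by apply: measurable_funD => //; apply: measurable_funX; exact: measurable_tnth.
  move=> t _; rewrite lee_fin.
  have u0 : 0 < 1 + usq t by rewrite ltr_wpDr ?sqdist_ge0.
  have -> : (1 + usq t) `^ (- c) = \prod_(i < p) (1 + usq t) `^ (- r).
    rewrite prodr_const card_ord -powR_mulrn ?powR_ge0// -powRrM /r; congr powR.
    by field; rewrite gt_eqF.
  apply: ler_prod => i _; rewrite powR_ge0/=.
  have i0 : 0 < 1 + tnth t i ^+ 2 by rewrite ltr_wpDr ?sqr_ge0.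
  apply: ler_powRN => //.
  rewrite lerD2l /sqdist (bigD1 i)//= subr0 lerDl; apply: sumr_ge0 => j _; exact: sqr_ge0.
rewrite (@ge0_integral_prodT R p (fun _ x => (1 + x ^+ 2) `^ (- r))); last 2 first.
- move=> _; apply: measurableT_comp (measurable_powR _) _.
  by apply: measurable_funD => //; exact: measurable_funX.
- by move=> _ x; exact: powR_ge0.
rewrite ltey_eq; apply/orP; left; apply: prode_fin_num => i _.
rewrite ge0_fin_numE; first exact: student1_fin.
by apply: integral_ge0 => x _; rewrite lee_fin powR_ge0.
Qed.

(** On the unit cube, which has measure 1, the integrand is at least [(1 + p)^(-c)]. *)
Lemma student_gt0 c : 0 <= c -> (0 < student_integral c)%E.
Proof.
move=> c0; have p0 : 0 <= p%:R :> R by [].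
pose I : set mR := `[0, 1]%classic.
have mI : measurable_fun setT (\1_I : mR -> R) by apply: measurable_indic; exact: measurable_itv.
apply: (@lt_le_trans _ _ (\int[mt R p]_t (((1 + p%:R) `^ (- c))%:E * (\prod_i \1_I (tnth t i))%:E))%E).
  rewrite ge0_integralZl ?lee_fin ?powR_ge0//; last 2 first.
  - apply/measurable_EFinP; apply: measurable_prod => i _.
    exact: (measurableT_comp mI (@measurable_tnth _ mR p i)).
  - by move=> t _; rewrite lee_fin prodr_ge0// => i _; rewrite indicE.
  rewrite (@ge0_integral_prodT R p (fun=> \1_I))//.
  rewrite big1 ?mule1 ?lte_fin ?powR_gt0 ?ltr_wpDr// => i _.
  rewrite integral_indic ?setIT//; last exact: measurable_itv.
  by apply: etrans (lebesgue_measure_itv `[0, 1]) _; rewrite /= lte_fin ltr01 -EFinD subr0.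
apply: ge0_le_integral => //.
- by move=> t _; rewrite -EFinM lee_fin mulr_ge0 ?powR_ge0// prodr_ge0// => i _; rewrite indicE.
- apply: emeasurable_funM => //; apply/measurable_EFinP; apply: measurable_prod => i _.
  exact: (measurableT_comp mI (@measurable_tnth _ mR p i)).
- apply/measurable_EFinP; apply: measurableT_comp (measurable_powR _) _.
  by apply: measurable_funD => //; exact: measurable_sqdist.
move=> t _; rewrite -EFinM lee_fin.
have [|] := boolP [forall i : 'I_p, tnth t i \in I].
  move=> /forallP tI; rewrite big1 ?mulr1; last by move=> i _; rewrite indicE tI.
  have u0 : 0 < 1 + usq t by rewrite ltr_wpDr ?sqdist_ge0.
  apply: ler_powRN => //.
  rewrite lerD2l /sqdist -[X in _ <= X%:R]card_ord -sumr_const; apply: ler_sum => i _.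
  have := tI i; rewrite inE /I/= in_itv/= subr0 => /andP[h0 h1]; nra.
rewrite negb_forall => /existsP[i /negbTE ti].
by rewrite (bigD1 i)//= indicE ti mul0r mulr0 powR_ge0.
Qed.

(** Substitute [a t + y] for [t] with [a^2 = s / k]; the Jacobian [a^p] supplies the powers of [s]
    and [k]. *)
Lemma student_scale (c s k : R) (y : 'I_p -> R) : 0 < s -> 0 < k ->
  (\int[mt R p]_t ((s + k * sqdist y t) `^ (- c))%:E =
   (s `^ (p%:R / 2 - c) * k `^ (- (p%:R / 2)))%:E * student_integral c)%E.
Proof.
move=> s0 k0; have sk : 0 < s / k by rewrite divr_gt0.
pose a := (s / k) `^ (2^-1).
have a0 : 0 < a by rewrite powR_gt0.
have a2 : a ^+ 2 = s / k.
  by rewrite /a -powR_mulrn ?powR_ge0// -powRrM mulVf// powRr1// ltW.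
have ap : a ^+ p = (s / k) `^ (p%:R / 2).
  rewrite -powR_mulrn ?(ltW a0)// /a -powRrM; congr (_ `^ _); ring.
have mF : measurable_fun setT (fun t : p.-tuple mR => ((s + k * sqdist y t) `^ (- c))%:E).
  apply/measurable_EFinP; apply: measurableT_comp (measurable_powR _) _.
  by apply: measurable_funD => //; apply: measurable_funM => //; exact: measurable_sqdist.
rewrite (ge0_integral_mt_affine y (lt0r_neq0 a0) mF); last by move=> t; rewrite lee_fin powR_ge0.
rewrite gtr0_norm// ap.
have E t : (s + k * sqdist y [tuple a * tnth t i + y i | i < p]) `^ (- c) =
    s `^ (- c) * (1 + usq t) `^ (- c).
  rewrite -powRM ?(ltW s0) ?addr_ge0 ?sqdist_ge0//; congr powR.
  have -> : sqdist y [tuple a * tnth t i + y i | i < p] = a ^+ 2 * usq t.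
    by rewrite /sqdist mulr_sumr; apply: eq_bigr => i _; rewrite tnth_mktuple; ring.
  by rewrite a2; field; rewrite gt_eqF.
under eq_integral do rewrite E EFinM.
rewrite ge0_integralZl ?lee_fin ?powR_ge0//; last 2 first.
- apply/measurable_EFinP; apply: measurableT_comp (measurable_powR _) _.
  by apply: measurable_funD => //; exact: measurable_sqdist.
- by move=> t _; rewrite lee_fin powR_ge0.
rewrite muleA -EFinM; congr (_%:E * _)%E.
rewrite powRM ?(ltW s0) ?invr_ge0 ?(ltW k0)// -[k^-1]powR_inv1 ?(ltW k0)// -powRrM mulN1r.
by rewrite powRD ?(gt_eqF s0) ?implybT//; ring.
Qed.

(* Reflection in [y] exchanges the positive and negative parts of [t_i - y_i], whose
   integrals are finite; with [t^+ + (t - y)^- + y^- = t^- + (t - y)^+ + y^+] this gives the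
   mean without integrating signed functions. *)
Lemma student_mean (c s k : R) (y : 'I_p -> R) i : (0 < p)%N -> p%:R / 2 + 1 < c -> 0 < s -> 0 < k ->
  (\int[mt R p]_t (Num.max (tnth t i) 0 * (s + k * sqdist y t) `^ (- c))%:E +
   (Num.max (- y i) 0)%:E * \int[mt R p]_t ((s + k * sqdist y t) `^ (- c))%:E =
   \int[mt R p]_t (Num.max (- tnth t i) 0 * (s + k * sqdist y t) `^ (- c))%:E +
   (Num.max (y i) 0)%:E * \int[mt R p]_t ((s + k * sqdist y t) `^ (- c))%:E)%E.
Proof.
move=> p0 pc s0 k0; pose w t := (s + k * sqdist y t) `^ (- c).
have w0 t : 0 <= w t by exact: powR_ge0.
have mw : measurable_fun setT w.
  apply: measurableT_comp (measurable_powR _) _.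
  by apply: measurable_funD => //; apply: measurable_funM => //; exact: measurable_sqdist.
have mt_ : measurable_fun setT (fun t : p.-tuple mR => tnth t i) by exact: measurable_tnth.
have mx (g : p.-tuple mR -> R) : measurable_fun setT g ->
    measurable_fun setT (fun t => (Num.max (g t) 0 * w t)%:E).
  by move=> mg; apply/measurable_EFinP; apply: measurable_funM => //; exact: measurable_maxr.
have x0 (g : p.-tuple mR -> R) t : (0 <= (Num.max (g t) 0 * w t)%:E)%E.
  by rewrite lee_fin mulr_ge0// le_max lexx orbT.
have mp : measurable_fun setT (fun t : p.-tuple mR => tnth t i - y i) by exact: measurable_funB.
have mn : measurable_fun setT (fun t : p.-tuple mR => - (tnth t i - y i)) by exact: measurableT_comp.
pose a := (\int[mt R p]_t (Num.max (tnth t i - y i) 0 * w t)%:E)%E.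
have aN : a = (\int[mt R p]_t (Num.max (- (tnth t i - y i)) 0 * w t)%:E)%E.
  have n1 : -1 != 0 :> R by rewrite oppr_eq0 oner_neq0.
  rewrite /a (ge0_integral_mt_affine (fun j => 2 * y j) n1 (mx _ mp)); last by move=> t; exact: (x0 (fun t => tnth t i - y i)).
  rewrite normrN normr1 expr1n mul1e; apply: eq_integral => t _.
  rewrite tnth_mktuple /w (_ : sqdist y _ = sqdist y t); last first.
    by apply: eq_bigr => j _; rewrite tnth_mktuple; ring.
  by congr (Num.max _ _ * _)%:E; ring.
have afin : (a < +oo)%E.
  (* Chosen so that [1 + d <= K (s + k d)] for [0 <= d]: the first moment is bounded by a Student
     integral whose exponent is smaller by one. *)
  pose K := s^-1 + k^-1.
  have K0 : 0 <= K by rewrite addr_ge0// invr_ge0 ltW.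
  have mc : measurable_fun setT (fun t => ((s + k * sqdist y t) `^ (- (c - 1)))%:E).
    apply/measurable_EFinP; apply: measurableT_comp (measurable_powR _) _.
    by apply: measurable_funD => //; apply: measurable_funM => //; exact: measurable_sqdist.
  apply: (@le_lt_trans _ _ (\int[mt R p]_t (K%:E * ((s + k * sqdist y t) `^ (- (c - 1)))%:E))%E).
    apply: ge0_le_integral => //.
    - by move=> t _; exact: (x0 (fun t => tnth t i - y i)).
    - exact: mx.
    - exact: emeasurable_funM.
    move=> t _; rewrite -EFinM lee_fin.
    have d0 := sqdist_ge0 y t.
    have b0 : 0 < s + k * sqdist y t by rewrite ltr_wpDr// mulr_ge0// ltW.
    rewrite (_ : - (c - 1) = - c + 1); last by ring.
    rewrite powRS// mulrA ler_wpM2r// ge_max; apply/andP; split; last by rewrite mulr_ge0// ltW.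
    have le1 : tnth t i - y i <= 1 + sqdist y t.
      apply: (@le_trans _ _ (1 + (tnth t i - y i) ^+ 2)).
        by move: (tnth t i - y i) => z; have := sqr_ge0 (z - 2^-1); nra.
      by rewrite lerD2l /sqdist (bigD1 i)//= lerDl; apply: sumr_ge0 => j _; exact: sqr_ge0.
    apply: (le_trans le1); rewrite (_ : K * _ = 1 + sqdist y t + (s / k + k / s * sqdist y t)).
      rewrite lerDl addr_ge0 ?(ltW (divr_gt0 s0 k0))//.
      by rewrite mulr_ge0// ltW// divr_gt0.
    by rewrite /K; field; rewrite !gt_eqF.
  rewrite ge0_integralZl//; last by move=> t _; rewrite lee_fin powR_ge0.
  rewrite student_scale// lte_mul_pinfty ?lee_fin//.
  rewrite lte_mul_pinfty ?lee_fin ?mulr_ge0 ?powR_ge0//; apply: student_fin => //; lra.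
have mW : measurable_fun setT (EFin \o w) by exact/measurable_EFinP.
have M0 z : (0 <= (Num.max z 0 : R)%:E)%E by rewrite lee_fin le_max lexx orbT.
have wE0 t : (0 <= (EFin \o w) t)%E by rewrite lee_fin.
have ZE (z : R) : ((Num.max z 0)%:E * \int[mt R p]_t ((s + k * sqdist y t) `^ (- c))%:E =
   \int[mt R p]_t ((Num.max z 0)%:E * (w t)%:E))%E by rewrite ge0_integralZl// => t _; exact: wE0.
rewrite !ZE.
have mN : measurable_fun setT (fun t : p.-tuple mR => - tnth t i) by exact: measurableT_comp.
have fa : a \is a fin_num by rewrite ge0_fin_numE//; apply: integral_ge0 => t _; exact: (x0 (fun t => tnth t i - y i)).
have c0 (z : R) t : (0 <= (Num.max z 0)%:E * (w t)%:E)%E by exact: (x0 (fun=> z)).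
have mc (z : R) : measurable_fun setT (fun t => (Num.max z 0)%:E * (w t)%:E)%E by exact: (mx (fun=> z)).
rewrite -(ge0_integralD _ measurableT (fun t _ => x0 _ t) (mx _ mt_) (fun t _ => c0 (- y i) t) (mc _)).
rewrite -(ge0_integralD _ measurableT (fun t _ => x0 _ t) (mx _ mN) (fun t _ => c0 (y i) t) (mc _)).
rewrite -[LHS](addeK _ fa) -[RHS](addeK _ fa); congr (_ - _)%E; rewrite {1}aN /a.
have s0' (g : p.-tuple mR -> R) z t : (0 <= (Num.max (g t) 0 * w t)%:E + (Num.max z 0)%:E * (w t)%:E)%E.
  by rewrite adde_ge0.
have ms (g : p.-tuple mR -> R) z : measurable_fun setT g ->
    measurable_fun setT (fun t => (Num.max (g t) 0 * w t)%:E + (Num.max z 0)%:E * (w t)%:E)%E.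
  by move=> mg; apply: emeasurable_funD; [exact: mx|exact: mc].
rewrite -(ge0_integralD _ measurableT (fun t _ => s0' _ _ t) (ms _ _ mt_) (fun t _ => x0 _ t) (mx _ mn)).
rewrite -(ge0_integralD _ measurableT (fun t _ => s0' _ _ t) (ms _ _ mN) (fun t _ => x0 _ t) (mx _ mp)).
have mxE (z : R) : Num.max z 0 - Num.max (- z) 0 = z.
  have [z0|z0] := leP 0 z; first by rewrite max_r ?subr0// oppr_le0.
  by rewrite max_l ?oppr_ge0 ?(ltW z0)// sub0r opprK.
apply: eq_integral => t _; rewrite -!EFinM -!EFinD -!mulrDl; congr (_ * _)%:E.
have := mxE (tnth t i); have := mxE (y i); have := mxE (tnth t i - y i); lra.
Qed.

End Student.

(** * The posterior as a mixture of Student laws *)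

Section Mixture.
Variable R : realType.
Notation mR := (measurableTypeR R).
Notation leb := (@lebesgue_measure R).
Notation pos := (`]0%R, +oo[%classic : set R).

Lemma integral_pind_jf (A b k w : R) : 0 < A -> b < 1 -> -1 < w ->
  (\int[leb]_v (pind v * jf A b k w v)%:E = (J A b k w)%:E)%E.
Proof.
move=> A0 b1 w1; rewrite -integral_pindE /J.
by rewrite /Rintegral fineK//; apply: integrable_fin_num => //; exact: integrable_jf.
Qed.

Lemma integral_pind_jw (A b : R) : 0 < A -> b < 1 ->
  (\int[leb]_v (pind v * jw A b v)%:E = (J A b 0 0)%:E)%E.
Proof.
move=> A0 b1; rewrite -(integral_pind_jf 0 A0 b1 (ltrN10 R)).
by apply: eq_integral => v _; rewrite /jf oppr0 powRr0 mulr1.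
Qed.

Variables (p : nat) (x : 'I_p -> R) (s : R).
Hypotheses (p0 : (0 < p)%N) (s0 : 0 < s).
Notation usq := (sqdist (fun=> 0 : R)).
Implicit Types (t : p.-tuple mR) (A m b c v : R).

Definition gbwt m A t : R := (sqdist x t + s) `^ (- m) * usq t `^ (- A).

Lemma gbt_ge0 m A t : 0 <= gbwt m A t.
Proof. by rewrite mulr_ge0 ?powR_ge0. Qed.

Lemma measurable_gbt m A : measurable_fun setT (gbwt m A).
Proof.
apply: measurable_funM; apply: measurableT_comp (measurable_powR _) _; last exact: measurable_sqdist.
by apply: measurable_funD => //; exact: measurable_sqdist.
Qed.

(** [J A (1 - m) 0 0] is the Beta constant of [feynman]. That formula is applied for each [t] off a
    null hyperplane, which contains the point [t = 0] where [usq] vanishes; Tonelli then exchanges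
    [t] and [v]. *)
Lemma mixture m A (phi : p.-tuple mR -> R) : 0 < m -> 0 < A ->
  measurable_fun setT phi -> (forall t, 0 <= phi t) ->
  ((J A (1 - m) 0 0)%:E * \int[mt R p]_t (phi t * gbwt m A t)%:E =
   \int[leb]_v ((pind v * v `^ (A - 1))%:E *
     \int[mt R p]_t (phi t * (sqdist x t + s + v * usq t) `^ (- (m + A)))%:E))%E.
Proof.
move=> m0 A0 mphi phi0.
have b1 : 1 - m < 1 by lra.
have JB := integral_pind_jw A0 b1.
have J0 : 0 <= J A (1 - m) 0 0 by apply/ltW/J_gt0 => //; rewrite ltrN10.
pose K (z : p.-tuple mR * mR) : \bar R :=
  (pind z.2 * z.2 `^ (A - 1) * (phi z.1 * (sqdist x z.1 + s + z.2 * usq z.1) `^ (- (m + A))))%:E.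
have mK : measurable_fun setT K.
  have mfst (g : p.-tuple mR -> R) : measurable_fun setT g ->
      measurable_fun setT (fun z : p.-tuple mR * mR => g z.1).
    by move=> mg; exact: measurableT_comp mg measurable_fst.
  have msnd (g : mR -> R) : measurable_fun setT g ->
      measurable_fun setT (fun z : p.-tuple mR * mR => g z.2).
    by move=> mg; exact: measurableT_comp mg measurable_snd.
  apply/measurable_EFinP; apply: measurable_funM.
    exact: (msnd _ (measurable_funM (@measurable_pind R) (measurable_powR (A - 1)))).
  apply: measurable_funM; first exact: mfst.
  apply: measurableT_comp (measurable_powR _) _; apply: measurable_funD.
    by apply: measurable_funD => //; apply: mfst; exact: measurable_sqdist.
  apply: measurable_funM; first exact: (msnd (fun v => v)).
  by apply: mfst; exact: measurable_sqdist.
have K0 z : (0 <= K z)%E by rewrite lee_fin !mulr_ge0 ?powR_ge0.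
have mphiE : measurable_fun setT (fun t => (phi t * gbwt m A t)%:E).
  by apply/measurable_EFinP; apply: measurable_funM => //; exact: measurable_gbt.
rewrite -ge0_integralZl//; last by move=> t _; rewrite lee_fin mulr_ge0 ?gbt_ge0.
transitivity (\int[mt R p]_t \int[leb]_v K (t, v))%E.
  apply: ae_eq_integral => //.
  - exact: emeasurable_funM.
  - exact: (@measurable_fun_fubini_tonelli_F _ _ _ _ _ leb K mK K0).
  pose i0 : 'I_p := Ordinal p0.
  exists [set t | tnth t i0 = 0]; split.
  - have -> : [set t : p.-tuple mR | tnth t i0 = 0] =
       setT `&` (fun t : p.-tuple mR => tnth t i0) @^-1` [set (0:R)].
      by rewrite setTI; apply/seteqP; split.
    by apply: (@measurable_tnth _ mR p i0) => //; exact: measurable_set1.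
  - exact: mt_coord0.
  move=> t /=; apply: contra_notP => tn0 _.
  have Y0 : 0 < usq t.
    rewrite /sqdist (bigD1 i0)//= subr0 ltr_pwDl//.
      by rewrite exprn_even_gt0//=; apply/eqP.
    by apply: sumr_ge0 => l _; exact: sqr_ge0.
  have X0 : 0 < sqdist x t + s by rewrite ltr_wpDl ?sqdist_ge0.
  have fe := @feynman R A m _ _ X0 Y0.
  rewrite !integral_pindE JB in fe.
  transitivity ((phi t)%:E * \int[leb]_v (pind v * (v `^ (A - 1) * (sqdist x t + s + v * usq t) `^ (- (m + A))))%:E)%E.
    by rewrite fe /gbwt -!EFinM; congr EFin; ring.
  rewrite -ge0_integralZl//.
  - by apply: eq_integral => v _; rewrite -EFinM; congr EFin; rewrite /=; ring.
  - apply/measurable_EFinP; apply: measurable_funM; first exact: measurable_pind.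
    apply: measurable_funM; first exact: measurable_powR.
    apply: measurableT_comp (measurable_powR _) _; apply: measurable_funD => //.
    exact: measurable_funM.
  - by move=> v _; rewrite lee_fin !mulr_ge0 ?powR_ge0.
  - by rewrite lee_fin.
rewrite (@fubini_tonelli _ _ _ _ _ (mt R p) leb K mK K0).
apply: eq_integral => v _; rewrite -ge0_integralZl//.
- apply/measurable_EFinP; apply: measurable_funM => //.
  apply: measurableT_comp (measurable_powR _) _; apply: measurable_funD.
    by apply: measurable_funD => //; exact: measurable_sqdist.
  by apply: measurable_funM => //; exact: measurable_sqdist.
- by move=> t _; rewrite lee_fin mulr_ge0 ?powR_ge0.
- by rewrite lee_fin mulr_ge0 ?powR_ge0.
Qed.

Let q := \sum_i x i ^+ 2.
Let q0 : 0 <= q. Proof. by apply: sumr_ge0 => i _; exact: sqr_ge0. Qed.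
Let w := q / s.
Let w0 : 0 <= w. Proof. by rewrite divr_ge0// ltW. Qed.
Let w1 : -1 < w. Proof. by apply: lt_le_trans w0; rewrite ltrN10. Qed.

Lemma complete_square t v : 0 < v ->
  sqdist x t + s + v * usq t = s * (1 + w * lam v) + (1 + v) * sqdist (fun i => x i / (1 + v)) t.
Proof.
move=> v0; have v1 : 0 < 1 + v by rewrite addr_gt0.
have -> : s * (1 + w * lam v) = s + lam v * q by rewrite /w; field; rewrite gt_eqF.
suff : sqdist x t + v * usq t = lam v * q + (1 + v) * sqdist (fun i => x i / (1 + v)) t by lra.
rewrite /sqdist /q !mulr_sumr -!big_split/=; apply: eq_bigr => i _.
by rewrite /lam; field; rewrite gt_eqF.
Qed.

Variables (A D b : R).
Hypotheses (A0 : 0 < A) (D0 : 0 < D) (b1 : b < 1) (pE : p%:R / 2 = A + 1 - b).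

(** After completing the square the inner integral is a scaled Student integral. Its factor
    [(1 + v)^(- p/2)] joins [v^(A - 1)] to form [jw A b] because [p/2 = A + 1 - b]; this relation is
    what determines [b]. *)
Lemma mixture_mass (r v : R) : 0 < v ->
  ((v `^ (A - 1))%:E * \int[mt R p]_t ((sqdist x t + s + v * usq t) `^ (- (r + p%:R / 2)))%:E =
  (s `^ (- r) * jf A b r w v)%:E * student_integral p (r + p%:R / 2))%E.
Proof.
move=> v0; have v1 : 0 < 1 + v by rewrite addr_gt0.
have bp := base_gt0 w1 v0.
under eq_integral do rewrite complete_square//.
rewrite student_scale ?mulr_gt0// muleA -EFinM; congr (_%:E * _)%E.
rewrite (_ : p%:R / 2 - (r + p%:R / 2) = - r); last by ring.
rewrite powRM ?(ltW s0) ?(ltW bp)// /jf /jw (_ : b - A - 1 = - (p%:R / 2)); last by rewrite pE; ring.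
ring.
Qed.

(** The exponent is left free because finiteness of the first moment also uses the mass at exponent
    [r - 1]. *)
Lemma gbt_mass (r : R) : 0 < r + p%:R / 2 - A -> p%:R / 2 < r + p%:R / 2 ->
  ((J A (1 - (r + p%:R / 2 - A)) 0 0)%:E * \int[mt R p]_t (gbwt (r + p%:R / 2 - A) A t)%:E =
  (s `^ (- r) * J A b r w)%:E * student_integral p (r + p%:R / 2))%E.
Proof.
move=> m0 r0; have := @mixture _ _ (fun=> 1) m0 A0 (measurable_cst _) (fun=> ler01).
under eq_integral do rewrite mul1r.
move=> ->.
transitivity (\int[leb]_v ((s `^ (- r) )%:E * ((pind v * jf A b r w v)%:E * student_integral p (r + p%:R / 2))))%E.
  apply: eq_integral => v _; rewrite /pind; have [v0|_] := ltP 0 v; last by rewrite !mul0r !mul0e mule0.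
  rewrite !mul1r muleA -EFinM -mixture_mass//; congr (_ * _)%E.
  by apply: eq_integral => t _; rewrite mul1r subrK.
have mj : measurable_fun setT (fun v : mR => (pind v * jf A b r w v)%:E).
  by apply: measurable_pindM => v; exact: jf_continuous.
have st0 : (0 <= student_integral p (r + p%:R / 2))%E by apply: integral_ge0 => t _; rewrite lee_fin powR_ge0.
rewrite ge0_integralZl ?lee_fin ?powR_ge0//; last 2 first.
- exact: emeasurable_funM.
- by move=> v _; rewrite mule_ge0// lee_fin mulr_ge0 ?mulr_ge0 ?powR_ge0.
rewrite ge0_integralZr//; last by move=> v _; rewrite lee_fin mulr_ge0 ?mulr_ge0 ?powR_ge0.
by rewrite integral_pind_jf// muleA -EFinM.
Qed.

Notation r := (A + D + 1).
Notation m := (D + p%:R / 2 + 1).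
Notation stm := (student_integral p (r + p%:R / 2)).

Let mE : r + p%:R / 2 - A = m. Proof. ring. Qed.
Let r0 : 0 < r. Proof. by move: A0 D0; lra. Qed.

Let pp0 : 0 <= p%:R / 2 :> R. Proof. by rewrite divr_ge0. Qed.

Let fin_mass c : 0 < c + p%:R / 2 - A -> 0 < c ->
  (\int[mt R p]_t (gbwt (c + p%:R / 2 - A) A t)%:E < +oo)%E.
Proof.
move=> c1 c0; have cp : p%:R / 2 < c + p%:R / 2 by lra.
have h := gbt_mass c1 cp.
have J0 : 0 < J A (1 - (c + p%:R / 2 - A)) 0 0 by by apply: J_gt0; rewrite ?ltrN10//; lra.
have : ((J A (1 - (c + p%:R / 2 - A)) 0 0)%:E * \int[mt R p]_t (gbwt (c + p%:R / 2 - A) A t)%:E < +oo)%E.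
  rewrite h; apply: lte_mul_pinfty => //; last exact: student_fin.
  by rewrite lee_fin; apply: mulr_ge0; [exact: powR_ge0|exact/ltW/J_gt0].
case: (\int[mt R p]_t _)%E => [z| |]; rewrite ?ltry// ?ltNyr//.
by rewrite gt0_muley ?lte_fin.
Qed.

(** From [|t_i| <= |x_i| + 1 + |x - t|^2], the moment is bounded by masses of [gbwt] with first
    exponent [m] and [m - 1], and both are finite. *)
Lemma gbt_moment_fin i (g : R -> R) : measurable_fun setT g -> (forall z, 0 <= g z <= `|z|) ->
  (\int[mt R p]_t (g (tnth t i) * gbwt m A t)%:E < +oo)%E.
Proof.
move=> mg gb; pose m1 := D + p%:R / 2.
have f1 : (\int[mt R p]_t (gbwt m A t)%:E < +oo)%E.
  by rewrite -mE; apply: fin_mass => //; move: D0 pp0; lra.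
have f2 : (\int[mt R p]_t (gbwt m1 A t)%:E < +oo)%E.
  have -> : m1 = (A + D) + p%:R / 2 - A by rewrite /m1; ring.
  by apply: fin_mass; move: A0 D0 pp0; lra.
have mE1 c : measurable_fun setT (fun t => (gbwt c A t)%:E).
  by apply/measurable_EFinP; exact: measurable_gbt.
have E0 c t : (0 <= (gbwt c A t)%:E)%E by rewrite lee_fin gbt_ge0.
apply: (@le_lt_trans _ _ (\int[mt R p]_t ((`|x i| + 1)%:E * (gbwt m A t)%:E + (gbwt m1 A t)%:E))%E).
  apply: ge0_le_integral => //.
  - by move=> t _; rewrite lee_fin mulr_ge0 ?gbt_ge0//; have /andP[] := gb (tnth t i).
  - apply/measurable_EFinP; apply: measurable_funM; last exact: measurable_gbt.
    by apply: measurableT_comp mg _; exact: measurable_tnth.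
  - by apply: emeasurable_funD => //; exact: emeasurable_funM.
  move=> t _; rewrite -EFinM -EFinD lee_fin.
  have X0 : 0 < sqdist x t + s by rewrite ltr_wpDl ?sqdist_ge0.
  have -> : gbwt m1 A t = (sqdist x t + s) * gbwt m A t.
    rewrite /gbwt mulrA -powRS//; congr (_ `^ _ * _); rewrite /m1; ring.
  rewrite -mulrDl ler_wpM2r ?gbt_ge0//; have /andP[_] := gb (tnth t i); move/le_trans; apply.
  rewrite -[tnth t i](subrK (x i)); apply: le_trans (ler_normD _ _) _; rewrite addrC -addrA lerD2l.
  apply: (@le_trans _ _ (1 + (tnth t i - x i) ^+ 2)).
    rewrite -[X in _ <= 1 + X]real_normK ?num_real//.
    by move: `|_| => z; have := sqr_ge0 (z - 2^-1); nra.
  rewrite lerD2l; apply: le_trans (_ : sqdist x t <= _); last by rewrite lerDl ltW.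
  by rewrite /sqdist (bigD1 i)//= lerDl; apply: sumr_ge0 => j _; exact: sqr_ge0.
rewrite ge0_integralD//; last 2 first.
- by move=> t _; rewrite mule_ge0.
- exact: emeasurable_funM.
rewrite ge0_integralZl// lte_add_pinfty// lte_mul_pinfty//.
Qed.

Lemma gbt_mean i :
  ((J A (1 - m) 0 0)%:E * \int[mt R p]_t (Num.max (tnth t i) 0 * gbwt m A t)%:E +
    (Num.max (- x i) 0 * (s `^ (- r) * (J A b r w - J (A + 1) b r w)))%:E * stm =
   (J A (1 - m) 0 0)%:E * \int[mt R p]_t (Num.max (- tnth t i) 0 * gbwt m A t)%:E +
    (Num.max (x i) 0 * (s `^ (- r) * (J A b r w - J (A + 1) b r w)))%:E * stm)%E.
Proof.
have mi : measurable_fun setT (fun t : p.-tuple mR => tnth t i) by exact: measurable_tnth.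
have m0 : 0 < m by move: D0 pp0; lra.
have mx (g : p.-tuple mR -> R) : measurable_fun setT g -> measurable_fun setT (fun t => Num.max (g t) 0).
  by move=> mg; exact: measurable_maxr.
have x0 (z : R) : 0 <= Num.max z 0 by rewrite le_max lexx orbT.
have mN : measurable_fun setT (fun t : p.-tuple mR => - tnth t i) by exact: measurableT_comp.
rewrite (mixture m0 A0 (mx _ mi) (fun t => x0 _)) (mixture m0 A0 (mx _ mN) (fun t => x0 _)).
have mA : m + A = r + p%:R / 2 by ring.
rewrite mA.
have J1 : J A b r w - J (A + 1) b r w >= 0 by rewrite subr_ge0 ltW// J_lt.
have st0 : (0 <= stm)%E by apply: integral_ge0 => t _; rewrite lee_fin powR_ge0.
have dj v : 0 < v -> jf A b r w v - jf (A + 1) b r w v = jf A b r w v / (1 + v).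
  by move=> v0; rewrite jfS// /lam; field; rewrite gt_eqF// addr_gt0.
have dj0 v : 0 <= pind v * (jf A b r w v / (1 + v)).
  rewrite /pind; have [v0|_] := ltP 0 v; last by rewrite mul0r.
  by rewrite mul1r divr_ge0 ?addr_ge0 ?(ltW v0)// ltW// jf_gt0.
have mdj : measurable_fun setT (fun v : mR => (pind v * (jf A b r w v / (1 + v)))%:E).
  apply: measurable_pindM => v v0; have v1 : 1 + v != 0 by rewrite gt_eqF// addr_gt0.
  apply: continuousM; first exact: jf_continuous.
  exact: isd_continuous (isd_inv v1 (isd_add (isd_cst 1 v) (isd_id v))).
have intdj : (\int[leb]_v (pind v * (jf A b r w v / (1 + v)))%:E = (J A b r w - J (A + 1) b r w)%:E)%E.
  have A1 : 0 < A + 1 by rewrite addr_gt0.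
  have JfE : (\int[leb]_v (pind v * (jf A b r w v / (1 + v)))%:E + (J (A + 1) b r w)%:E = (J A b r w)%:E)%E.
    rewrite -!integral_pind_jf// -ge0_integralD//.
    - apply: eq_integral => v _; rewrite -EFinD -mulrDr /pind; have [v0|_] := ltP 0 v; last by rewrite !mul0r.
      by rewrite -dj// subrK.
    - by move=> v _; rewrite lee_fin.
    - by move=> v _; rewrite lee_fin !mulr_ge0 ?powR_ge0.
    - by apply: measurable_pindM => v; exact: jf_continuous.
  by rewrite EFinB -JfE addeK.
have massE (z : R) : ((Num.max z 0 * (s `^ (- r) * (J A b r w - J (A + 1) b r w)))%:E * stm =
   \int[leb]_v ((pind v * v `^ (A - 1))%:E * ((Num.max (pind v * (z / (1 + v))) 0)%:E *
       \int[mt R p]_t ((sqdist x t + s + v * usq t) `^ (- (r + p%:R / 2)))%:E)))%E.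
  transitivity (\int[leb]_v ((Num.max z 0 * s `^ (- r))%:E * ((pind v * (jf A b r w v / (1 + v)))%:E * stm)))%E.
    rewrite ge0_integralZl ?lee_fin ?mulr_ge0 ?powR_ge0//; last 2 first.
    - exact: emeasurable_funM.
    - by move=> v _; rewrite mule_ge0// lee_fin.
    rewrite ge0_integralZr//; last by move=> v _; rewrite lee_fin.
    by rewrite intdj muleA -EFinM mulrA.
  apply: eq_integral => v _; rewrite /pind; have [v0|_] := ltP 0 v; last by rewrite !mul0r !mul0e mule0.
  have v1 : 0 < 1 + v by rewrite addr_gt0.
  rewrite !mul1r [RHS]muleCA mixture_mass// !muleA -!EFinM; congr (_%:E * _)%E.
  have -> : Num.max (z / (1 + v)) 0 = Num.max z 0 / (1 + v).
    by rewrite maxr_pMl ?invr_ge0 ?(ltW v1)// mul0r.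
  by ring.
rewrite !massE.
pose P (g : p.-tuple mR -> R) (v : mR) : \bar R := ((pind v * v `^ (A - 1))%:E *
   \int[mt R p]_t (Num.max (g t) 0 * (sqdist x t + s + v * usq t) `^ (- (r + p%:R / 2)))%:E)%E.
pose Q (z : R) (v : mR) : \bar R := ((pind v * v `^ (A - 1))%:E * ((Num.max (pind v * (z / (1 + v))) 0)%:E *
       \int[mt R p]_t ((sqdist x t + s + v * usq t) `^ (- (r + p%:R / 2)))%:E))%E.
have mpw : measurable_fun setT (fun v : mR => (pind v * v `^ (A - 1))%:E).
  apply/measurable_EFinP; apply: measurable_funM; first exact: measurable_pind.
  exact: measurable_powR.
have pw0 v : (0 <= (pind v * v `^ (A - 1))%:E)%E by rewrite lee_fin mulr_ge0 ?powR_ge0.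
have P0 g v : (0 <= P g v)%E.
  by rewrite mule_ge0//; apply: integral_ge0 => t _; rewrite lee_fin mulr_ge0 ?powR_ge0.
have Q0 z v : (0 <= Q z v)%E.
  apply: mule_ge0; [exact: pw0|apply: mule_ge0; first by rewrite lee_fin; exact: x0].
  by apply: integral_ge0 => t _; rewrite lee_fin; exact: powR_ge0.
have mI (h : p.-tuple mR -> R) : measurable_fun setT h -> (forall t, 0 <= h t) ->
    measurable_fun setT (fun v : mR => \int[mt R p]_t (h t * (sqdist x t + s + v * usq t) `^ (- (r + p%:R / 2)))%:E)%E.
  move=> mh h0.
  pose f (z : mR * p.-tuple mR) := (h z.2 * (sqdist x z.2 + s + z.1 * usq z.2) `^ (- (r + p%:R / 2)))%:E.
  have mf : measurable_fun setT f.
    have msnd (g : p.-tuple mR -> R) : measurable_fun setT g ->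
        measurable_fun setT (fun z : mR * p.-tuple mR => g z.2).
      by move=> mg; exact: measurableT_comp mg measurable_snd.
    apply/measurable_EFinP; apply: measurable_funM; first exact: msnd.
    apply: measurableT_comp (measurable_powR _) _; apply: measurable_funD.
      by apply: measurable_funD => //; apply: msnd; exact: measurable_sqdist.
    by apply: measurable_funM; [exact: measurable_fst|apply: msnd; exact: measurable_sqdist].
  have f0 z : (0 <= f z)%E by rewrite lee_fin mulr_ge0 ?powR_ge0.
  exact: (@measurable_fun_fubini_tonelli_F _ _ _ _ _ (mt R p) f mf f0).
have mP g : measurable_fun setT g -> measurable_fun setT (P g).
  by move=> mg; apply: emeasurable_funM => //; apply: mI => //; exact: mx.
have mQ z : measurable_fun setT (Q z).
  apply: emeasurable_funM => //; apply: emeasurable_funM.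
    apply/measurable_EFinP; apply: measurable_maxr => //; apply/measurable_EFinP.
    apply: measurable_pindM => v v0; have v1 : 1 + v != 0 by rewrite gt_eqF// addr_gt0.
    apply: continuousM; first exact: cst_continuous.
    exact: isd_continuous (isd_inv v1 (isd_add (isd_cst 1 v) (isd_id v))).
  have := mI (fun=> 1) (measurable_cst _) (fun=> ler01).
  by apply: eq_measurable_fun => v _; apply: eq_integral => t _; rewrite mul1r.
have PQ g z : measurable_fun setT g ->
    (\int[leb]_v P g v + \int[leb]_v Q z v = \int[leb]_v (P g v + Q z v))%E.
  by move=> mg; symmetry; apply: ge0_integralD => //; exact: mP.
apply: (etrans (PQ _ (- x i) mi)); apply: etrans (esym (PQ _ (x i) mN)).
apply: eq_integral => v _; rewrite /P /Q /pind; have [v0|_] := ltP 0 v; last by rewrite !mul0r !mul0e.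
have v1 : 0 < 1 + v by rewrite addr_gt0.
have I0 (h : p.-tuple mR -> R) : (forall t, 0 <= h t) ->
    (0 <= \int[mt R p]_t (h t * (sqdist x t + s + v * usq t) `^ (- (r + p%:R / 2)))%:E)%E.
  by move=> h0; apply: integral_ge0 => t _; rewrite lee_fin mulr_ge0 ?powR_ge0.
have M0 (z : R) : (0 <= (Num.max z 0)%:E *
    \int[mt R p]_t ((sqdist x t + s + v * usq t) `^ (- (r + p%:R / 2)))%:E)%E.
  apply: mule_ge0; first by rewrite lee_fin; exact: x0.
  by apply: integral_ge0 => t _; rewrite lee_fin; exact: powR_ge0.
rewrite !mul1r; apply: etrans (esym (ge0_muleDr _ (I0 _ (fun t => x0 _)) (M0 _))) _.
apply: etrans (ge0_muleDr _ (I0 _ (fun t => x0 _)) (M0 _)).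
congr (_ * _)%E.
have sE t : (sqdist x t + s + v * usq t) `^ (- (r + p%:R / 2)) =
  (s * (1 + w * lam v) + (1 + v) * sqdist (fun i => x i / (1 + v)) t) `^ (- (r + p%:R / 2)).
  by rewrite complete_square.
have e1 (h : p.-tuple mR -> R) : (\int[mt R p]_t (h t * (sqdist x t + s + v * usq t) `^ (- (r + p%:R / 2)))%:E =
  \int[mt R p]_t (h t * (s * (1 + w * lam v) + (1 + v) * sqdist (fun i => x i / (1 + v)) t) `^ (- (r + p%:R / 2)))%:E)%E.
  by apply: eq_integral => t _; rewrite sE.
have e2 : (\int[mt R p]_t ((sqdist x t + s + v * usq t) `^ (- (r + p%:R / 2)))%:E =
  \int[mt R p]_t ((s * (1 + w * lam v) + (1 + v) * sqdist (fun i => x i / (1 + v)) t) `^ (- (r + p%:R / 2)))%:E)%E.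
  by apply: eq_integral => t _; rewrite sE.
rewrite (e1 (fun t => Num.max (tnth t i) 0)) (e1 (fun t => Num.max (- tnth t i) 0)) e2.
have c1 : p%:R / 2 + 1 < r + p%:R / 2 by move: A0 D0; lra.
have sp : 0 < s * (1 + w * lam v) := mulr_gt0 s0 (base_gt0 w1 v0).
rewrite mulNr; exact: (student_mean (fun i => x i / (1 + v)) i p0 c1 sp v1).
Qed.

(** The Beta constant, the power of [s] and the Student integral cancel in the ratio. The integrals
    enter through variables so that, once known to be finite, they can be replaced by real
    numbers. *)
Lemma gbt_ratio i (P N I : \bar R) :
  P = (\int[mt R p]_t (Num.max (tnth t i) 0 * gbwt m A t)%:E)%E ->
  N = (\int[mt R p]_t (Num.max (- tnth t i) 0 * gbwt m A t)%:E)%E ->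
  I = (\int[mt R p]_t (gbwt m A t)%:E)%E ->
  fine (P - N) / fine I = (1 - psi A b r w) * x i.
Proof.
move=> PE NE IE.
have np (z : R) : 0 <= Num.max z 0 <= `|z|.
  by rewrite le_max lexx orbT ge_max ler_norm normr_ge0.
have nn (z : R) : 0 <= Num.max (- z) 0 <= `|z| by rewrite -normrN.
have mid : measurable_fun setT (fun z : R => z) by exact: measurable_id.
have int0 (g : p.-tuple mR -> R) : (forall t, 0 <= g t) -> (0 <= \int[mt R p]_t (g t * gbwt m A t)%:E)%E.
  by move=> g0; apply: integral_ge0 => t _; rewrite lee_fin mulr_ge0 ?gbt_ge0.
have x0 (z : R) : 0 <= Num.max z 0 by rewrite le_max lexx orbT.
have Pf : P \is a fin_num.
  rewrite PE ge0_fin_numE ?int0//.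
  by apply: (gbt_moment_fin i (g := fun z => Num.max z 0)) => //; exact: measurable_maxr.
have Nf : N \is a fin_num.
  rewrite NE ge0_fin_numE ?int0//.
  apply: (gbt_moment_fin i (g := fun z => Num.max (- z) 0)) => //.
  by apply: measurable_maxr => //; exact: measurableT_comp.
have rp : p%:R / 2 < r + p%:R / 2 by move: r0; lra.
have m0 : 0 < m by move: D0 pp0; lra.
have stf : stm \is a fin_num.
  by rewrite ge0_fin_numE; [exact: student_fin|apply: integral_ge0 => t _; rewrite lee_fin powR_ge0].
have mE' : r + p%:R / 2 - A = m by ring.
have If : I \is a fin_num.
  rewrite IE ge0_fin_numE; last by apply: integral_ge0 => t _; rewrite lee_fin gbt_ge0.
  by rewrite -mE'; apply: fin_mass => //; rewrite mE'.
have := gbt_mean i; rewrite -PE -NE.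
have := @gbt_mass r; rewrite mE' -IE => /(_ m0 rp).
have st0 : (0 < stm)%E by apply: student_gt0; move: r0 pp0; lra.
have J0 : 0 < J A (1 - m) 0 0 by apply: J_gt0; rewrite ?ltrN10//; lra.
have JA : 0 < J A b r w by exact: J_gt0.
have sp : 0 < s `^ (- r) by exact: powR_gt0.
move: Pf Nf If stf st0; rewrite /psi.
case: (P) => [P'| |]// _; case: (N) => [N'| |]// _; case: (I) => [I'| |]// _; case: (stm) => [S| |]// _.
rewrite lte_fin => S0; rewrite -!EFinM -!EFinD => -[eI] [eM] /=.
have xE : Num.max (x i) 0 - Num.max (- x i) 0 = x i.
  have [z0|z0] := leP 0 (x i); first by rewrite max_r ?subr0// oppr_le0.
  by rewrite max_l ?oppr_ge0 ?(ltW z0)// sub0r opprK.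
rewrite -[in RHS]xE; move: eI eM.
move: (J A (1 - m) 0 0) (J A b r w) (J (A + 1) b r w) (s `^ (- r)) J0 JA sp => c jA jA1 sr c0 jA0 sr0.
move: (Num.max (x i) 0) (Num.max (- x i) 0) => xp xn eI eM.
have I0 : I' = sr * jA * S / c by apply/(mulfI (lt0r_neq0 c0)); rewrite eI; field; rewrite gt_eqF.
have PN : P' - N' = (xp - xn) * (sr * (jA - jA1)) * S / c.
  apply/(mulfI (lt0r_neq0 c0)); rewrite mulrBr.
  rewrite [RHS](_ : _ = (xp - xn) * (sr * (jA - jA1)) * S); last by field; rewrite gt_eqF.
  by rewrite !mulrBl; move: (c * P') (c * N') (xp * _ * S) (xn * _ * S) eM => c1 c2 c3 c4; lra.
by rewrite PN I0; field; rewrite !gt_eqF.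
Qed.

End Mixture.

Section GBayes.
Variable R : realType.
Notation mR := (measurableTypeR R).
Variables (p n : nat) (a e : R) (x : 'rV[R]_p) (s : R).
Let A : R := p%:R / 2 + a + 1.
Let b : R := a + 2.
Let D : R := n%:R / 2 + e - a.
Hypotheses (p0 : (0 < p)%N) (A0 : 0 < A) (b1 : b < 1) (D0 : 0 < D) (s0 : 0 < s).

(** The first exponent in [gbw] is [- (D + p/2 + 1)] and the prior is [(|t|^2)^(-A)], so [gbw] is
    [gbwt] at these parameters; [p/2 = A + 1 - b] holds because [b = a + 2]. *)
Lemma gbayesE : gbayes n a e x s = (1 - psi A b (A + D + 1) (sqnorm x / s)) *: x.
Proof.
apply/rowP => i; rewrite !mxE.
pose xs j := x ord0 j.
have gE (t : p.-tuple mR) : gbw n a e x s (rv t) = gbwt xs s (D + p%:R / 2 + 1) A t.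
  rewrite /gbw /gbwt; congr (_ `^ _ * _ `^ _).
  - congr (_ + _); apply: eq_bigr => j _; rewrite !mxE /xs; ring.
  - by rewrite /D natrD; lra.
  - by apply: eq_bigr => j _; rewrite !mxE subr0.
have gbw0 t : 0 <= gbw n a e x s t by rewrite mulr_ge0 ?powR_ge0.
have mg := measurable_gbt xs s (D + p%:R / 2 + 1) A.
have mi : measurable_fun setT (fun t : p.-tuple mR => tnth t i) by exact: measurable_tnth.
have maxM (z g : R) : 0 <= g -> Num.max (z * g) 0 = Num.max z 0 * g.
  by move=> g0; rewrite maxr_pMl// mul0r.
have maxN (z g : R) : 0 <= g -> Num.max (- (z * g)) 0 = Num.max (- z) 0 * g.
  by move=> g0; rewrite -mulNr maxM.
have x0 (z : R) : 0 <= Num.max z 0 by rewrite le_max lexx orbT.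
have E (F : 'rV[R]_p -> R) (h : p.-tuple mR -> R) : measurable_fun setT h ->
    (forall v, 0 <= F v) -> (forall t, F (rv t) = h t) ->
    intRn (fun v => (F v)%:E) = (\int[mt R p]_t (h t)%:E)%E.
  move=> mh F0 Fh; rewrite intRnE//; first by apply: eq_integral => t _; rewrite Fh.
  by apply/measurable_EFinP; apply: eq_measurable_fun mh => t _; rewrite Fh.
have pE : p%:R / 2 = A + 1 - b by rewrite /A /b; ring.
rewrite -[RHS](gbt_ratio (x := xs) (i := i) p0 s0 A0 D0 b1 pE erefl erefl erefl); congr (_ / _).
  rewrite /RintRn; congr (fine (_ - _)); apply: E => //.
  - by apply: measurable_funM => //; exact: measurable_maxr.
  - by move=> t; rewrite mxE gE maxM ?gbt_ge0.
  - by apply: measurable_funM => //; apply: measurable_maxr => //; exact: measurableT_comp.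
  - by move=> t; rewrite mxE gE maxN ?gbt_ge0.
rewrite /RintRn.
rewrite (E _ (gbwt xs s (D + p%:R / 2 + 1) A))//; last by move=> t; rewrite gE max_l ?gbt_ge0.
rewrite (E _ (fun=> 0))//; last by move=> t; rewrite gE max_r ?oppr_le0 ?gbt_ge0.
by rewrite integral0 sube0.
Qed.

End GBayes.

(** * The parameter conditions *)

Section Conditions.
Variable R : realType.
Implicit Types (P N a e : R).

Let A P a := P / 2 + a + 1.
Let b a := a + 2.
Let D N a e := N / 2 + e - a.

(** Since [2 (A - b) = P - 2 = (N/2 + 1) c], the bound on [a] is equivalent to the first inequality,
    in the form [A <= c D]. For [e <= - N/4 - 3/2] one has [c (N/2 + e) - P/2 - 1 <= -2 (1 + c)],
    hence [a <= -2] and [b <= 0]. *)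
Lemma params_ok_small_e P N a e : 3 <= P -> 1 <= N -> - (P / 2) - 1 < a ->
  e <= - (N / 4) - 3 / 2 ->
  a <= (2 * (P - 2) / (N + 2) * (N / 2 + e) - P / 2 - 1) / (1 + 2 * (P - 2) / (N + 2)) ->
  params_ok (A P a) (b a) (D N a e) N.
Proof.
move=> P3 N1 a1 e1; have N2 : 0 < N + 2 by lra.
set c := 2 * (P - 2) / (N + 2).
have c0 : 0 < c by rewrite /c !mulr_gt0 ?invr_gt0//; lra.
have cE : c * (N + 2) = 2 * (P - 2) by rewrite /c; field; rewrite gt_eqF.
rewrite ler_pdivlMr ?addr_gt0// => h.
have A0 : 0 < A P a by rewrite /A; lra.
have AD : A P a <= c * D N a e by rewrite /A /D; clearbody c; nra.
have D0 : 0 < D N a e by rewrite -(pmulr_rgt0 _ c0) (lt_le_trans A0).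
have a2 : a <= -2 by clearbody c; nra.
have ineq : (N / 2 + 1) * A P a <= 2 * (A P a - b a) * D N a e.
  have -> : 2 * (A P a - b a) = (N / 2 + 1) * c by rewrite /A /b; lra.
  by rewrite -mulrA ler_pM2l//; lra.
rewrite /b in ineq *; split => //; [lra|lra|].
have [ba|ba] := ltP (a + 2) 0; first by left.
(* At the boundary [b = 0] the extra term of the second alternative vanishes, so the same inequality
   proves it. *)
have -> : a = -2 by lra.
right; have aE : a = -2 by lra.
by move: ineq; rewrite aE addNr !mul0r mulr0 mul0r addr0.
Qed.

(** [g] is twice the difference of the two sides in the second alternative, and it opens upwards.
    The signs at [-2] and [-1], that is at [b = 0] and [b = 1], place [astar] strictly between them;
    on [[-2, astar]], [a] lies between the roots. *)
Lemma params_ok_large_e P N a e astar : 3 <= P -> 2 <= N -> - (P / 2) - 1 < a ->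
  - (N / 4) - 3 / 2 < e ->
  let g x := (2 * P + 2 * N + 4 * e + 4) * x ^+ 2
    + x * (2 * P ^+ 2 + 2 * P * N + 12 * P + 7 * N + 4 * (P + 3) * e + 10)
    + 4 * P ^+ 2 + 7 / 2 * P * N + 6 * (P + 2) * e + 7 * N + 13 * P + 10 in
  g astar = 0 -> (forall x, g x = 0 -> x <= astar) -> a <= astar ->
  params_ok (A P a) (b a) (D N a e) N.
Proof.
move=> P3 N2 a1 e1 g g0 gmax aas.
have A0 : 0 < A P a by rewrite /A; lra.
have gE x : g x = 2 * ((N / 2 + 1) * A P x + 2 * (b x * (2 * A P x + 1 - b x)) * (A P x + D N x e)
    - 2 * (A P x - b x) * D N x e).
  by rewrite /g /A /b /D; field.
set L := 2 * P + 2 * N + 4 * e + 4.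
have L0 : 0 < L by rewrite /L; lra.
set B := 2 * P ^+ 2 + 2 * P * N + 12 * P + 7 * N + 4 * (P + 3) * e + 10.
set K := 4 * P ^+ 2 + 7 / 2 * P * N + 6 * (P + 2) * e + 7 * N + 13 * P + 10.
have gq x : g x = L * x ^+ 2 + x * B + K by rewrite /g /L /B /K; ring.
(* The other root, from the sum of the roots. *)
pose a' := - B / L - astar.
have gf x : g x = L * (x - astar) * (x - a').
  have KE : K = - (L * astar ^+ 2 + astar * B) by move: g0; rewrite gq; lra.
  by rewrite gq KE /a'; field; rewrite gt_eqF.
have a's : a' <= astar by apply: gmax; rewrite gf subrr mulr0.
have gm2 : g (-2) < 0.
  rewrite (_ : g (-2) = - ((P - 2) * (N / 2 + 2 * e + 3))); last by rewrite /g; field.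
  by rewrite oppr_lt0 mulr_gt0//; lra.
(* The last summand needs [N/2 + e + 1 > 0], which follows from [e > - N/4 - 3/2] and [2 <= N]. The
   same inequality gives [D > 0] below, as [a < -1]. *)
have gm1 : 0 < g (-1).
  rewrite gE (_ : _ - _ = (N / 2 + 1) * (P / 2) + P ^+ 2 + (P + 2) * (N / 2 + e + 1)); last first.
    by rewrite /A /b /D; field.
  rewrite mulr_gt0// addr_gt0//; last by rewrite mulr_gt0//; lra.
  by rewrite addr_gt0 ?exprn_gt0 ?mulr_gt0//; lra.
have s2 : a' < -2 < astar.
  move: gm2; rewrite gf -mulrA pmulr_rlt0// => h; nra.
have /andP[a'2 s2'] := s2.
have s1 : astar < -1.
  have h1 : 0 < -1 - a' by lra.
  by move: gm1; rewrite gf pmulr_lgt0// pmulr_rgt0//; lra.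
have ga : -2 <= a -> g a <= 0.
  move=> a2; rewrite gf; have h1 : 0 <= a - a' by lra.
  by rewrite mulr_le0_ge0// mulr_ge0_le0 ?(ltW L0)//; lra.
have b1 : b a < 1 by rewrite /b; lra.
have D0 : 0 < D N a e by rewrite /D; lra.
split => //; first lra.
(* For [a < -2] one has [A < P/2 - 1] and [D > N/4 + 1/2], which already give
   [(N/2 + 1) A <= (P - 2) D]; [g] is used only from [-2] on. *)
have [a2|a2] := ltP a (-2).
  left; split; first by rewrite /b; lra.
  have AE : 2 * (A P a - b a) = P - 2 by rewrite /A /b; field.
  rewrite AE /A /D; nra.
right; split; first by rewrite /b; lra.
by have := ga a2; rewrite gE; lra.
Qed.

End Conditions.

Section Shrinkage.
Variable R : realType.
Variables (A b D N : R).
Hypothesis ok : params_ok A b D N.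

Lemma dpsi_continuous (w : R) : -1 < w -> {for w, continuous (dpsi A b (A + D + 1))}.
Proof.
case: ok => A0 b1 D0 _ _ w1.
have A1 : 0 < A + 1 by rewrite addr_gt0.
have A2 : 0 < A + 2 by rewrite addr_gt0.
have cJ A' k : 0 < A' -> {for w, continuous (J A' b k)}.
  by move=> A'0; exact: isd_continuous (isd_J k A'0 b1 w1).
have J0 : J A b (A + D + 1) w ^+ 2 != 0 by rewrite expf_neq0// gt_eqF// J_gt0.
apply: continuousM; last first.
  apply: continuousV => //.
  by apply: (@continuousM _ _ (J A b (A + D + 1))); exact: cJ.
apply: continuousM; first exact: cst_continuous.
by apply: continuousB; apply: continuousM; exact: cJ.
Qed.

End Shrinkage.

Section Main.
Variables (R : realType) (p n : nat) (f : R -> R) (a e : R).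

Lemma gbayes_minimax : (0 < p)%N -> (0 < n)%N -> measurable_fun [set: R] f ->
  (forall t : R, 0 <= t -> 0 <= f t) ->
  params_ok (p%:R / 2 + a + 1) (a + 2) (n%:R / 2 + e - a) n%:R ->
  @minimax R p n f (@gbayes R p n a e).
Proof.
move=> p0 n0 mf f0 ok theta eta eta0; have [A0 b1 D0 _ _] := ok.
have [Y [_ phiY]] := phi_bounded ok; have [C dC] := dpsi_bounded ok.
apply: (@risk_shrink_le R p n f theta eta mf f0 eta0 _ _ _ _ _ Y C phiY dC) => //.
- by move=> w w0; apply: isd_psi => //; exact: lt_le_trans w0.
- by move=> w w0; apply: (dpsi_continuous ok); exact: lt_le_trans w0.
- move=> w w0; have w1 : -1 < w by exact: lt_le_trans w0.
  by rewrite !ltW ?psi_gt0 ?psi_lt1.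
- move=> w w0; apply: le_trans (riskdiff_le0 ok w0); rewrite /Th /Xi.
  by rewrite (_ : 2 * (_ + 1 - _) = p%:R); [rewrite le_eqVlt; apply/orP; left; apply/eqP; ring|field].
- by move=> x s s0; exact: gbayesE.
Qed.
End Main.

Theorem theorem4p1 (R : realType) (p n : nat) (f : R -> R) (a e : R) :
  (3 <= p)%N -> (1 <= n)%N ->
  measurable_fun [set: R] f ->
  (forall t : R, 0 <= t -> 0 <= f t) ->
  (\int[@lebesgue_measure R]_(t in `[0%R, +oo[%classic)
       (powR t ((p + n)%:R / 2 - 1) * f t)%:E < +oo)%E ->
  (forall (theta : 'rV[R]_p) (eta : R), 0 < eta ->
     intRn (fun x : 'rV[R]_p => intRn (fun z : 'rV[R]_n =>
        (dens f theta eta x z)%:E)) = 1%E) ->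
  (\int[@lebesgue_measure R]_(t in `[0%R, +oo[%classic)
       (powR t ((n + p)%:R / 2 - a + e) * f t)%:E < +oo)%E ->
  ((- (p%:R / 2) - n%:R / 2 - 1 < e /\ e <= - (n%:R / 4) - 3 / 2 /\
    - (p%:R / 2) - 1 < a /\
    a <= (cpn R p n * (n%:R / 2 + e) - p%:R / 2 - 1) / (1 + cpn R p n))
   -> @minimax R p n f (@gbayes R p n a e)) /\
  ((- (n%:R / 4) - 3 / 2 < e /\ (2 <= n)%N /\ - (p%:R / 2) - 1 < a /\
    exists astar : R, gpoly p n e astar = 0 /\
      (forall b : R, gpoly p n e b = 0 -> b <= astar) /\ a <= astar)
   -> @minimax R p n f (@gbayes R p n a e)).
Proof.
move=> p3 n1 mf f0 _ _ _.
have p3R : 3 <= p%:R :> R by rewrite ler_nat.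
have n1R : 1 <= n%:R :> R by rewrite ler1n.
have p0 : (0 < p)%N by exact: leq_trans p3.
split=> [[_ [e1 [a1 a2]]]|[e1 [n2 [a1 [astar [g0 [gmax aas]]]]]]]; apply: gbayes_minimax => //.
  exact: params_ok_small_e a2.
by apply: (params_ok_large_e (astar := astar)) => //; rewrite ler_nat.
Qed.
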